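(* Let $(M,g)$ be a smooth Lorentzian manifold of dimension $n+1$, let $\gamma_0:[0,\ell]\to M$ be a lightlike geodesic, let $\mathcal M=Z\times A$ parametrize the lightlike geodesics $\gamma_{z,a}:[0,\ell]\to M$ near $\gamma_0$, let $\Omega\subset M$ be open and relatively compact with all endpoints $\gamma_{z,a}(0),\gamma_{z,a}(\ell)$, $(z,a)\in\overline{\mathcal M}$, outside $\overline\Omega$, and let $$L_\kappa f(\gamma)=\int_0^\ell\kappa(\gamma(s),\dot\gamma(s))f(\gamma(s))\,ds,\qquad\gamma=\gamma_{z,a},\ (z,a)\in\mathcal M,$$ where $\kappa$ is a smooth weight, positively homogeneous of degree $1$ in the second variable. Let $S\Subset\Omega$ be compact with nonempty interior, and let $\delta,r>0$ and $K_r=\{f\in H^\delta_S(\Omega):\|f\|_{H^\delta(\Omega)}\le r\}$. Suppose that $\omega$ is a modulus of continuity such that $$\|f_1-f_2\|_{L^2(\Omega)}\le\omega\big(\|L_\kappa f_1-L_\kappa f_2\|_{L^2(\mathcal M)}\big),\qquad f_1,f_2\in K_r.$$ Then for every $\alpha\in(0,1)$, $\omega(t)\gtrsim t^\alpha$ for small $t$.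
   Context: Setting and parametrization. $g$ has signature $(-,+,\dots,+)$. Choose a spacelike hypersurface $H$ containing $\gamma_0(0)$ and semigeodesic coordinates $(t,z)\in(-T,T)\times Z\subset\mathbb R\times\mathbb R^n$ associated with $H$, in which $H=\{t=0\}$ and $g=-dt^2+g'(t,z)$ with $g'(t,\cdot)$ a Riemannian metric on $Z$ depending smoothly on $t$, and such that $\gamma_0(0)=0$ and $\dot\gamma_0(0)=(1,\theta_0)$. Put $h=g'(0,\cdot)$, so $|\theta_0|_h=1$. On the $h$-unit sphere bundle $SZ$ choose local coordinates $(z,a)\in Z\times A$, $A\subset\mathbb R^{n-1}$, via $(z,a)\mapsto(z,\theta(z,a))$ with $\theta(0,0)=\theta_0$. Then $\gamma_{z,a}$ is the lightlike geodesic with $\gamma_{z,a}(0)=(0,z)$ and $\dot\gamma_{z,a}(0)=(1,\theta(z,a))$, and $\mathcal M=Z\times A$ (with $L^2(\mathcal M)$ taken with respect to $dz\,da$). $Z$ and $A$ are taken small enough that $\gamma_{z,a}$ is defined on $[0,\ell]$ with endpoints outside $\overline\Omega$ for all $(z,a)\in\overline{\mathcal M}$. The considerations are local: one restricts, if necessary, to a neighborhood in $\mathcal M\times(0,\ell)$ on which $(z,a,s)\mapsto(z,a,\gamma_{z,a}(s))$ is injective. Sobolev spaces. For a closed Riemannian manifold $(M_1,g_1)$, $\|u\|_{H^s(M_1)}=\|(1-\Delta_{g_1})^{s/2}u\|_{L^2(M_1)}$. With an auxiliary Riemannian metric fixed on $\Omega$ and a fixed closed Riemannian manifold $M_1$ containing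 a neighborhood of $S$ on which the metrics agree, $H^s_S(\Omega)=\{u\in H^s(M_1):\operatorname{supp}u\subset S\}$, with the norm of $H^s(M_1)$. $L_\kappa$ is extended from $C_0^\infty(\Omega)$ to such functions by continuity. Modulus of continuity: a nondecreasing function $\omega:[0,\infty)\to[0,\infty)$ with $\omega(t)\to0=\omega(0)$ as $t\to0^+$. $\omega(t)\gtrsim h(t)$ for small $t$ means: there exist $c,t_0>0$ with $\omega(t)\ge c\,h(t)$ for $0<t<t_0$. *)

(* Defs.v *)
From HB Require Import structures.
From mathcomp Require Import all_boot all_order all_algebra.
From mathcomp Require Import all_classical all_reals all_analysis measurable_realfun.
From mathcomp Require Import lra.
Import Order.TTheory GRing.Theory Num.Theory.
Import numFieldNormedType.Exports.
Set Implicit Arguments.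
Unset Strict Implicit.
Unset Printing Implicit Defensive.
Local Open Scope classical_set_scope.
Local Open Scope ring_scope.

(* The Borel sigma-algebra of T. *)
Definition borel (T : ptopologicalType) := g_sigma_algebraType (@open T).

Lemma borel_open (T : ptopologicalType) (U : set T) :
  open U -> measurable (U : set (borel T)).
Proof. by move=> oU; apply: sub_sigma_algebra. Qed.

Section lebesgue.
Variable R : realType.

Definition vcons n (p : measurableTypeR R * borel 'rV[R]_n) : borel 'rV[R]_n.+1 :=
  row_mx (p.1 : R)%:M (p.2 : 'rV[R]_n) : 'rV[R]_(1 + n).

Definition vuncons n (x : borel 'rV[R]_n.+1) : measurableTypeR R * borel 'rV[R]_n :=
  ((x : 'rV[R]_n.+1) 0 0, rsubmx (x : 'rV[R]_(1 + n))).

Lemma vcons0 n p : (@vcons n p : 'rV[R]_n.+1) 0 0 = p.1.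
Proof.
have -> : (0 : 'I_n.+1) = lshift n (0 : 'I_1) by apply: val_inj.
by apply: etrans (row_mxEl _ _ _ _) _; rewrite mxE eqxx mulr1n.
Qed.

Lemma vconsS n p j : (@vcons n p : 'rV[R]_n.+1) 0 (rshift 1 j) = p.2 0 j.
Proof. exact: row_mxEr. Qed.

Lemma vec_ord n (P : 'I_n.+1 -> Prop) :
  P 0 -> (forall j : 'I_n, P (rshift 1 j)) -> forall i, P i.
Proof.
move=> P0 PS i; have [j ->|j ->] := split_ordP (i : 'I_(1 + n)); last exact: PS.
by rewrite ord1; have -> : lshift n (0 : 'I_1) = (0 : 'I_n.+1) by apply: val_inj.
Qed.

Lemma vunconsK n : cancel (@vuncons n) (@vcons n).
Proof.
move=> x; apply/rowP; apply: vec_ord => [|j]; first by rewrite vcons0.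
by rewrite vconsS mxE.
Qed.

Lemma vconsK n : cancel (@vcons n) (@vuncons n).
Proof.
move=> [t z]; rewrite /vuncons vcons0; congr pair.
exact: (row_mxKr (t%:M : 'rV[R]_1) z).
Qed.

Lemma measurable_vcons n : measurable_fun setT (@vcons n).
Proof.
refine (@measurability _ _ _ _ setT (@vcons n) (@open _) _ _) => // _ [U oU <-].
rewrite setTI.
pose B (i : 'rV[rat]_n.+1 * nat) : set 'rV[R]_n.+1 :=
  ball (map_mx ratr i.1 : 'rV[R]_n.+1) i.2.+1%:R^-1.
pose F i : set (measurableTypeR R * borel 'rV[R]_n) :=
  [set p | B i `<=` U /\ B i (vcons p)].
suff -> : @vcons n @^-1` U = \bigcup_i F i.
  apply: countable_bigcupT_measurable => [|i]; first exact: countableP.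
  have [BU|nBU] := pselect (B i `<=` U); last first.
    rewrite (_ : F i = set0); first exact: measurable0.
    by apply/seteqP; split => // p [].
  pose x := map_mx ratr i.1 : 'rV[R]_n.+1; pose e : R := i.2.+1%:R^-1.
  rewrite (_ : F i = (ball (x 0 0) e : set (measurableTypeR R)) `*`
     (ball (rsubmx (x : 'rV[R]_(1 + n))) e : set (borel 'rV[R]_n))); last first.
    apply/seteqP; split=> [p [_ [e0 Bp]]|p [/= h1 [e0 h2]]] /=.
      split; first by have := Bp 0 0; rewrite vcons0.
      by split => // a b; rewrite ord1 mxE; have := Bp 0 (rshift 1 b); rewrite vconsS.
    split => //; split => // a; rewrite ord1; apply: vec_ord => [|b].
      by rewrite vcons0.
    by rewrite vconsS; have := h2 0 b; rewrite mxE.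
  apply: measurableX; first exact: measurable_ball.
  apply: (@borel_open _ (ball (rsubmx (x : 'rV[R]_(1 + n))) e)); apply: ball_open; rewrite invr_gt0.
apply/seteqP; split=> [p Up|p [i _ [BU Bi]]]; last exact: BU.
have /nbhs_ballP[e /= e0 eU] : nbhs (vcons p : 'rV[R]_n.+1) U.
  exact: open_nbhs_nbhs.
have [k ke] : exists k, (k.+1%:R^-1 : R) < e / 2.
  have e20 : 0 < (e / 2)^-1 by rewrite invr_gt0 divr_gt0.
  exists (Num.bound (e / 2)^-1); rewrite invf_plt ?posrE ?divr_gt0//.
  by apply: lt_trans (archi_boundP (ltW e20)) _; rewrite ltr_nat.
have /choice[q Hq] : forall j, exists q : rat,
    `|(vcons p : 'rV[R]_n.+1) 0 j - ratr q| < k.+1%:R^-1.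
  move=> j; set y := fun_of_matrix _ _ _; set d := _^-1.
  have d0 : 0 < d :> R by rewrite invr_gt0.
  have [|q] := @rat_in_itvoo R (y - d) (y + d); first lra.
  by rewrite in_itv /= => /andP[h1 h2]; exists q; rewrite ltr_norml; apply/andP; split; lra.
have k0 : (0 : R) < k.+1%:R^-1 by rewrite invr_gt0.
exists (\row_j q j, k) => //; split; last first.
  split => // a b; rewrite ord1 /ball/= distrC.
  suff -> : (map_mx ratr (\row_j q j) : 'rV[R]_n.+1) 0 b = ratr (q b) by [].
  by rewrite !mxE.
move=> y [_ By]; apply: eU; split => // a b; rewrite ord1 /ball/=.
apply: le_lt_trans (ler_distD (ratr (q b)) _ _) _.
have h : `|ratr (q b) - y 0 b| < k.+1%:R^-1 by have := By 0 b; rewrite !mxE.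
have := Hq b; move: ke h; rewrite -/(vcons p 0 b).
set u := `|_ - y 0 b|; set v := `|_ - ratr _|; set w := k.+1%:R^-1; lra.
Qed.

Lemma measurable_vuncons n : measurable_fun setT (@vuncons n).
Proof.
apply/measurable_fun_pairP; split.
  refine (@measurability _ _ _ _ setT (fst \o @vuncons n) _ (RGenOpens.measurableE R) _).
  move=> _ [U [a [b ->]] <-]; rewrite setTI.
  apply: (@borel_open _ ((fun x : 'rV[R]_n.+1 => x 0 0) @^-1` _)).
  have oI : open (`]a, b[%classic : set R) by exact: interval_open.
  by apply: (open_comp _ oI) => x _; exact: (@coord_continuous _ _ _ 0 0).
refine (@measurability _ _ _ _ setT (snd \o @vuncons n) (@open _) _ _) => // _ [U oU <-].
rewrite setTI.
apply: (@borel_open _ ((fun x : 'rV[R]_n.+1 => rsubmx (x : 'rV_(1 + n))) @^-1` U)).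
apply: (@open_comp _ _ (fun x : 'rV[R]_n.+1 => rsubmx (x : 'rV_(1 + n)))) => // x _.
have Fx := nbhs_filter (x : 'rV[R]_n.+1).
apply/cvg_ballP => e e0; apply: filterS (nbhsx_ballx (x : 'rV[R]_n.+1) e e0) => y [_ xy].
by split => // i j; rewrite !mxE ord1.
Qed.

Definition leb0 : set (borel 'rV[R]_0) -> \bar R :=
  @dirac _ (borel 'rV[R]_0) (0 : 'rV[R]_0) R.
HB.instance Definition _ := Measure.on leb0.
Lemma leb0_sigma_finite : sigma_finite setT leb0.
Proof.
exists (fun=> setT); first by rewrite bigcup_const.
by move=> i; split => //; rewrite /leb0 diracT ltry.
Qed.
HB.instance Definition _ := Measure_isSigmaFinite.Build _ _ _ leb0 leb0_sigma_finite.

Definition lebS n (mu : {sigma_finite_measure set (borel 'rV[R]_n) -> \bar R}) :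
    set (borel 'rV[R]_n.+1) -> \bar R :=
  pushforward (@lebesgue_measure R \x mu)%E (@vcons n).

Section lebS.
Variables (n : nat) (mu : {sigma_finite_measure set (borel 'rV[R]_n) -> \bar R}).
Let mv := @measurable_vcons n.
Let lebS_0 : lebS mu set0 = 0%E. Proof. exact: measure0. Qed.
Let lebS_ge0 A : (0 <= lebS mu A)%E. Proof. exact: measure_ge0. Qed.
Let lebS_additive : semi_sigma_additive (lebS mu).
Proof. exact: measure_semi_sigma_additive. Qed.
HB.instance Definition _ := isMeasure.Build _ _ _ (lebS mu) lebS_0 lebS_ge0 lebS_additive.
Let lebS_sigma_finite : sigma_finite setT (lebS mu).
Proof.
have /sigma_finiteP[F [FT ndF Foo]] := sigma_finiteT (@lebesgue_measure R).
have /sigma_finiteP[G [GT ndG Goo]] := sigma_finiteT mu.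
exists (fun k => @vuncons n @^-1` (F k `*` G k)).
  rewrite -preimage_bigcup -[LHS](preimage_setT (@vuncons n)); congr (_ @^-1` _).
  rewrite -setXTT FT GT predeqE => -[x y]; split => [[/= [i _ Fx] [j _ Gy]]|].
    exists (maxn i j) => //; split.
      by move: x Fx; exact/subsetPset/ndF/leq_maxl.
    by move: y Gy; exact/subsetPset/ndG/leq_maxr.
  by move=> [i _ [/= Fx Gy]]; split; exists i.
move=> k; have [mF Fk] := Foo k; have [mG Gk] := Goo k; split.
  rewrite -[X in measurable X]setTI; apply: measurable_vuncons => //.
  exact: measurableX.
rewrite /lebS /pushforward [X in (_ X < _)%E](_ : _ = F k `*` G k); last first.
  by apply/funext => p; rewrite /preimage /mkset vconsK.
by rewrite product_measure1E// lte_mul_pinfty// ge0_fin_numE.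
Qed.
HB.instance Definition _ := Measure_isSigmaFinite.Build _ _ _ (lebS mu) lebS_sigma_finite.
End lebS.

(* Lebesgue measure on the Borel sets of R^n, as an iterated product measure. *)
Fixpoint leb n : {sigma_finite_measure set (borel 'rV[R]_n) -> \bar R} :=
  if n is m.+1 then lebS (leb m) else leb0.
End lebesgue.

Section calculus.
Variable R : realType.

Definition partial m (i : 'I_m) (f : 'rV[R]_m -> R) : 'rV[R]_m -> R :=
  'D_(delta_mx 0 i) f.

(* C^oo on an open set: every iterated partial derivative exists and is
   differentiable, hence continuous, at each point of U. *)
Definition smooth_on m (U : set 'rV[R]_m) (f : 'rV[R]_m -> R) :=
  forall (s : seq 'I_m) x, U x -> differentiable (foldr (@partial m) f s) x.

Definition smooth_map_on m k (U : set 'rV[R]_m) (F : 'rV[R]_m -> 'rV[R]_k) :=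
  forall j, smooth_on U (fun x => F x 0 j).

Definition posdef m (A : 'M[R]_m) :=
  A^T = A /\ forall v : 'rV[R]_m, v != 0 -> 0 < (v *m A *m v^T) 0 0.

End calculus.

(* cphi and cpsi are total functions; only their values on cdom and on
   cim = cphi (cdom) are meaningful. *)
Record chart (R : realType) (T : topologicalType) (d : nat) := Chart {
  cdom : set T;
  cphi : T -> 'rV[R]_d;
  cpsi : 'rV[R]_d -> T;
  cim := cphi @` cdom;
  cdom_open : open cdom;
  cim_open : open cim;
  cphiK : forall p, cdom p -> cpsi (cphi p) = p;
  cphi_continuous : forall p, cdom p -> {for p, continuous cphi};
  cpsi_continuous : forall x, cim x -> {for x, continuous cpsi} }.

Definition smooth_transition (R : realType) (T : topologicalType) d
    (c c' : chart R T d) :=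
  smooth_map_on (cphi c @` (cdom c `&` cdom c')) (cphi c' \o cpsi c).

(* A smooth structure is a maximal atlas.  The tangent space at p is identified
   with 'rV_d through the coordinates of the preferred chart [chart_at p]; row
   vectors are multiplied by Jacobian matrices on the right. *)
Record manifold (R : realType) (d : nat) := Manifold {
  carrier :> ptopologicalType;
  atlas : set (chart R carrier d);
  chart_at : carrier -> chart R carrier d;
  manifold_hausdorff : hausdorff_space carrier;
  manifold_second_countable : @second_countable carrier;
  chart_at_atlas : forall p, atlas (chart_at p);
  chart_at_dom : forall p, cdom (chart_at p) p;
  atlas_smooth : forall c c', atlas c -> atlas c' -> smooth_transition c c';
  atlas_maximal : forall c,
    (forall c', atlas c' -> smooth_transition c c' /\ smooth_transition c' c) ->
    atlas c }.

Section geometry.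
Variables (R : realType) (d : nat).
Implicit Types M : manifold R d.

Definition smooth_function M (u : M -> R) :=
  forall c, atlas c -> smooth_on (cim c) (u \o cpsi c).

Definition smooth_between M M1 (U : set M) (F : M -> M1) :=
  (forall p, U p -> {for p, continuous F}) /\
  forall (c : chart R M d) (c1 : chart R M1 d), atlas c -> atlas c1 ->
    smooth_map_on (cphi c @` (cdom c `&` U `&` F @^-1` cdom c1))
                  (cphi c1 \o F \o cpsi c).

Definition tangent_map M M1 (F : M -> M1) (p : M) : 'M[R]_d :=
  jacobian (cphi (chart_at (F p)) \o F \o cpsi (chart_at p))
           (cphi (chart_at p) p).

(* Rows: the coordinate vector fields of c at cpsi c x, as tangent vectors. *)
Definition coord_frame M (c : chart R M d) (x : 'rV[R]_d) : 'M[R]_d :=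
  jacobian (cphi (chart_at (cpsi c x)) \o cpsi c) x.

(* Matrix, in the coordinates of c, of a field g of bilinear forms. *)
Definition gram M (g : M -> 'M[R]_d) (c : chart R M d) (x : 'rV[R]_d) : 'M[R]_d :=
  coord_frame c x *m g (cpsi c x) *m (coord_frame c x)^T.

Definition smooth_form M (U : set M) (g : M -> 'M[R]_d) :=
  forall c, atlas c -> forall i j,
    smooth_on (cphi c @` (cdom c `&` U)) (fun x => gram g c x i j).

Definition riemannian M (U : set M) (g : M -> 'M[R]_d) :=
  smooth_form U g /\ forall p, U p -> posdef (g p).

Definition christoffel M (g : M -> 'M[R]_d) c x (k i j : 'I_d) : R :=
  let G a b := fun y => gram g c y a b in
  2^-1 * \sum_l invmx (gram g c x) k l *
    (partial i (G j l) x + partial j (G i l) x - partial l (G i j) x).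

(* |G|^(-1/2) d_i (|G|^(1/2) G^(ij) d_j f) in the coordinates of c *)
Definition laplacian M (g : M -> 'M[R]_d) c (f : 'rV[R]_d -> R) (x : 'rV[R]_d) : R :=
  let vol y := Num.sqrt (\det (gram g c y)) in
  (vol x)^-1 * \sum_i partial i
    (fun y => vol y * \sum_j invmx (gram g c y) i j * partial j f y) x.

Definition is_volume M (U : set M) (g : M -> 'M[R]_d)
    (mu : {measure set (borel M) -> \bar R}) :=
  forall c (B : set (borel M)), atlas c -> measurable B -> B `<=` U `&` cdom c ->
  mu B = (\int[leb R d]_(x in (cphi c : borel M -> borel 'rV[R]_d) @` B)
            (Num.sqrt (\det (gram g c x)))%:E)%E.

Definition velocity M (gam : R -> M) (s : R) : 'rV[R]_d :=
  derive1 (cphi (chart_at (gam s)) \o gam) s.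

Definition geodesic_on M (g : M -> 'M[R]_d) (I : set R) (gam : R -> M) :=
  forall s, I s -> {for s, continuous gam} /\
  forall c, atlas c -> cdom c (gam s) ->
    let x := cphi c \o gam in
    [/\ derivable x s 1, derivable (derive1 x) s 1 &
        forall k, derive1 (derive1 x) s 0 k = - \sum_i \sum_j
          christoffel g c (x s) k i j * derive1 x s 0 i * derive1 x s 0 j].

(* A geodesic on the closed interval [0, l] is the restriction of a geodesic on
   a slightly larger open interval; the values of gam elsewhere are irrelevant. *)
Definition lightlike_geodesic M (g : M -> 'M[R]_d) (l : R) (gam : R -> M) :=
  (exists2 eps, 0 < eps & geodesic_on g `]- eps, l + eps[ gam) /\
  forall s, 0 <= s <= l -> velocity gam s != 0 /\
    velocity gam s *m g (gam s) *m (velocity gam s)^T = 0.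

Definition smooth_weight M (kappa : M -> 'rV[R]_d -> R) :=
  (forall c, atlas c ->
     smooth_on [set y : 'rV[R]_(d + d) | cim c (lsubmx y) /\ rsubmx y != 0]
       (fun y => kappa (cpsi c (lsubmx y))
                       (rsubmx y *m coord_frame c (lsubmx y)))) /\
  forall p v t, v != 0 -> 0 < t -> kappa p (t *: v) = t * kappa p v.

Definition weighted_ray_transform M (kappa : M -> 'rV[R]_d -> R) (l : R)
    (f : M -> R) (gam : R -> M) : R :=
  \int[lebesgue_measure]_(s in `[0, l])
     (kappa (gam s) (velocity gam s) * f (gam s)).

(* iota is a diffeomorphism of N onto an open set, with inverse iotaV. *)
Definition isometric_open_embedding M M1 (G : M -> 'M[R]_d) (g1 : M1 -> 'M[R]_d)
    (N : set M) (iota : M -> M1) (iotaV : M1 -> M) :=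
  [/\ open N /\ open (iota @` N),
      forall p, N p -> iotaV (iota p) = p,
      smooth_between N iota, smooth_between (iota @` N) iotaV &
      forall p, N p ->
        G p = tangent_map iota p *m g1 (iota p) *m (tangent_map iota p)^T].

End geometry.

Definition lorentzian (R : realType) n (M : manifold R n.+1)
    (g : M -> 'M[R]_n.+1) :=
  smooth_form setT g /\ forall p, (g p)^T = g p /\
  exists2 P : 'M[R]_(1 + n), P \in unitmx &
    P *m g p *m P^T = block_mx (-1)%:M 0 0 1%:M.

Section L2.
Context d (T : measurableType d) (R : realType).
Variable mu : {measure set T -> \bar R}.

Definition L2norm (D : set T) (f : T -> R) : \bar R :=
  Lnorm mu 2%:E (EFin \o (f \_ D)).

Definition in_L2 (D : set T) (f : T -> R) :=
  measurable_fun D f /\ (L2norm D f < +oo)%E.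

Definition L2dot (f h : T -> R) : R := \int[mu]_x (f x * h x).

End L2.

Section sobolev.
Variables (R : realType) (d : nat) (M1 : manifold R d).
Variables (g1 : M1 -> 'M[R]_d) (mu1 : {measure set (borel M1) -> \bar R}).

(* A complete orthonormal system of L^2(M1) made of smooth eigenfunctions of
   - Laplacian; eigenvalues are repeated according to multiplicity. *)
Definition eigenbasis (e : nat -> M1 -> R) (lam : nat -> R) :=
  [/\ forall j, smooth_function (e j),
      forall j c x, atlas c -> cim c x ->
        - laplacian g1 c (e j \o cpsi c) x = lam j * e j (cpsi c x),
      forall i j, L2dot mu1 (e i) (e j) = (i == j)%:R &
      forall u, in_L2 mu1 setT u -> (forall j, L2dot mu1 u (e j) = 0) ->
        {ae mu1, forall p, u p = 0}].

Variables (e : nat -> M1 -> R) (lam : nat -> R).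

(* v = (1 - Laplacian)^(s/2) u in L^2(M1), by functional calculus. *)
Definition bessel (s : R) (u v : M1 -> R) :=
  [/\ in_L2 mu1 setT u, in_L2 mu1 setT v &
      forall j, L2dot mu1 v (e j) = (1 + lam j) `^ (s / 2) * L2dot mu1 u (e j)].

Definition ess_support (u : M1 -> R) : set M1 :=
  ~` \bigcup_(U in [set U : set M1 | open U /\ {ae mu1, forall p, U p -> u p = 0}]) U.

(* The ball of radius r of the space of u in H^s(M1) with supp u in S1. *)
Definition sobolev_ball (S1 : set M1) (s r : R) (u : M1 -> R) :=
  ess_support u `<=` S1 /\
  exists2 v, bessel s u v & (L2norm mu1 setT v <= r%:E)%E.

Definition sobolev_cvg (s : R) (f : nat -> M1 -> R) (u : M1 -> R) :=
  exists2 v : nat -> M1 -> R, forall k, bessel s (f k \- u) (v k) &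
    (L2norm mu1 setT (v k) @[k --> \oo] --> 0)%E.

End sobolev.

Section parametrization.
Variables (R : realType) (n : nat).

Definition pt (t : R) (z : 'rV[R]_n) : 'rV[R]_n.+1 := row_mx t%:M z : 'rV_(1 + n).

(* The hypersurface H of the construction is cpsi c {t = 0}; it is spacelike
   because g' is positive definite. *)
Definition semigeodesic (M : manifold R n.+1) (g : M -> 'M[R]_n.+1)
    (c : chart R M n.+1) (T : R) (Z0 : set 'rV[R]_n) (g' : R -> 'rV[R]_n -> 'M[R]_n) :=
  [/\ atlas c, cim c = [set pt t z | t in `](- T), T[ & z in Z0] &
      forall t z, - T < t < T -> Z0 z ->
        posdef (g' t z) /\
        gram g c (pt t z) = (block_mx (-1)%:M 0 0 (g' t z) : 'M[R]_(1 + n))].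

(* (z, a) |-> (z, theta z a) is the inverse of a coordinate system of the unit
   sphere bundle: a smooth injective map into it that is an immersion, the
   dimensions 2n - 1 being equal. *)
Definition sphere_coordinates (h : 'rV[R]_n -> 'M[R]_n) (Z0 : set 'rV[R]_n)
    (A0 : set 'rV[R]_n.-1) (theta : 'rV[R]_n -> 'rV[R]_n.-1 -> 'rV[R]_n) :=
  [/\ smooth_map_on [set y : 'rV[R]_(n + n.-1) | Z0 (lsubmx y) /\ A0 (rsubmx y)]
        (fun y => theta (lsubmx y) (rsubmx y)),
      forall z a, Z0 z -> A0 a -> theta z a *m h z *m (theta z a)^T = 1%:M,
      forall z a a', Z0 z -> A0 a -> A0 a' -> theta z a = theta z a' -> a = a' &
      forall z a, Z0 z -> A0 a -> row_free (jacobian (theta z) a)].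

(* A is the coordinate patch of the theorem; the coordinates extend to an open
   set A0 containing its compact closure, so that geodesics with parameters on
   the boundary of the patch make sense. *)
Definition coord_nbhd m (A0 A : set 'rV[R]_m) :=
  [/\ open A0, open A, A 0, compact (closure A) & closure A `<=` A0].

Definition starts_at (M : manifold R n.+1) (c : chart R M n.+1) (gam : R -> M)
    (z v : 'rV[R]_n) :=
  gam 0 = cpsi c (pt 0 z) /\ derive1 (cphi c \o gam) 0 = pt 1 v.

Definition param_space (Z : set 'rV[R]_n) (A : set 'rV[R]_n.-1) :
    set (borel 'rV[R]_(n + n.-1)) :=
  [set y : 'rV[R]_(n + n.-1) | Z (lsubmx y) /\ A (rsubmx y)].

End parametrization.

Section ray_transform.
Variables (R : realType) (n : nat) (M M1 : manifold R n.+1).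
Variables (Z : set 'rV[R]_n) (A : set 'rV[R]_n.-1).
Variables (gam : 'rV[R]_n -> 'rV[R]_n.-1 -> R -> M) (l : R).
Variable kappa : M -> 'rV[R]_n.+1 -> R.

Definition light_ray_transform (f : M -> R) : borel 'rV[R]_(n + n.-1) -> R :=
  fun y : 'rV[R]_(n + n.-1) =>
    weighted_ray_transform kappa l f (gam (lsubmx y) (rsubmx y)).

(* A function on M1 supported in iota(N), seen on M and extended by zero. *)
Definition pull_back (N : set M) (iota : M -> M1) (u : M1 -> R) : M -> R :=
  (u \o iota) \_ N.

(* w in L^2(Z x A) is the value at u of the extension by continuity, for the
   norm of H^s(M1), of the transform from smooth functions compactly supported
   in N. *)
Definition light_ray_extension (mu1 : {measure set (borel M1) -> \bar R})
    (e : nat -> M1 -> R) (lam : nat -> R) (N : set M) (iota : M -> M1) (s : R)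
    (u : M1 -> R) (w : borel 'rV[R]_(n + n.-1) -> R) :=
  in_L2 (leb R (n + n.-1)) (param_space Z A) w /\
  exists f : nat -> M1 -> R,
    [/\ forall k, smooth_function (f k) /\
          closure [set p | f k p != 0] `<=` iota @` N,
        sobolev_cvg mu1 e lam s f u &
        (L2norm (leb R (n + n.-1)) (param_space Z A)
           (light_ray_transform (pull_back N iota (f k)) \- w)%R
           @[k --> \oo] --> 0)%E].

End ray_transform.

Definition modulus_of_continuity (R : realType) (omega : R -> R) :=
  [/\ forall s t, 0 <= s -> s <= t -> omega s <= omega t,
      forall t, 0 <= t -> 0 <= omega t, omega 0 = 0 &
      omega t @[t --> 0^'+] --> 0].

(* Main.v *)
(* The transform is tested on highly oscillating functions supported near an
   interior point of S.  In a chart choose a linear phase phi whose derivative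
   does not vanish on null vectors (phi is a timelike covector at the point),
   and a cutoff chi.  Along a light ray the phase is then non-stationary and both
   endpoints of the ray lie outside the support, so repeated integration by parts
   shows that the ray transforms of chi cos(lam phi) and chi sin(lam phi) are
   O(lam ^ - N) for every N, uniformly on the compact set of parameters; this
   needs the joint continuity of the geodesics in time and parameters, because
   only each geodesic separately is assumed to be smooth.
     The H^delta norms grow at most like a power lam ^ k: the eigenfunction
   coefficients of (1 - Laplacian)^m f are (1 + lam_j)^m times those of f by
   Green's formula, and the Bessel potential exists by the Riesz-Fischer theorem.
   As cos^2 + sin^2 = 1, one of the two functions has L^2 norm bounded below.
   Rescaling it by lam ^ - k and comparing with 0, the stability estimate gives
   c lam ^ - k <= omega (C_N lam ^ - N) for all N, that is, omega t is at
   least of the order of t ^ (k / N). *)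

Require Import Defs.
From HB Require Import structures.
From mathcomp Require Import all_boot all_order all_algebra.
From mathcomp Require Import all_classical all_reals all_analysis measurable_realfun.
From mathcomp Require Import lra ring.
Import Order.TTheory GRing.Theory Num.Theory.
Import numFieldNormedType.Exports.
Set Implicit Arguments.
Unset Strict Implicit.
Unset Printing Implicit Defensive.
Local Open Scope classical_set_scope.
Local Open Scope ring_scope.

(** * Smooth functions *)

(** The weight depends on the velocity, so the integration by parts takes place in phase space:
    along a geodesic the derivative of a function B of the state (x, v) is its derivative along the
    spray, and B -> [transport] (B / [speed]) sends smooth amplitudes supported over a fixed box in
    x to amplitudes of the same kind. Decay of every order is thus an induction over amplitudes, fed
    by one uniform bound per amplitude along all rays. The mass on M, the transform and the Sobolev
    norm on M1 concern the same function because it is stored in coordinates, supported in a box: it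
    is lifted to M by a chart inside the interior of S, and to M1 by that chart carried over by
    [iota]. High derivatives are never written out. [smooth_on] speaks of all iterated partials, so
    smoothness is proved for classes of functions stable under partials; and powers of 1 - Laplacian
    act on an inductive class of waves whose growth exponent in lam is read off its syntax. The
    exponent k obtained in this way does not depend on N, which is why every positive alpha is
    reached. *)

Section differential_calculus.
Variable R : realType.

Lemma near_eq_differentiable (V W : normedModType R) (f g : V -> W) x :
  (\near x, f x = g x) -> differentiable f x -> differentiable g x.
Proof.
move=> fg /diff_locallyP[cdf df].
have gx : f x = g x by exact: nbhs_singleton fg.
have H : g \o shift x = cst (g x) + 'd f x +o_ 0 id.
  apply/eqaddoP => eps e0; move/eqaddoP : df => /(_ eps e0) df.
  have : \forall h \near 0, f (h + x) = g (h + x).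
    by move: fg; rewrite [in X in X -> _](near_shift 0) /= subr0.
  move=> H; near=> h.
  have h1 : `|((f \o shift x) - (cst (f x) + 'd f x)) h| <= eps * `|h| by near: h.
  have h2 : f (h + x) = g (h + x) by near: h.
  by move: h1; rewrite !fctE /= h2 gx.
apply/diff_locallyP; rewrite (diff_unique _ H) //.
Unshelve. all: by end_near. Qed.

Lemma differentiable_rV k (V : normedModType R) (F : V -> 'rV[R]_k) x :
  (forall j, differentiable (fun y => F y 0 j) x) -> differentiable F x.
Proof.
move=> dF; have -> : F = \sum_(j < k) (fun y => F y 0 j *: (delta_mx 0 j : 'rV[R]_k)).
  by apply/funext => y; rewrite fct_sumE {1}(row_sum_delta (F y)).
by apply: differentiable_sum => j; exact: differentiableZl.
Qed.

Lemma diff_rV_coord k (V : normedModType R) (F : V -> 'rV[R]_k) x v j :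
  differentiable F x -> ('d F x v) 0 j = 'd (fun y => F y 0 j) x v.
Proof.
move=> dF.
have lc : linear (fun y : 'rV[R]_k => y 0 j : R) by move=> a u w; rewrite !mxE.
pose L : {linear 'rV[R]_k -> R} := HB.pack (fun y : 'rV[R]_k => y 0 j : R)
  (GRing.isLinear.Build _ _ _ _ _ lc).
have cL : continuous L by exact: coord_continuous.
have dL : differentiable L (F x) by exact: linear_differentiable.
by rewrite -[fun y => F y 0 j]/(L \o F) (diff_comp dF dL) (diff_lin _ cL).
Qed.

Lemma diff_partial m (f : 'rV[R]_m -> R) x v : differentiable f x ->
  'd f x v = \sum_i v 0 i * partial i f x.
Proof.
move=> df; rewrite {1}(row_sum_delta v) linear_sum; apply: eq_bigr => i _.
by rewrite linearZ /partial deriveE.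
Qed.

Lemma linear_rV_diff m (f : 'rV[R]_m -> R) : linear f -> forall x v,
  differentiable f x /\ 'd f x v = f v.
Proof.
move=> lf x v.
pose L : {linear 'rV[R]_m -> R} := HB.pack f (GRing.isLinear.Build _ _ _ _ _ lf).
have dc i (y : 'rV[R]_m) :
    differentiable (fun y : 'rV[R]_m => y 0 i * L (delta_mx 0 i)) y.
  by apply: differentiableM => //; exact: differentiable_coord.
have LE : (L : _ -> R) = \sum_(i < m) (fun y : 'rV[R]_m => y 0 i * L (delta_mx 0 i)).
  apply/funext => y; rewrite fct_sumE {1}(row_sum_delta y) linear_sum.
  by apply: eq_bigr => i _; rewrite linearZ.
have dL y : differentiable L y by rewrite LE; exact: differentiable_sum.
split; first exact: dL.
have cL : continuous L by move=> y; exact/differentiable_continuous/dL.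
by rewrite -[f]/(L : _ -> R) (diff_lin _ cL).
Qed.

Lemma partialE m (f : 'rV[R]_m -> R) x i : differentiable f x ->
  partial i f x = 'd f x (delta_mx 0 i).
Proof. by move=> df; rewrite /partial deriveE. Qed.

Lemma near_partial m (f g : 'rV[R]_m -> R) x i :
  (\near x, f x = g x) -> partial i f x = partial i g x.
Proof. by move=> fg; exact: near_eq_derive. Qed.

Lemma open_near (T : topologicalType) (U : set T) (P : T -> Prop) x :
  open U -> U x -> (forall y, U y -> P y) -> \near x, P x.
Proof. by move=> oU Ux UP; apply: filterS UP _; exact: open_nbhs_nbhs. Qed.

Lemma smooth_on_diff m (U : set 'rV[R]_m) f x : smooth_on U f -> U x ->
  differentiable f x.
Proof. by move=> /(_ [::]); exact. Qed.

Lemma smooth_on_partial m (U : set 'rV[R]_m) f i :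
  smooth_on U f -> smooth_on U (partial i f).
Proof. by move=> sf s x Ux; have := sf (rcons s i) x Ux; rewrite foldr_rcons. Qed.

Lemma smooth_on_sub m (U V : set 'rV[R]_m) f : V `<=` U ->
  smooth_on U f -> smooth_on V f.
Proof. by move=> VU sf s x /VU; exact: sf. Qed.

Lemma smooth_on_local m (U : set 'rV[R]_m) f :
  (forall x, U x -> exists W, W x /\ smooth_on W f) -> smooth_on U f.
Proof. by move=> H s x /H[W [Wx sf]]; exact: sf. Qed.

(** Coinduction for smoothness. By induction on the list of indices, each iterated partial agrees on
    U with a member of P, and agreement on an open set survives one more partial. This replaces
    product and chain rules for iterated derivatives. *)
Lemma smooth_on_coind m (U : set 'rV[R]_m) (P : ('rV[R]_m -> R) -> Prop) f :
  open U ->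
  (forall f, P f -> (forall x, U x -> differentiable f x) /\
     forall i, exists2 h, P h & forall x, U x -> partial i f x = h x) ->
  P f -> smooth_on U f.
Proof.
move=> oU HP Pf s.
suff [h Ph fh] : exists2 h, P h & forall x, U x -> foldr (@partial R m) f s x = h x.
  move=> x Ux; apply: (@near_eq_differentiable _ _ h).
    by apply: (open_near oU Ux) => y Uy; rewrite fh.
  by case: (HP h Ph) => + _; exact.
elim: s => [|i s [h Ph fh]] /=; first by exists f.
have [_ /(_ i)[h' Ph' hh']] := HP _ Ph; exists h' => // x Ux.
rewrite -hh' //; apply: near_partial.
by apply: (open_near oU Ux) => y Uy; rewrite fh.
Qed.

Lemma eq_smooth_on m (U : set 'rV[R]_m) f g : open U ->
  (forall x, U x -> f x = g x) -> smooth_on U f -> smooth_on U g.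
Proof.
move=> oU fg sf.
apply: (@smooth_on_coind _ _ (fun h => exists2 h', smooth_on U h' &
   forall x, U x -> h' x = h x)) => //; last by exists f.
move=> h [h' sh' e]; split=> [x Ux|i].
  apply: (@near_eq_differentiable _ _ h'); last exact: smooth_on_diff sh' Ux.
  by apply: (open_near oU Ux) => y Uy; rewrite e.
exists (partial i h'); first by exists (partial i h') => //; exact: smooth_on_partial.
move=> x Ux; apply: near_partial; apply: (open_near oU Ux) => y Uy.
by rewrite e.
Qed.

Lemma smooth_on_cst m (U : set 'rV[R]_m) a : open U -> smooth_on U (cst a).
Proof.
move=> oU; apply: (@smooth_on_coind _ _ (fun h => exists b, h = cst b)) => //;
  last by exists a.
move=> _ [b ->]; split=> [x _|i]; first exact: differentiable_cst.
exists (cst 0); first by exists 0.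
by move=> x _; rewrite /partial derive_cst.
Qed.

(* Smoothness in the sense of a derivative chain staying inside some family. *)
Definition smooth1 (V : set R) (rho : R -> R) :=
  exists2 P : (R -> R) -> Prop, P rho & forall h, P h ->
    exists2 h', P h' & forall t, V t -> is_derive t 1 h (h' t).

(* This class is closed under partial derivatives, so all its members are smooth. *)
Inductive gen m (U : set 'rV[R]_m) : ('rV[R]_m -> R) -> Prop :=
| gen_smooth f : smooth_on U f -> gen U f
| gen_add f g : gen U f -> gen U g -> gen U (fun x => f x + g x)
| gen_mul f g : gen U f -> gen U g -> gen U (fun x => f x * g x)
| gen_comp1 V rho f : smooth1 V rho -> gen U f -> (forall x, U x -> V (f x)) ->
    gen U (fun x => rho (f x))
| gen_comp k (W : set 'rV[R]_k) G (F : 'rV[R]_m -> 'rV[R]_k) : smooth_on W G ->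
    (forall j, gen U (fun x => F x 0 j)) -> (forall x, U x -> W (F x)) ->
    gen U (fun x => G (F x)).

Lemma gen_sum m (U : set 'rV[R]_m) k (F : 'I_k -> 'rV[R]_m -> R) : open U ->
  (forall j, gen U (F j)) -> gen U (fun x => \sum_(j < k) F j x).
Proof.
move=> oU; elim: k F => [|k IH] F gF.
  under eq_fun do rewrite big_ord0; exact/gen_smooth/smooth_on_cst.
by under eq_fun do rewrite big_ord_recr; apply: gen_add => //; exact: IH.
Qed.

(** The sum, product and chain rules, arranged so that each derivative is again a term of [gen]: in
    the compositions, the derivative of the outer function stays in its own smooth class and is
    composed with the same inner function. *)
Lemma gen_partial m (U : set 'rV[R]_m) f : open U -> gen U f ->
  (forall x, U x -> differentiable f x) /\
  forall i, exists2 h, gen U h & forall x, U x -> partial i f x = h x.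
Proof.
move=> oU; elim=> {f}.
- move=> f sf; split=> [x|i]; first exact: smooth_on_diff.
  by exists (partial i f) => //; exact/gen_smooth/smooth_on_partial.
- move=> f g _ [df pf] _ [dg pg]; split=> [x Ux|i].
    by apply: (@differentiableD _ _ _ f g); [exact: df|exact: dg].
  have [[f' gf' ff'] [g' gg' gg'E]] := (pf i, pg i).
  exists (fun x => f' x + g' x); first exact: gen_add.
  move=> x Ux; rewrite -ff' // -gg'E // /partial.
  by apply: (@deriveD _ _ _ f g); apply: diff_derivable; [exact: df|exact: dg].
- move=> f g gf [df pf] gg [dg pg]; split=> [x Ux|i].
    by apply: (@differentiableM _ _ f g); [exact: df|exact: dg].
  have [[f' gf' ff'] [g' gg' gg'E]] := (pf i, pg i).
  exists (fun x => f x * g' x + g x * f' x).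
    by apply: gen_add; apply: gen_mul.
  move=> x Ux; rewrite -ff' // -gg'E // /partial.
  by apply: (@deriveM _ _ f g); apply: diff_derivable; [exact: df|exact: dg].
- move=> V rho f [P Prho HP] gf [df pf] fV.
  have [rho' Prho' drho] := HP _ Prho.
  have dr t : V t -> differentiable rho t.
    by move=> /drho[? _]; exact/derivable1_diffP.
  split=> [x Ux|i].
    by apply: (@differentiable_comp _ _ _ _ f rho); [exact: df|exact/dr/fV].
  have [f' gf' ff'] := pf i.
  exists (fun x => rho' (f x) * f' x).
    by apply: gen_mul => //; apply: (@gen_comp1 _ _ V) => //; exists P.
  move=> x Ux; rewrite partialE; last first.
    by apply: (@differentiable_comp _ _ _ _ f rho); [exact: df|exact/dr/fV].
  rewrite (@diff_comp _ _ _ _ f rho); [|exact: df|exact/dr/fV] => /=.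
  rewrite deriv1E; last by have [] := drho _ (fV _ Ux).
  rewrite /= derive1E; have [_ ->] := drho _ (fV _ Ux).
  by rewrite -partialE ?ff' //; [exact: mulrC|exact: df].
- move=> k W G F sG gF dF FW.
  have dFx x : U x -> differentiable F x.
    by move=> Ux; apply: differentiable_rV => j; have [d _] := dF j; exact: d.
  have dGx x : U x -> differentiable G (F x) by move=> /FW; exact: smooth_on_diff.
  split=> [x Ux|i].
    by apply: (@differentiable_comp _ _ _ _ F G); [exact: dFx|exact: dGx].
  have /choice[f' Hf'] : forall j, exists h, gen U h /\
      forall x, U x -> partial i (fun x => F x 0 j) x = h x.
    by move=> j; have [_ /(_ i)[h]] := dF j; exists h.
  exists (fun x => \sum_j f' j x * partial j G (F x)).
    apply: gen_sum => // j; apply: gen_mul; first by case: (Hf' j).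
    by apply: (@gen_comp _ _ _ W) => //; exact: smooth_on_partial.
  move=> x Ux; rewrite partialE; last first.
    by apply: (@differentiable_comp _ _ _ _ F G); [exact: dFx|exact: dGx].
  rewrite (@diff_comp _ _ _ _ F G); [|exact: dFx|exact: dGx] => /=.
  rewrite diff_partial; last exact: dGx.
  apply: eq_bigr => j _; congr (_ * _).
  have [_ <-//] := Hf' j; rewrite partialE ?diff_rV_coord //; first exact: dFx.
  by have [d _] := dF j; exact: d.
Qed.

Lemma gen_smooth_on m (U : set 'rV[R]_m) f : open U -> gen U f -> smooth_on U f.
Proof. by move=> oU; apply: smooth_on_coind => // g; exact: gen_partial. Qed.

Section smooth_on_ops.
Variables (m : nat) (U : set 'rV[R]_m).
Hypothesis oU : open U.
Implicit Types f g : 'rV[R]_m -> R.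

Lemma smooth_onD f g : smooth_on U f -> smooth_on U g ->
  smooth_on U (fun x => f x + g x).
Proof. by move=> /gen_smooth sf /gen_smooth sg; exact/gen_smooth_on/gen_add. Qed.

Lemma smooth_onM f g : smooth_on U f -> smooth_on U g ->
  smooth_on U (fun x => f x * g x).
Proof. by move=> /gen_smooth sf /gen_smooth sg; exact/gen_smooth_on/gen_mul. Qed.

Lemma smooth_onZ a f : smooth_on U f -> smooth_on U (fun x => a * f x).
Proof. by move=> sf; apply: smooth_onM => //; exact: smooth_on_cst. Qed.

Lemma smooth_onN f : smooth_on U f -> smooth_on U (fun x => - f x).
Proof. by move=> /(@smooth_onZ (-1)); under eq_fun do rewrite mulN1r. Qed.

Lemma smooth_onB f g : smooth_on U f -> smooth_on U g ->
  smooth_on U (fun x => f x - g x).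
Proof. by move=> sf sg; apply: smooth_onD => //; exact: smooth_onN. Qed.

Lemma smooth_on_sum (I : Type) (r : seq I) (P : pred I) (F : I -> 'rV[R]_m -> R) :
  (forall j, smooth_on U (F j)) -> smooth_on U (fun x => \sum_(j <- r | P j) F j x).
Proof.
move=> sF; elim: r => [|i r IH].
  by under eq_fun do rewrite big_nil; exact: smooth_on_cst.
under eq_fun do rewrite big_cons; case: (P i) => //; exact: smooth_onD.
Qed.

Lemma smooth_on_prod (I : Type) (r : seq I) (P : pred I) (F : I -> 'rV[R]_m -> R) :
  (forall j, smooth_on U (F j)) -> smooth_on U (fun x => \prod_(j <- r | P j) F j x).
Proof.
move=> sF; elim: r => [|i r IH].
  by under eq_fun do rewrite big_nil; exact: smooth_on_cst.
under eq_fun do rewrite big_cons; case: (P i) => //; exact: smooth_onM.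
Qed.

Lemma smooth_on_comp1 V rho f : smooth1 V rho -> smooth_on U f ->
  (forall x, U x -> V (f x)) -> smooth_on U (fun x => rho (f x)).
Proof.
by move=> sr /gen_smooth sf fV; apply: gen_smooth_on => //; exact: gen_comp1 fV.
Qed.

Lemma smooth_on_comp k (W : set 'rV[R]_k) G (F : 'rV[R]_m -> 'rV[R]_k) :
  smooth_on W G -> smooth_map_on U F -> (forall x, U x -> W (F x)) ->
  smooth_on U (fun x => G (F x)).
Proof.
move=> sG sF FW; apply: gen_smooth_on => //; apply: gen_comp FW => // j.
exact: gen_smooth.
Qed.

Lemma smooth_on_lin f : linear f -> smooth_on U f.
Proof.
move=> lf; have dL := linear_rV_diff lf.
apply: (@smooth_on_coind _ _ (fun h => h = f \/ smooth_on U h)) => //; last by left.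
move=> h [->|sh]; split.
- by move=> x _; have [d _] := dL x 0.
- move=> i; exists (cst (f (delta_mx 0 i))); first by right; exact: smooth_on_cst.
  by move=> x _; have [d e] := dL x (delta_mx 0 i); rewrite partialE // e.
- by move=> x; exact: smooth_on_diff.
- by move=> i; exists (partial i h) => //; right; exact: smooth_on_partial.
Qed.

Lemma smooth_on_coord i : smooth_on U (fun x => x 0 i).
Proof. by apply: smooth_on_lin => a x y; rewrite !mxE. Qed.

End smooth_on_ops.

Lemma is_derive1D (f g : R -> R) (t a b : R) : is_derive t 1 f a -> is_derive t 1 g b ->
  is_derive t 1 (fun x => f x + g x) (a + b).
Proof. by move=> df dg; exact: is_deriveD. Qed.

Lemma is_derive1M (f g : R -> R) (t a b : R) : is_derive t 1 f a -> is_derive t 1 g b ->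
  is_derive t 1 (fun x => f x * g x) (f t * b + g t * a).
Proof. by move=> df dg; exact: is_deriveM. Qed.

Lemma is_derive1Z (c : R) (f : R -> R) (t a : R) : is_derive t 1 f a ->
  is_derive t 1 (fun x => c * f x) (c * a).
Proof. by move=> df; exact: is_deriveZ. Qed.

Lemma is_derive1_eq (f : R -> R) (t a b : R) : a = b -> is_derive t 1 f a ->
  is_derive t 1 f b.
Proof. by move=> ->. Qed.

Lemma is_derive1_comp (f g : R -> R) (t a b : R) : is_derive t 1 f a ->
  is_derive (f t) 1 g b -> is_derive t 1 (fun x => g (f x)) (b * a).
Proof.
move=> [df ea] [dg eb]; apply: DeriveDef.
  apply/derivable1_diffP; apply: (@differentiable_comp _ _ _ _ f g).
    exact/derivable1_diffP.
  exact/derivable1_diffP.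
by rewrite -derive1E derive1_comp // !derive1E ea eb.
Qed.

Lemma smooth1_cos : smooth1 setT (@cos R).
Proof.
exists (fun h => exists a b, h = (fun t => a * cos t + b * sin t)).
  by exists 1, 0; apply/funext => t; rewrite mul1r mul0r addr0.
move=> _ [a [b ->]]; exists (fun t => b * cos t + (- a) * sin t); first by exists b, (- a).
move=> t _; apply: (is_derive1_eq _ (is_derive1D (is_derive1Z a (is_derive_cos t))
  (is_derive1Z b (is_derive_sin t)))).
by rewrite mulrN mulNr addrC.
Qed.

Lemma smooth1_sin : smooth1 setT (@sin R).
Proof.
have [P Pc HP] := smooth1_cos.
exists (fun f => P f \/ f = @sin R); first by right.
move=> f [/HP[f' Pf' df']|->]; first by exists f' => //; left.
by exists (@cos R); [left|move=> t _; exact: is_derive_sin].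
Qed.

Lemma is_derive1_expV n (t : R) : t != 0 ->
  is_derive t 1 (fun x => x^-1 ^+ n) (- n%:R * t^-1 ^+ n.+1).
Proof.
move=> t0; have dV : is_derive t 1 (@GRing.inv R) (- (t^-1 ^+ 2)).
  apply: DeriveDef; first exact: (@derivableV _ _ id t 1 t0 (@derivable_id _ _ _ _)).
  rewrite (@deriveV _ _ id t 1 t0 (@derivable_id _ _ _ _)) derive_id.
  by rewrite /GRing.scale /= mulr1 exprVn.
elim: n => [|n IH].
  by under eq_fun do rewrite expr0; rewrite oppr0 mul0r; exact: is_derive_cst.
under eq_fun do rewrite exprS.
apply: (is_derive1_eq _ (is_derive1M dV IH)).
by rewrite -[in RHS]natr1 !exprS; ring.
Qed.

Lemma smooth1_inv : smooth1 [set t : R | t != 0] (@GRing.inv R).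
Proof.
exists (fun h => exists a n, h = (fun t => a * t^-1 ^+ n)).
  by exists 1, 1; apply/funext => t; rewrite mul1r expr1.
move=> _ [a [n ->]]; exists (fun t => (- (a * n%:R)) * t^-1 ^+ n.+1).
  by exists (- (a * n%:R)), n.+1.
move=> t /= t0; apply: (is_derive1_eq _ (is_derive1Z a (is_derive1_expV n t0))).
ring.
Qed.

(** Writing 1 / sqrt t as sqrt t / t keeps the derivatives in the family a * sqrt t * t^-n. *)
Lemma smooth1_sqrt : smooth1 [set t : R | 0 < t] (@Num.sqrt R).
Proof.
exists (fun h => exists a n, h = (fun t => a * (Num.sqrt t * t^-1 ^+ n))).
  by exists 1, 0; apply/funext => t; rewrite expr0 mulr1 mul1r.
move=> _ [a [n ->]].
exists (fun t => (a * (2^-1 - n%:R)) * (Num.sqrt t * t^-1 ^+ n.+1)).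
  by exists (a * (2^-1 - n%:R)), n.+1.
move=> t /= t0; have tn0 : t != 0 by rewrite gt_eqF.
apply: (is_derive1_eq _ (is_derive1Z a (is_derive1M (is_derive1_sqrt t0)
  (is_derive1_expV n tn0)))).
have s0 : Num.sqrt t != 0 by rewrite gt_eqF // sqrtr_gt0.
have e : (Num.sqrt t)^-1 = Num.sqrt t * t^-1.
  by rewrite -{3}(sqr_sqrtr (ltW t0)) expr2 invfM mulrA mulfV // mul1r.
by rewrite invfM e !exprS; ring.
Qed.

(** The functions p(1/t) exp(-1/t), extended by zero. The polynomial factor makes the family closed
    under derivation: the derivative has the factor (p - p')(1/t) / t^2. *)
Definition bump (p : {poly R}) (t : R) : R :=
  if 0 < t then p.[t^-1] * expR (- t^-1) else 0.

Lemma bump_bound p : exists2 C, 0 <= C & forall t, `|bump p t| <= C * `|t|.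
Proof.
exists (\sum_(i < size p) `|p`_i| * i.+1`!%:R).
  by apply: sumr_ge0 => i _; rewrite mulr_ge0.
move=> t; rewrite /bump; case: ltP => t0; last first.
  by rewrite normr0 mulr_ge0 // sumr_ge0 // => i _; rewrite mulr_ge0.
rewrite horner_coef mulr_suml mulr_suml; apply: le_trans (ler_norm_sum _ _ _) _.
apply: ler_sum => i _; rewrite !normrM -!mulrA ler_wpM2l //.
have ti : 0 < t^-1 by rewrite invr_gt0.
have := expR_ge1Dxn i (ltW ti).
rewrite expRN normrX normfV (gtr0_norm t0) (gtr0_norm (_ : 0 < _^-1)) ?invr_gt0 ?expR_gt0 // => h.
rewrite ler_pdivrMr ?expR_gt0 //.
have f0 : (0 : R) < i.+1`!%:R by rewrite ltr0n fact_gt0.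
have h2 : t^-1 ^+ i.+1 <= i.+1`!%:R * expR t^-1.
  by rewrite mulrC -ler_pdivrMr //; apply: le_trans h; rewrite lerDr.
have := ler_wpM2l (ltW t0) h2; rewrite exprS mulrA mulfV ?gt_eqF // mul1r.
by rewrite mulrCA mulrA.
Qed.

Lemma is_derive_bump p (t : R) :
  is_derive t 1 (bump p) (bump ('X^2 * (p - p^`())) t).
Proof.
have [t0|t0|->] := ltgtP t 0.
- have E : \near t, (cst 0 : R -> R) t = bump p t.
    apply: (@open_near R [set y : R | y < 0]) => //.
    by move=> y /= y0; rewrite /bump ltNge ltW.
  apply: (near_eq_is_derive E); rewrite /bump ltNge ltW //=; exact: is_derive_cst.
- have E : \near t, p.[t^-1] * expR (- t^-1) = bump p t.
    apply: (@open_near R [set y : R | 0 < y]) => //.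
    by move=> y /= y0; rewrite /bump y0.
  apply: (near_eq_is_derive E).
  have dV : is_derive t 1 (@GRing.inv R) (- (t^-1 ^+ 2)).
    have := @is_derive1_expV 1 t (lt0r_neq0 t0); under eq_fun do rewrite expr1.
    by rewrite mulN1r.
  have dp : is_derive t^-1 1 (horner p) p^`().[t^-1].
    by apply: DeriveDef; [exact: derivable_horner|rewrite -derive1E derivE].
  have dN : is_derive t 1 (fun t => - t^-1) (t^-1 ^+ 2).
    by have := is_derive1Z (-1) dV; under eq_fun do rewrite mulN1r; rewrite mulN1r opprK.
  apply: (is_derive1_eq _ (is_derive1M (is_derive1_comp dV dp)
    (is_derive1_comp dN (is_derive_expR _)))).
  rewrite /bump t0 hornerM hornerD hornerN hornerXn.
  ring.
- rewrite {2}/bump ltxx.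
  have [C C0 HC] := bump_bound ('X * p).
  have lim0 : (fun h : R => h^-1 *: (bump p (h *: (1 : R) + 0) - bump p 0)) @ 0^' --> (0 : R).
    apply/cvgrPdist_le => e e0; near=> h.
    have h0 : h != 0 by near: h; exact: nbhs_dnbhs_neq.
    rewrite sub0r normrN {2}/bump ltxx subr0 addr0 /GRing.scale /= mulr1.
    have -> : h^-1 * bump p h = bump ('X * p) h.
      by rewrite /bump; case: ifP; rewrite ?mulr0 // hornerM hornerX mulrA.
    apply: le_trans (HC _) _.
    have : `|h| <= e / (C + 1).
      by near: h; apply: dnbhs0_le; rewrite divr_gt0 // ltr_pwDr.
    rewrite ler_pdivlMr ?ltr_pwDr //; apply: le_trans.
    by rewrite mulrC ler_wpM2l // lerDl.
  apply: DeriveDef; first by apply/cvg_ex; exists 0.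
  exact: cvg_lim lim0.
Unshelve. all: by end_near. Qed.

Lemma smooth1_bump p : smooth1 setT (bump p).
Proof.
exists (fun h => exists p, h = bump p); first by exists p.
move=> _ [q ->]; exists (bump ('X^2 * (q - q^`()))) => [|t _]; first by eexists.
exact: is_derive_bump.
Qed.

End differential_calculus.

(** * Smooth matrix-valued functions and Jacobians *)

Section smooth_matrices.
Variables (R : realType) (m : nat) (U : set 'rV[R]_m).
Hypothesis oU : open U.

Lemma smooth_on_mulmx p q s (A : 'rV[R]_m -> 'M[R]_(p, q)) (B : 'rV[R]_m -> 'M[R]_(q, s)) :
  (forall i j, smooth_on U (fun x => A x i j)) ->
  (forall i j, smooth_on U (fun x => B x i j)) ->
  forall i j, smooth_on U (fun x => (A x *m B x) i j).
Proof.
move=> sA sB i j; under eq_fun do rewrite mxE.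
by apply: smooth_on_sum => // k; exact: smooth_onM.
Qed.

Lemma smooth_on_det k (A : 'rV[R]_m -> 'M[R]_k) :
  (forall i j, smooth_on U (fun x => A x i j)) -> smooth_on U (fun x => \det (A x)).
Proof.
move=> sA; rewrite /determinant; apply: smooth_on_sum => // s.
by apply: smooth_onZ => //; exact: smooth_on_prod.
Qed.

Lemma smooth_on_invmx k (A : 'rV[R]_m -> 'M[R]_k) :
  (forall i j, smooth_on U (fun x => A x i j)) ->
  (forall x, U x -> A x \in unitmx) ->
  forall i j, smooth_on U (fun x => invmx (A x) i j).
Proof.
move=> sA uA i j.
apply: (@eq_smooth_on _ _ _ (fun x => (\det (A x))^-1 * cofactor (A x) j i)) => //.
  by move=> x Ux; rewrite /invmx uA // !mxE.
apply: smooth_onM => //.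
  apply: (smooth_on_comp1 oU (@smooth1_inv R)) => [|x Ux]; first exact: smooth_on_det.
  by have := uA x Ux; rewrite unitmxE unitfE.
apply: smooth_onZ => //; apply: smooth_on_det => a b.
by under eq_fun do rewrite !mxE; exact: sA.
Qed.

Lemma jacobianE k (F : 'rV[R]_m -> 'rV[R]_k) x i j : differentiable F x ->
  jacobian F x i j = partial i (fun y => F y 0 j) x.
Proof.
move=> dF; rewrite /jacobian mxE diff_rV_coord // partialE //.
by apply: (@differentiable_comp _ _ _ _ F (fun y : 'rV[R]_k => y 0 j)) => //;
  exact: differentiable_coord.
Qed.

Lemma smooth_map_diff k (F : 'rV[R]_m -> 'rV[R]_k) x :
  smooth_map_on U F -> U x -> differentiable F x.
Proof. by move=> sF Ux; apply: differentiable_rV => j; exact: smooth_on_diff (sF j) Ux. Qed.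

Lemma smooth_on_jacobian k (F : 'rV[R]_m -> 'rV[R]_k) : smooth_map_on U F ->
  forall i j, smooth_on U (fun x => jacobian F x i j).
Proof.
move=> sF i j; apply: (eq_smooth_on oU _ (smooth_on_partial i (sF j))) => x Ux.
by rewrite jacobianE //; exact: smooth_map_diff.
Qed.

Lemma near_jacobian k (F G : 'rV[R]_m -> 'rV[R]_k) x :
  (\near x, F x = G x) -> differentiable F x -> jacobian F x = jacobian G x.
Proof.
move=> FG dF; apply/matrixP => i j.
have dG : differentiable G x := near_eq_differentiable FG dF.
apply: etrans (@jacobianE k F x i j dF) _.
apply: etrans _ (esym (@jacobianE k G x i j dG)).
by apply: near_partial; apply: filterS FG => y ->.
Qed.

Lemma jacobian_comp k s (F : 'rV[R]_m -> 'rV[R]_k) (G : 'rV[R]_k -> 'rV[R]_s) x :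
  differentiable F x -> differentiable G (F x) ->
  jacobian (G \o F) x = jacobian F x *m jacobian G (F x).
Proof.
move=> dF dG; apply/row_matrixP => i; rewrite !rowE mulmxA.
have dGF : differentiable (G \o F) x by exact: differentiable_comp.
rewrite -(deriveEjacobian _ dF) -(deriveEjacobian _ dG) -(deriveEjacobian _ dGF).
by rewrite (deriveE _ dF) (deriveE _ dG) (deriveE _ dGF) (diff_comp dF dG).
Qed.

Lemma jacobian_id (x : 'rV[R]_m) : jacobian id x = 1%:M.
Proof.
apply/row_matrixP => i; rewrite !rowE mulmx1 -deriveEjacobian //.
by rewrite derive_id.
Qed.

Lemma smooth_on_continuous f x : smooth_on U f -> U x -> {for x, continuous f}.
Proof. by move=> sf Ux; apply: differentiable_continuous; exact: smooth_on_diff sf Ux. Qed.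

Lemma smooth_map_continuous k (F : 'rV[R]_m -> 'rV[R]_k) x :
  smooth_map_on U F -> U x -> {for x, continuous F}.
Proof. by move=> sf Ux; apply: differentiable_continuous; exact: smooth_map_diff. Qed.

Lemma smooth_on_extend (K : set 'rV[R]_m) f : closed K -> K `<=` U ->
  smooth_on U f -> (forall x, ~ K x -> f x = 0) -> smooth_on setT f.
Proof.
move=> cK KU sf f0; apply: smooth_on_local => x _.
have [Kx|nKx] := pselect (K x); first by exists U; split => //; exact: KU.
exists (~` K); split => //; have oK : open (~` K) by exact: closed_openC.
by apply: (eq_smooth_on oK _ (smooth_on_cst 0 oK)) => y /f0.
Qed.

End smooth_matrices.

(** * Curves, the sup norm and local Lipschitz bounds *)

Section curves.
Variable R : realType.

Lemma is_derive_comp_curve m (f : 'rV[R]_m -> R) (y : R -> 'rV[R]_m) s :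
  derivable y s 1 -> differentiable f (y s) ->
  is_derive s 1 (f \o y) (\sum_j derive1 y s 0 j * partial j f (y s)).
Proof.
move=> /derivable1_diffP dy df; apply: DeriveDef.
  by apply/derivable1_diffP; exact: differentiable_comp.
rewrite deriveE; last exact: differentiable_comp.
by rewrite diff_comp //= diff_partial // -derive1E'.
Qed.

Lemma derive1_comp_curve m k (F : 'rV[R]_m -> 'rV[R]_k) (y : R -> 'rV[R]_m) s :
  derivable y s 1 -> differentiable F (y s) ->
  derivable (F \o y) s 1 /\ derive1 (F \o y) s = derive1 y s *m jacobian F (y s).
Proof.
move=> /derivable1_diffP dy dF; split.
  by apply/derivable1_diffP; exact: differentiable_comp.
rewrite !derive1E' //; last exact: differentiable_comp.
by rewrite diff_comp //= -deriveEjacobian // deriveE.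
Qed.

Lemma derivable_rV_coord m (y : R -> 'rV[R]_m) s j : derivable y s 1 ->
  derivable (fun t => y t 0 j) s 1 /\ derive1 (fun t => y t 0 j) s = derive1 y s 0 j.
Proof.
move=> dy; split; first by move/derivable_mxP : dy; exact.
by rewrite !derive1E derive_mx // mxE.
Qed.

Lemma is_derive_rV m (y : R -> 'rV[R]_m) (s : R) (v : 'rV[R]_m) :
  (forall j, is_derive s 1 (fun t => y t 0 j) (v 0 j)) -> is_derive s 1 y v.
Proof.
move=> dy; have d : derivable y s 1.
  by apply/derivable_mxP => i j; rewrite ord1; have [] := dy j.
apply: DeriveDef => //; rewrite derive_mx //; apply/rowP => j; rewrite mxE.
by have [_ ->] := dy j.
Qed.

Lemma rV_norm_le m (x : 'rV[R]_m) e : 0 <= e ->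
  (`|x| <= e) <-> (forall i, `|x 0 i| <= e).
Proof.
move=> e0; split=> [xe i|H].
  apply: le_trans xe; rewrite [leRHS]/Num.Def.normr/= mx_normrE.
  exact: (le_bigmax _ (fun i : 'I_1 * 'I_m => `|x i.1 i.2|) (0, i)).
rewrite [leLHS]/Num.Def.normr/= mx_normrE (bigmax_le _ e0)//= => -[i j] _.
by rewrite ord1 /=.
Qed.

Lemma rV_norm_coord m (x : 'rV[R]_m) i : `|x 0 i| <= `|x|.
Proof. by move: i; apply/rV_norm_le. Qed.

Lemma rV_norm_lt m (x : 'rV[R]_m) e : 0 < e ->
  (`|x| < e) <-> (forall i, `|x 0 i| < e).
Proof.
move=> e0; split=> [xe i|H]; first exact: le_lt_trans (rV_norm_coord _ _) xe.
rewrite [ltLHS]/Num.Def.normr/= mx_normrE; apply: bigmax_lt => //= -[i j] _.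
by rewrite ord1 /=.
Qed.

(** Mean value theorem on the segment from y to x, which stays in the ball. Row vectors carry the
    sup norm, so the m partials add up to the factor m. *)
Lemma ball_lipschitz m (f : 'rV[R]_m -> R) (x0 : 'rV[R]_m) rho B :
  (forall x : 'rV[R]_m, `|x - x0| < rho -> differentiable f x) ->
  (forall (x : 'rV[R]_m) i, `|x - x0| < rho -> `|partial i f x| <= B) ->
  forall x y : 'rV[R]_m, `|x - x0| < rho -> `|y - x0| < rho ->
    `|f x - f y| <= m%:R * B * `|x - y|.
Proof.
move=> df dB x y hx hy.
pose c (t : R) : 'rV[R]_m := y + t *: (x - y).
have cB (t : R) : 0 <= t <= 1 -> `|c t - x0| < rho.
  move=> /andP[t0 t1].
  have -> : c t - x0 = t *: (x - x0) + (1 - t) *: (y - x0).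
    by apply/rowP => i; rewrite !mxE; ring.
  apply: le_lt_trans (ler_normD _ _) _; rewrite !normrZ (ger0_norm t0).
  have t1' : 0 <= 1 - t by rewrite subr_ge0.
  rewrite (ger0_norm t1'); have [t00|t00] := eqVneq t 0.
    by rewrite t00 mul0r add0r subr0 mul1r.
  have tp : 0 < t by rewrite lt_neqAle eq_sym t00.
  have : t * `|x - x0| < t * rho by rewrite ltr_pM2l.
  have : (1 - t) * `|y - x0| <= (1 - t) * rho by rewrite ler_wpM2l // ltW.
  lra.
have dc (t : R) : is_derive t 1 c (x - y).
  apply: is_derive_rV => j.
  have e : (fun t => c t 0 j) = (fun t => cst (y 0 j) t + (x - y) 0 j * id t).
    by apply/funext => u; rewrite !mxE mulrC.
  rewrite e; apply: (is_derive1_eq _ (is_derive1D (is_derive_cst _ _ _)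
    (is_derive1Z _ (is_derive_id _ _)))).
  by rewrite add0r mulr1.
have dfc (t : R) : 0 <= t <= 1 -> is_derive t 1 (f \o c) (\sum_j (x - y) 0 j * partial j f (c t)).
  move=> ht; have [d1 d2] := dc t.
  have := @is_derive_comp_curve _ f c t d1 (df _ (cB _ ht)).
  by rewrite derive1E d2.
have [t] : exists2 t, t \in `]0, 1[%R & (f \o c) 1 - (f \o c) 0 =
    (\sum_j (x - y) 0 j * partial j f (c t)) * (1 - 0).
  apply: MVT; first exact: ltr01.
    by move=> t; rewrite in_itv /= => /andP[t0 t1]; apply: dfc; rewrite !ltW.
  apply: derivable_within_continuous => t; rewrite in_itv /= => ht.
  by have [] := dfc t ht.
rewrite in_itv /= => /andP[t0 t1]; rewrite /c /= scale1r scale0r addr0 subrKC subr0 mulr1 => ->.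
apply: le_trans (ler_norm_sum _ _ _) _.
have -> : m%:R * B * `|x - y| = \sum_(j < m) `|x - y| * B.
  by rewrite sumr_const card_ord -[RHS]mulr_natl; ring.
apply: ler_sum => j _; rewrite normrM ler_pM //; first exact: rV_norm_coord.
by apply: dB; apply: cB; rewrite !ltW.
Qed.

Lemma smooth_locally_lipschitz m (U : set 'rV[R]_m) (f : 'rV[R]_m -> R) x0 :
  open U -> smooth_on U f -> U x0 -> exists rho L, [/\ 0 < rho, 0 <= L,
    (forall x, `|x - x0| < rho -> U x) &
    forall x y, `|x - x0| < rho -> `|y - x0| < rho ->
      `|f x - f y| <= L * `|x - y|].
Proof.
move=> oU sf Ux0.
have H : \forall x \near x0, U x /\ forall i, `|partial i f x| <= `|partial i f x0| + 1.
  near=> x; split; first by near: x; exact: open_nbhs_nbhs.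
  move=> i; suff : `|partial i f x0 - partial i f x| < 1.
    move=> h; have := ler_distD (partial i f x0) (partial i f x) 0.
    by rewrite !subr0 distrC => /le_trans; apply; rewrite addrC lerD2l ltW.
  move: i; near: x; apply: filter_forall => i.
  have := smooth_on_continuous (smooth_on_partial i sf) Ux0.
  by move=> /cvgrPdist_lt/(_ 1 ltr01).
have [rho /= rho0 Hr] := (nbhs_ballP _ _).1 H.
have Hb x : `|x - x0| < rho -> ball x0 rho x by rewrite -ball_normE /= distrC.
exists rho, (m%:R * \sum_(i < m) (`|partial i f x0| + 1)); split => //.
- by rewrite mulr_ge0 // sumr_ge0 // => i _; rewrite addr_ge0.
- by move=> x /Hb/Hr[].
- apply: ball_lipschitz => [x /Hb/Hr[Ux _]|x i /Hb/Hr[_ /(_ i)]].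
    exact: smooth_on_diff sf Ux.
  move/le_trans; apply; rewrite (bigD1 i) //= lerDl sumr_ge0 // => j _; rewrite addr_ge0.
Unshelve. all: by end_near. Qed.

End curves.

(** * Boxes and smooth cutoff functions *)

Section cutoff.
Variables (R : realType) (m : nat).

(** A cube, so that [vcons] splits it into an interval and a cube of one dimension less: its measure
    and the slices in Fubini arguments are explicit. *)
Definition box (x0 : 'rV[R]_m) (rho : R) : set 'rV[R]_m :=
  [set x | forall i, `|x 0 i - x0 0 i| <= rho].

Lemma box_closed x0 rho : closed (box x0 rho).
Proof.
have -> : box x0 rho = \bigcap_(i in [set: 'I_m])
    ((fun x : 'rV[R]_m => `|x 0 i - x0 0 i|) @^-1` [set t | t <= rho]).
  by apply/seteqP; split=> x /= H i; [move=> _|]; exact: H.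
apply: closed_bigI => i _; apply: preimage_closed; last exact: closed_le.
move=> x _; apply: (@continuous_comp _ _ _ (fun x : 'rV[R]_m => x 0 i - x0 0 i) Num.norm).
  apply: differentiable_continuous; apply: differentiableB => //.
  exact: differentiable_coord.
exact: norm_continuous.
Qed.

Lemma box_compact x0 rho : compact (box x0 rho).
Proof.
apply: bounded_closed_compact; last exact: box_closed.
exists (`|x0| + `|rho|); split; first exact: num_real.
move=> M hM x bx; apply/rV_norm_le; first by apply: le_trans (ltW hM); rewrite addr_ge0.
move=> i; have := bx i; have := rV_norm_coord x0 i.
have := ler_distD (x0 0 i) (x 0 i) 0; rewrite !subr0 => h1 h2 h3.
have := ler_norm rho; move: hM; lra.
Qed.

Lemma box_sub_ball x0 rho e x : 0 <= rho -> rho < e -> box x0 rho x -> `|x - x0| < e.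
Proof.
move=> r0 re bx; apply/rV_norm_lt; first exact: le_lt_trans re.
by move=> i; rewrite !mxE; apply: le_lt_trans re.
Qed.

Lemma smooth_cutoff (x0 : 'rV[R]_m) (rho : R) : 0 < rho -> exists chi : 'rV[R]_m -> R,
  [/\ smooth_on setT chi, forall x, 0 <= chi x,
      forall x : 'rV[R]_m, (forall i, `|x 0 i - x0 0 i| < rho) -> 0 < chi x &
      forall x, ~ box x0 rho x -> chi x = 0].
Proof.
move=> r0; have oT : open [set: 'rV[R]_m] by exact: openT.
pose c (x : 'rV[R]_m) i := rho ^+ 2 - (x 0 i - x0 0 i) * (x 0 i - x0 0 i).
have b0 t : 0 <= bump (1 : {poly R}) t.
  by rewrite /bump; case: ifP => // _; rewrite hornerC mul1r expR_ge0.
exists (fun x => \prod_i bump 1 (c x i)); split.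
- apply: smooth_on_prod => // i.
  apply: (@smooth_on_comp1 _ _ _ _ setT _ (fun x => c x i)) => //; first exact: smooth1_bump.
  have s : smooth_on setT (fun x : 'rV[R]_m => x 0 i - x0 0 i).
    by apply: smooth_onB => //; [exact: smooth_on_coord|exact: smooth_on_cst].
  by apply: smooth_onB => //; [exact: smooth_on_cst|exact: smooth_onM].
- by move=> x; apply: prodr_ge0.
- move=> x hx; apply: prodr_gt0 => i _; rewrite /bump ifT.
    by rewrite hornerC mul1r expR_gt0.
  have := hx i; rewrite /c subr_gt0 ltr_norml expr2 => /andP[]; move: (_ - _) => u; nra.
- move=> x /existsNP[i /negP]; rewrite -ltNge => hx.
  rewrite (bigD1 i) //= /bump ifF ?mul0r //; apply/negbTE; rewrite -leNgt /c.
  move: hx; rewrite subr_le0 expr2 lter_normr => /orP[]; move: (_ - _) => u; nra.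
Qed.

End cutoff.

(** * Charts *)

Section charts.
Variables (R : realType) (T : topologicalType) (d : nat).
Implicit Type c : chart R T d.

Lemma cdom_cpsi c x : cim c x -> cdom c (cpsi c x).
Proof. by move=> [p cp <-]; rewrite cphiK. Qed.

Lemma cpsiK c x : cim c x -> cphi c (cpsi c x) = x.
Proof. by move=> [p cp <-]; rewrite cphiK. Qed.

Lemma cim_cphi c p : cdom c p -> cim c (cphi c p).
Proof. by move=> cp; exists p. Qed.

Lemma cphi_imageE c (O : set T) :
  cphi c @` (cdom c `&` O) = [set x | cim c x /\ O (cpsi c x)].
Proof.
apply/seteqP; split=> [_ [p [cp Op] <-]|x [cx Ox]] /=.
  by split; [exact: cim_cphi|rewrite cphiK].
by exists (cpsi c x); [split => //; exact: cdom_cpsi|exact: cpsiK].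
Qed.

Lemma cphi_image_open c (O : set T) : open O -> open (cphi c @` (cdom c `&` O)).
Proof.
move=> oO; rewrite cphi_imageE openE => x [cx Ox].
have h1 : nbhs x (cim c) by apply: open_nbhs_nbhs; split => //; exact: cim_open.
have h2 : nbhs x (cpsi c @^-1` O).
  by apply: (cpsi_continuous cx); exact: open_nbhs_nbhs.
by rewrite /interior; near=> y; split; near: y.
Unshelve. all: by end_near. Qed.

Lemma cpsi_image_compact c (K : set 'rV[R]_d) : compact K -> K `<=` cim c ->
  compact (cpsi c @` K).
Proof.
move=> cK Kc; apply: continuous_compact => //.
apply: continuous_in_subspaceT => x; rewrite inE => Kx.
exact/cpsi_continuous/Kc.
Qed.

End charts.

Section atlas.
Variables (R : realType) (d : nat) (M : manifold R d).
Implicit Types (c : chart R M d) (g : M -> 'M[R]_d).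

Lemma transition_diff c c' x : atlas c -> atlas c' -> cim c x -> cdom c' (cpsi c x) ->
  differentiable (cphi c' \o cpsi c) x.
Proof.
move=> ac ac' cx cx'; apply: smooth_map_diff (atlas_smooth ac ac') _.
by rewrite cphi_imageE.
Qed.

Lemma transition_jacobianK c c' x : atlas c -> atlas c' -> cim c x ->
  cdom c' (cpsi c x) ->
  jacobian (cphi c' \o cpsi c) x *m
    jacobian (cphi c \o cpsi c') (cphi c' (cpsi c x)) = 1%:M.
Proof.
move=> ac ac' cx cx'.
have d1 := transition_diff ac ac' cx cx'.
have d2 : differentiable (cphi c \o cpsi c') ((cphi c' \o cpsi c) x).
  apply: transition_diff => //; first exact: cim_cphi.
  by rewrite /= cphiK //; exact: cdom_cpsi.
rewrite -(jacobian_comp d1 d2) -(jacobian_id x).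
apply: near_jacobian; last exact: differentiable_comp.
have oW : open (cphi c @` (cdom c `&` cdom c')) by exact/cphi_image_open/cdom_open.
apply: (open_near oW) => [|y]; rewrite cphi_imageE // => -[cy cy'] /=.
by rewrite cphiK // cpsiK.
Qed.

Lemma coord_frame_unit c x : atlas c -> cim c x -> coord_frame c x \in unitmx.
Proof.
move=> ac cx; have := @transition_jacobianK c (chart_at (cpsi c x)) x ac
  (chart_at_atlas _) cx (chart_at_dom _).
rewrite -/(coord_frame c x) => /mulmx1_unit[uJ _].
exact: uJ.
Qed.

Lemma gram_sym c g x : (g (cpsi c x))^T = g (cpsi c x) -> (gram g c x)^T = gram g c x.
Proof. by move=> gs; rewrite /gram !trmx_mul trmxK gs mulmxA. Qed.

Lemma gram_unit c g x : atlas c -> cim c x -> g (cpsi c x) \in unitmx ->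
  gram g c x \in unitmx.
Proof.
move=> ac cx ug; have uc := coord_frame_unit ac cx.
by rewrite /gram !unitmx_mul unitmx_tr uc ug.
Qed.

Lemma gram_posdef c g x : atlas c -> cim c x -> posdef (g (cpsi c x)) ->
  posdef (gram g c x).
Proof.
move=> ac cx [gs gp]; split; first exact: gram_sym.
move=> v v0; have uc := coord_frame_unit ac cx.
have := gp (v *m coord_frame c x); rewrite trmx_mul !mulmxA; apply.
by apply: contra_neq v0 => /(congr1 (mulmx^~ (invmx (coord_frame c x)))); rewrite mulmxK // mul0mx.
Qed.

Lemma chart_curve c c' (gam : R -> M) s : atlas c -> atlas c' ->
  {for s, continuous gam} -> cdom c (gam s) -> cdom c' (gam s) ->
  derivable (cphi c \o gam) s 1 ->
  derivable (cphi c' \o gam) s 1 /\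
  derive1 (cphi c' \o gam) s = derive1 (cphi c \o gam) s *m
    jacobian (cphi c' \o cpsi c) (cphi c (gam s)).
Proof.
move=> ac ac' cg cs cs' dg.
have dT : differentiable (cphi c' \o cpsi c) ((cphi c \o gam) s).
  by apply: transition_diff; rewrite /= ?cphiK //; exact: cim_cphi.
have [dd e] := derive1_comp_curve dg dT.
have E : \near s, (((cphi c' \o cpsi c) \o (cphi c \o gam)) s = (cphi c' \o gam) s).
  have : nbhs s (gam @^-1` cdom c).
    by apply: cg; apply: open_nbhs_nbhs; split => //; exact: cdom_open.
  by apply: filterS => u cu /=; rewrite cphiK.
split; first exact: near_eq_derivable E dd.
by rewrite -[RHS]e !derive1E; apply/esym/near_eq_derive.
Qed.

Lemma velocityE c (gam : R -> M) s : atlas c -> {for s, continuous gam} ->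
  cdom c (gam s) -> derivable (cphi c \o gam) s 1 ->
  velocity gam s = derive1 (cphi c \o gam) s *m coord_frame c (cphi c (gam s)).
Proof.
move=> ac cg cs dg; rewrite /coord_frame cphiK //.
by have [] := @chart_curve c (chart_at (gam s)) gam s ac (chart_at_atlas _) cg cs
  (chart_at_dom _) dg.
Qed.

End atlas.

(** The segment from the identity to A consists of positive definite, hence nonsingular, matrices.
    The determinant along it is a polynomial in t with value 1 at t = 0, so by the intermediate
    value theorem it cannot become nonpositive at t = 1. *)
Lemma posdef_det (R : realType) m (A : 'M[R]_m) : posdef A -> 0 < \det A.
Proof.
move=> [_ pA].
pose B (t : R) : 'M[R]_m := t *: A + (1 - t) *: 1%:M.
have detB (t : R) : 0 <= t <= 1 -> \det (B t) != 0.
  move=> /andP[t0 t1]; apply/negP => /det0P[v v0 /(congr1 (fun u => (u *m v^T) 0 0))].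
  have -> : (v *m B t *m v^T) 0 0 = t * (v *m A *m v^T) 0 0 + (1 - t) * (v *m v^T) 0 0.
    rewrite /B mulmxDr mulmxDl -!scalemxAr mulmx1 -!scalemxAl.
    by rewrite mxE [X in X + _]mxE [X in _ + X]mxE.
  rewrite mul0mx [X in _ = X]mxE => h.
  have h2 : 0 < (v *m v^T) 0 0.
    have [i vi] : exists i, v 0 i != 0 by apply/rV0Pn.
    rewrite mxE (bigD1 i) //= mxE ltr_pwDl //.
      by rewrite lt_neqAle eq_sym mulf_neq0 //= -expr2 sqr_ge0.
    by apply: sumr_ge0 => j _; rewrite mxE -expr2 sqr_ge0.
  have h1 := pA v v0; move: h h1 h2; move: ((v *m A *m v^T) 0 0) ((v *m v^T) 0 0) => a b h h1 h2.
  have [t0'|t0'] := eqVneq t 0; first by move: h; rewrite t0'; lra.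
  have tp : 0 < t by rewrite lt_neqAle eq_sym t0'.
  nra.
pose P : {poly R} := \det ('X *: map_mx polyC A + (1 - 'X) *: 1%:M).
have PE (t : R) : P.[t] = \det (B t).
  rewrite -horner_evalE -det_map_mx; congr (\det _).
  apply/matrixP => i j; rewrite !mxE /= horner_evalE.
  by case: (i == j); rewrite !(hornerD, hornerM, hornerN, hornerX, hornerC) //= ?mulr1 ?mulr0.
rewrite ltNge; apply/negP => dA.
have [|t t01] := @poly_ivt R (- P) 0 1 ler01.
  rewrite !hornerN !PE /B scale0r subr0 scale1r add0r det1 subrr scale0r addr0 scale1r.
  by rewrite oppr_le0 ler01 oppr_ge0.
by rewrite rootN /root PE; apply/negP/detB.
Qed.

(** * Gram matrix and Christoffel symbols of a Lorentzian metric *)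

Section lorentzian_geometry.
Variables (R : realType) (n : nat) (M : manifold R n.+1) (g : M -> 'M[R]_n.+1).
Hypothesis hg : lorentzian g.

Lemma lorentzian_unit p : g p \in unitmx.
Proof.
have [_ /(_ p)[_ [P uP e]]] := hg.
have : P *m g p *m P^T \in unitmx.
  rewrite e unitmxE det_lblock det_scalar1 det1 mulr1 unitrN unitr1 //.
by rewrite !unitmx_mul => /andP[/andP[]].
Qed.

Lemma smooth_gram c i j : atlas c -> smooth_on (cim c) (fun x => gram g c x i j).
Proof.
move=> ac; have [sf _] := hg; have := sf c ac i j.
by rewrite cphi_imageE; apply: smooth_on_sub => x.
Qed.

Lemma smooth_christoffel c k i j : atlas c ->
  smooth_on (cim c) (fun x => christoffel g c x k i j).
Proof.
move=> ac; have oc := cim_open (c := c).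
apply: smooth_onZ => //; apply: smooth_on_sum => // l; apply: smooth_onM => //.
  apply: smooth_on_invmx => // [a b|x cx]; first exact: smooth_gram.
  exact/gram_unit/lorentzian_unit.
have sG a b e : smooth_on (cim c) (partial a (fun y => gram g c y b e)).
  exact/smooth_on_partial/smooth_gram.
by apply: smooth_onB => //; apply: smooth_onD.
Qed.

End lorentzian_geometry.

(** * Continuous dependence of geodesics on parameters *)

Section ode.
Variable R : realType.

(** Induction along an interval, by the supremum of the s such that P holds on [a, s]: the second
    rule puts the supremum into the set, the first one pushes beyond it. It is the device by which
    estimates are continued along a geodesic. *)
Lemma real_induction (P : R -> Prop) a b : a <= b -> P a ->
  (forall s, a <= s < b -> (forall t, a <= t <= s -> P t) ->
     exists2 e, 0 < e & forall t, s < t < s + e -> t <= b -> P t) ->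
  (forall s, a < s <= b -> (forall t, a <= t < s -> P t) -> P s) ->
  forall s, a <= s <= b -> P s.
Proof.
move=> ab Pa Pr Pl.
pose E := [set s | a <= s <= b /\ forall t, a <= t <= s -> P t].
have Ea : E a by split; rewrite ?lexx // => t /andP[h1 h2]; rewrite (_ : t = a) //; lra.
have hE : has_sup E by split; [exists a|exists b => s [/andP[]]].
have ubE : ubound E (sup E) by exact: sup_upper_bound.
have aS : a <= sup E by exact: ubE.
have Sb : sup E <= b by apply: ge_sup => [|s [/andP[]]]; first by exists a.
have PS t : a <= t < sup E -> P t.
  move=> /andP[at_ tS]; have e0 : 0 < sup E - t by rewrite subr_gt0.
  have [s Es ts] := sup_adherent e0 hE.
  by case: Es => _; apply; rewrite at_ /=; move: ts; lra.
have PsE : P (sup E).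
  move: aS; rewrite le_eqVlt => /orP[/eqP <- //|aS].
  by apply: Pl => //; rewrite aS.
have PS' t : a <= t <= sup E -> P t.
  move=> /andP[at_]; rewrite le_eqVlt => /orP[/eqP -> //|tS].
  by apply: PS; rewrite at_.
have [SEb|bSE] := ltP (sup E) b; last first.
  by move=> s /andP[as_ sb]; apply: PS'; rewrite as_ /=; exact: le_trans sb bSE.
have [e e0 He] := Pr (sup E) (introT andP (conj aS SEb)) PS'.
pose t := Num.min b (sup E + e / 2).
have : E t.
  have St : sup E < t by rewrite lt_min SEb /=; lra.
  split; first by rewrite (le_trans aS (ltW St)) /= ge_min lexx.
  move=> u /andP[au ut]; have [uS|Su] := leP u (sup E).
    by apply: PS'; rewrite au.
  have tb : t <= b by rewrite ge_min lexx.
  have te : t <= sup E + e / 2 by rewrite ge_min lexx orbT.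
  by apply: He; [rewrite Su /=; lra|exact: le_trans tb].
move=> /ubE; rewrite leNgt => /negP; case.
by rewrite lt_min SEb /=; lra.
Qed.

Lemma is_derive_continuous m (u : R -> 'rV[R]_m) (s : R) v :
  is_derive s 1 u v -> {for s, continuous u}.
Proof. by move=> [d _]; apply: differentiable_continuous; exact/derivable1_diffP. Qed.

Lemma is_derive_rV_coord m (u : R -> 'rV[R]_m) (s : R) (v : 'rV[R]_m) j :
  is_derive s 1 u v -> is_derive s 1 (fun t => u t 0 j) (v 0 j).
Proof.
move=> [d <-]; have [d1 e] := derivable_rV_coord j d.
by apply: DeriveDef => //; rewrite -!derive1E e.
Qed.

(** A substitute for Gronwall's inequality on a short interval. At the point c where |u - w| is
    largest, the mean value theorem in each coordinate gives D c <= D a + (c - a) L D c <= D a + D c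
    / 2. *)
Lemma ode_stability m (f : 'rV[R]_m -> 'rV[R]_m) (y0 : 'rV[R]_m) (rho L : R)
    (u w : R -> 'rV[R]_m) (a b : R) :
  0 <= L -> (b - a) * L <= 2^-1 ->
  (forall x y : 'rV[R]_m, `|x - y0| < rho -> `|y - y0| < rho ->
     `|f x - f y| <= L * `|x - y|) ->
  (forall s, a <= s <= b -> [/\ is_derive s 1 u (f (u s)),
     is_derive s 1 w (f (w s)), `|u s - y0| < rho & `|w s - y0| < rho]) ->
  forall s, a <= s <= b -> `|u s - w s| <= 2 * `|u a - w a|.
Proof.
move=> L0 abL fL H s sab.
have ab : a <= b by move: sab => /andP[]; exact: le_trans.
pose D (t : R) := `|u t - w t|.
have cD : {within `[a, b], continuous D}.
  apply: continuous_in_subspaceT => t; rewrite inE /= in_itv /= => /H[du dw _ _].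
  have c1 := is_derive_continuous du; have c2 := is_derive_continuous dw.
  apply: (@continuous_comp _ _ _ (fun t => u t - w t) Num.norm); last exact: norm_continuous.
  exact: (@cvgB _ _ _ _ _ u w).
have [c cab Dc] := EVT_max ab cD.
have Dc' t : a <= t <= b -> D t <= D c by move=> h; apply: Dc; rewrite in_itv.
apply: le_trans (Dc' s sab) _.
rewrite in_itv /= in cab; have /andP[ac cb] := cab.
suff : D c <= D a + 2^-1 * D c by rewrite /D; lra.
have Dc0 : 0 <= D c by exact: normr_ge0.
have Da0 : 0 <= D a by exact: normr_ge0.
apply/rV_norm_le => [|j]; first by rewrite addr_ge0 ?mulr_ge0.
move: ac; rewrite le_eqVlt => /orP[/eqP ac|ac].
  apply: le_trans (rV_norm_coord _ _) _; rewrite -/(D c) -ac; lra.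
pose h t := u t 0 j - w t 0 j.
have dh t : a <= t <= b -> is_derive t 1 h (f (u t) 0 j - f (w t) 0 j).
  move=> /H[du dw _ _].
  apply: (@is_deriveB _ _ _ (fun t => u t 0 j) (fun t => w t 0 j)).
    exact: (is_derive_rV_coord j du).
  exact: (is_derive_rV_coord j dw).
have inab t : a <= t <= c -> a <= t <= b.
  by move=> /andP[-> /le_trans]; exact.
have [t] : exists2 t, t \in `]a, c[%R & h c - h a = (f (u t) 0 j - f (w t) 0 j) * (c - a).
  apply: MVT => //.
    move=> t; rewrite in_itv /= => /andP[t0 t1]; apply: dh; apply: inab.
    by rewrite !ltW.
  apply: derivable_within_continuous => t; rewrite in_itv /= => /inab ht.
  by have [] := dh t ht.
rewrite in_itv /= => /andP[t0 t1] e.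
have tab : a <= t <= b by apply: inab; rewrite !ltW.
have [_ _ hu hw] := H t tab.
have fd : `|f (u t) 0 j - f (w t) 0 j| <= L * D c.
  have := rV_norm_coord (f (u t) - f (w t)) j; rewrite !mxE => /le_trans; apply.
  by apply: le_trans (fL _ _ hu hw) _; rewrite ler_wpM2l // Dc'.
have -> : (u c - w c) 0 j = h a + (f (u t) 0 j - f (w t) 0 j) * (c - a).
  by rewrite -e /h !mxE; ring.
apply: le_trans (ler_normD _ _) _; apply: lerD.
  by have := rV_norm_coord (u a - w a) j; rewrite !mxE.
rewrite normrM (gtr0_norm (_ : 0 < c - a)) ?subr_gt0 //.
apply: le_trans (_ : (L * D c) * (c - a) <= _).
  by rewrite ler_wpM2r // subr_ge0 ltW.
have : (c - a) * L <= 2^-1 by apply: le_trans abL; rewrite ler_wpM2r // lerB.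
move=> h2; rewrite mulrC mulrA; exact: ler_wpM2r.
Qed.

Lemma smooth_map_locally_lipschitz m k (U : set 'rV[R]_m) (F : 'rV[R]_m -> 'rV[R]_k) x0 :
  open U -> smooth_map_on U F -> U x0 -> exists rho L, [/\ 0 < rho, 0 <= L,
    (forall x, `|x - x0| < rho -> U x) &
    forall x y, `|x - x0| < rho -> `|y - x0| < rho ->
      `|F x - F y| <= L * `|x - y|].
Proof.
move=> oU sF Ux0.
have /choice[rL HrL] : forall j, exists rL : R * R, [/\ 0 < rL.1, 0 <= rL.2,
    (forall x, `|x - x0| < rL.1 -> U x) &
    forall x y, `|x - x0| < rL.1 -> `|y - x0| < rL.1 ->
      `|F x 0 j - F y 0 j| <= rL.2 * `|x - y|].
  by move=> j; have [r [L H]] := smooth_locally_lipschitz oU (sF j) Ux0; exists (r, L).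
have /nbhs_ballP[r0 /= r00 Hr0] : nbhs x0 U by exact: open_nbhs_nbhs.
exists (\big[Num.min/r0]_j (rL j).1), (\sum_j (rL j).2).
have L0 : 0 <= \sum_j (rL j).2 by apply: sumr_ge0 => j _; case: (HrL j).
split => //.
- by apply: lt_bigmin => // j _; case: (HrL j).
- move=> x xr; apply: Hr0; rewrite -ball_normE /= distrC.
  by apply: lt_le_trans xr _; exact: bigmin_le_id.
- move=> x y xr yr; apply/rV_norm_le => [|j]; first by rewrite mulr_ge0.
  have [_ _ _ H] := HrL j.
  have hj : \big[Num.min/r0]_j (rL j).1 <= (rL j).1 by exact: bigmin_le_cond.
  have := H x y (lt_le_trans xr hj) (lt_le_trans yr hj); rewrite !mxE => /le_trans; apply.
  apply: ler_wpM2r => //; rewrite (bigD1 j) //= lerDl sumr_ge0 // => i _.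
  by case: (HrL i).
Qed.

End ode.

(** * The geodesic equation as a first order system in a chart *)

Section geodesic_flow.
Variables (R : realType) (n : nat) (M : manifold R n.+1) (g : M -> 'M[R]_n.+1).
Hypothesis hg : lorentzian g.
Notation d := n.+1.
Implicit Types (c : chart R M d) (gam : R -> M).

Definition state c gam (s : R) : 'rV[R]_(d + d) :=
  locked (row_mx (cphi c (gam s)) (derive1 (cphi c \o gam) s)).

Lemma stateE c gam s :
  state c gam s = row_mx (cphi c (gam s)) (derive1 (cphi c \o gam) s).
Proof. by rewrite /state -lock. Qed.

Definition state_dom c : set 'rV[R]_(d + d) := [set y | cim c (lsubmx y)].

(* The geodesic equation in the coordinates (x, v) of the tangent bundle reads
   y' = spray c y. *)
Definition spray c (y : 'rV[R]_(d + d)) : 'rV[R]_(d + d) :=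
  row_mx (rsubmx y)
    (\row_k - \sum_i \sum_j christoffel g c (lsubmx y) k i j * rsubmx y 0 i * rsubmx y 0 j).

Lemma smooth_lsubmx m1 m2 (U : set 'rV[R]_(m1 + m2)) : open U ->
  smooth_map_on U lsubmx.
Proof.
by move=> oU j; under eq_fun do rewrite mxE; exact: smooth_on_coord.
Qed.

Lemma smooth_rsubmx m1 m2 (U : set 'rV[R]_(m1 + m2)) : open U ->
  smooth_map_on U rsubmx.
Proof.
by move=> oU j; under eq_fun do rewrite mxE; exact: smooth_on_coord.
Qed.

Lemma lsubmx_preimage_open m1 m2 (U : set 'rV[R]_m1) : open U ->
  open [set y : 'rV[R]_(m1 + m2) | U (lsubmx y)].
Proof.
move=> oU; apply: (@open_comp _ _ (fun y : 'rV[R]_(m1 + m2) => lsubmx y)) => // x _.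
exact: (smooth_map_continuous (smooth_lsubmx (@openT _))).
Qed.

Lemma state_dom_open c : open (state_dom c).
Proof. exact/lsubmx_preimage_open/cim_open. Qed.

Lemma smooth_spray c : atlas c -> smooth_map_on (state_dom c) (spray c).
Proof.
move=> ac j; have oW := @state_dom_open c.
rewrite /spray; case: (split_ordP j) => i ->.
  under eq_fun do rewrite row_mxEl; exact: smooth_rsubmx.
under eq_fun do rewrite row_mxEr mxE.
apply: smooth_onN => //; apply: smooth_on_sum => // a; apply: smooth_on_sum => // b.
apply: smooth_onM => //; last exact: smooth_rsubmx.
apply: smooth_onM => //; last exact: smooth_rsubmx.
exact: (smooth_on_comp oW (smooth_christoffel hg i a b ac) (smooth_lsubmx oW)).
Qed.

Lemma state_derive c gam (I : set R) s : geodesic_on g I gam -> I s -> atlas c ->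
  cdom c (gam s) -> is_derive s 1 (state c gam) (spray c (state c gam s)).
Proof.
move=> hgam Is ac cs; have [_ /(_ c ac cs)[dx ddx eq]] := hgam s Is.
apply: is_derive_rV => j; rewrite /spray stateE row_mxKl row_mxKr.
case: (split_ordP j) => i ->.
  under eq_fun do rewrite stateE row_mxEl; rewrite row_mxEl.
  have [d1 e1] := derivable_rV_coord i dx.
  by apply: DeriveDef => //; rewrite -derive1E e1.
under eq_fun do rewrite stateE row_mxEr; rewrite row_mxEr mxE.
have [d1 e1] := derivable_rV_coord i ddx.
by apply: DeriveDef => //; rewrite -derive1E e1 eq.
Qed.

Lemma state_continuous c gam (I : set R) s : geodesic_on g I gam -> I s -> atlas c ->
  cdom c (gam s) -> {for s, continuous (state c gam)}.
Proof.
by move=> h Is ac cs; exact: (is_derive_continuous (state_derive h Is ac cs)).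
Qed.

Lemma state_in_dom c gam s : cdom c (gam s) -> state_dom c (state c gam s).
Proof. by move=> cs; rewrite /state_dom /= stateE row_mxKl; exact: cim_cphi. Qed.

Lemma near_cdom c gam (I : set R) s : geodesic_on g I gam -> I s ->
  cdom c (gam s) -> \forall t \near s, cdom c (gam t).
Proof.
move=> h Is cs; have [cg _] := h s Is; apply: cg.
by apply: open_nbhs_nbhs; split => //; exact: cdom_open.
Qed.

(** States change between charts by [Psi], the tangent map of the transition, which is continuous at
    the reference state. The radius e' depends on the reference state only and serves all geodesics
    and all times at once; the parameter dependence relies on this uniformity. *)
Lemma chart_state c c' gam0 s0 (I0 : set R) (e : R) : atlas c -> atlas c' ->
  geodesic_on g I0 gam0 -> I0 s0 -> cdom c (gam0 s0) -> cdom c' (gam0 s0) -> 0 < e ->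
  exists2 e', 0 < e' & forall gam s (I : set R), geodesic_on g I gam -> I s ->
    cdom c (gam s) -> `|state c gam s - state c gam0 s0| < e' ->
    cdom c' (gam s) /\ `|state c' gam s - state c' gam0 s0| < e.
Proof.
move=> ac ac' h0 I0s cs0 cs0' e0.
pose W := cphi c @` (cdom c `&` cdom c').
have oW : open W by apply: cphi_image_open; exact: cdom_open.
pose WW := [set y : 'rV[R]_(d + d) | W (lsubmx y)].
have oWW : open WW by exact: lsubmx_preimage_open.
pose tau := cphi c' \o cpsi c.
have st : smooth_map_on W tau by exact: atlas_smooth.
pose Psi (y : 'rV[R]_(d + d)) : 'rV[R]_(d + d) :=
  row_mx (tau (lsubmx y)) (rsubmx y *m jacobian tau (lsubmx y)).
have sPsi : smooth_map_on WW Psi.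
  move=> j; rewrite /Psi; case: (split_ordP j) => i ->.
    under eq_fun do rewrite row_mxEl.
    exact: (smooth_on_comp oWW (st i) (smooth_lsubmx oWW)).
  under eq_fun do rewrite row_mxEr.
  apply: (smooth_on_mulmx oWW) => a b; first by rewrite ord1; exact: smooth_rsubmx.
  exact: (smooth_on_comp oWW (smooth_on_jacobian oW st a b) (smooth_lsubmx oWW)).
have PsiE gam s (I : set R) : geodesic_on g I gam -> I s -> cdom c (gam s) ->
    cdom c' (gam s) -> state c' gam s = Psi (state c gam s).
  move=> h Is cs cs'; have [cg /(_ c ac cs)[dx _ _]] := h s Is.
  have [_ e1] := chart_curve ac ac' cg cs cs' dx.
  by rewrite /Psi !stateE row_mxKl row_mxKr e1 /tau /= cphiK.
have W0 : WW (state c gam0 s0) by rewrite /WW /= stateE row_mxKl; exists (gam0 s0).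
have cPsi := smooth_map_continuous sPsi W0.
have : \forall y \near state c gam0 s0, WW y /\ `|Psi y - Psi (state c gam0 s0)| < e.
  near=> y; split; first by near: y; exact: open_nbhs_nbhs.
  rewrite distrC; near: y.
  by have /cvgrPdist_lt/(_ e e0) := cPsi.
move=> /nbhs_ballP[e' /= e'0 H]; exists e' => // gam s I h Is cs hs.
have [|Ws hP] := H (state c gam s); first by rewrite -ball_normE /= distrC.
have cs' : cdom c' (gam s).
  move: Ws; rewrite /WW /= stateE row_mxKl /W cphi_imageE => -[_].
  by rewrite cphiK.
by split => //; rewrite (PsiE gam s I) // (PsiE gam0 s0 I0).
Unshelve. all: by end_near. Qed.

Lemma norm_diff_continuous m (u w : R -> 'rV[R]_m) (t : R) :
  {for t, continuous u} -> {for t, continuous w} ->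
  {for t, continuous (fun s => `|u s - w s|)}.
Proof.
move=> cu cw; apply: (@continuous_comp _ _ _ (fun t => u t - w t) Num.norm).
  exact: (@cvgB _ _ _ _ _ u w).
exact: norm_continuous.
Qed.

End geodesic_flow.

(** A bootstrap. [gam2] might leave the chart or drift away from [gam1], so both properties are
    carried together by real induction. As long as the distance of the states is below rho / 4, both
    stay in the ball where the spray is Lipschitz, and [ode_stability] improves the bound to 2 dl,
    which is strictly below rho / 4 and leaves room to continue. *)
Lemma chart_continuation (R : realType) (n : nat) (M : manifold R n.+1)
    (g : M -> 'M[R]_n.+1) (c : chart R M n.+1)
    (gam1 gam2 : R -> M) (I : set R) (y0 : 'rV[R]_(n.+1 + n.+1)) (rho L a b dl : R) :
  atlas c -> geodesic_on g I gam1 -> geodesic_on g I gam2 ->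
  (forall s, a <= s <= b -> I s) ->
  0 < rho -> 0 <= L -> (b - a) * L <= 2^-1 ->
  (forall y : 'rV[R]_(n.+1 + n.+1), `|y - y0| < rho -> state_dom c y) ->
  (forall x y : 'rV[R]_(n.+1 + n.+1), `|x - y0| < rho -> `|y - y0| < rho ->
     `|spray g c x - spray g c y| <= L * `|x - y|) ->
  (forall s, a <= s <= b -> cdom c (gam1 s) /\ `|state c gam1 s - y0| <= rho / 4) ->
  cdom c (gam2 a) -> `|state c gam1 a - state c gam2 a| <= dl -> 2 * dl < rho / 4 ->
  forall s, a <= s <= b ->
    cdom c (gam2 s) /\ `|state c gam1 s - state c gam2 s| <= 2 * dl.
Proof.
move=> ac h1 h2 abI rho0 L0 abL Hdom HL H1 c2a Hdl dlr s sab.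
have ab : a <= b by move: sab => /andP[]; exact: le_trans.
have dl0 : 0 <= dl by exact: le_trans (normr_ge0 _) Hdl.
have near_y0 t : a <= t <= b -> `|state c gam1 t - state c gam2 t| < rho / 4 ->
    `|state c gam2 t - y0| < rho / 2.
  move=> /H1[_]; move: (state c gam1 t) (state c gam2 t) => u w h h'.
  have := ler_distD u w y0; rewrite (distrC w u); move: h h'; lra.
pose P t := cdom c (gam2 t) /\ `|state c gam1 t - state c gam2 t| <= 2 * dl.
have Pa : P a by split => //; apply: le_trans Hdl _; move: dl0; clear; lra.
suff : forall t, a <= t <= b -> P t by move=> /(_ s sab).
apply: (real_induction ab Pa) => t.
- move=> /andP[at_ tb] Pt.
  have tab : a <= t <= b by rewrite at_ ltW.
  have [cg2 ht] : P t by apply: Pt; rewrite at_ lexx.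
  have [cg1 _] := H1 t tab.
  have near2 := near_cdom h2 (abI _ tab) cg2.
  have nd : \forall u \near t, `|state c gam1 u - state c gam2 u| < rho / 4.
    have cc := norm_diff_continuous (state_continuous h1 (abI _ tab) ac cg1)
      (state_continuous h2 (abI _ tab) ac cg2).
    by apply: (cvgr_lt _ cc); exact: le_lt_trans ht dlr.
  have : \forall u \near t, cdom c (gam2 u) /\ `|state c gam1 u - state c gam2 u| < rho / 4.
    by near=> u; split; near: u.
  move=> /nbhs_ballP[e /= e0 He]; exists e; [exact: e0|move=> u /andP[tu ute] ub].
  have Hu v : a <= v <= u -> cdom c (gam2 v) /\ `|state c gam1 v - state c gam2 v| < rho / 4.
    move=> /andP[av vu]; have [vt|tv] := leP v t.
      by have [cv hv] := Pt v (introT andP (conj av vt)); split; [exact: cv|exact: le_lt_trans hv dlr].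
    by apply: He; rewrite /ball /= distrC gtr0_norm ?subr_gt0 //; move: vu ute; clear; lra.
  have auu : a <= u <= u by rewrite lexx andbT; move: at_ tu; clear; lra.
  split; first by have [cu _] := Hu u auu; exact: cu.
  apply: le_trans (_ : 2 * `|state c gam1 a - state c gam2 a| <= _); last by rewrite ler_pM2l.
  have auL : (u - a) * L <= 2^-1 by apply: le_trans abL; rewrite ler_wpM2r // lerB.
  apply: (@ode_stability _ _ (spray g c) y0 rho L _ _ a u L0 auL HL _ u auu) => v /andP[av vu]; have vab : a <= v <= b by rewrite av (le_trans vu).
  have [cv2 hv] := Hu v (introT andP (conj av vu)); have [cv1 hv1] := H1 v vab.
  split; [exact: (state_derive h1 (abI _ vab) ac cv1)|exact: (state_derive h2 (abI _ vab) ac cv2)| |].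
    by apply: le_lt_trans hv1 _; move: rho0; clear; lra.
  by apply: lt_trans (near_y0 v vab hv) _; move: rho0; clear; lra.
- move=> /andP[at_ tb] Pt.
  have tab : a <= t <= b by rewrite ltW.
  (* The state of [gam2] at the limit time t makes sense only once [gam2 t] is known to lie in the
     chart domain. Before t the curve lies in the image of the compact box K, which is closed in the
     Hausdorff space M, so the limit lies there as well. *)
  pose x0 := lsubmx y0; pose K := box x0 (rho / 2).
  have KU : K `<=` cim c.
    move=> x Kx; have := Hdom (row_mx x (rsubmx y0)); rewrite /state_dom /= row_mxKl; apply.
    apply/rV_norm_lt => // j; rewrite !mxE.
    case: (split_ordP j) => i ->; rewrite ?row_mxEl ?row_mxEr.
      by apply: le_lt_trans (_ : rho / 2 < rho); [have := Kx i; rewrite mxE|move: rho0; clear; lra].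
    by rewrite mxE subrr normr0.
  have cK : closed (cpsi c @` K).
    apply: compact_closed; first exact: manifold_hausdorff.
    by apply: cpsi_image_compact => //; exact: box_compact.
  have inK u : a <= u < t -> (cpsi c @` K) (gam2 u).
    move=> hu; have [cu du] := Pt u hu.
    have uab : a <= u <= b by move: hu tb; clear; lra.
    exists (cphi c (gam2 u)); last exact: cphiK.
    have : `|state c gam2 u - y0| < rho / 2 by apply: near_y0 => //; exact: le_lt_trans du dlr.
    move=> /ltW/rV_norm_le; rewrite divr_ge0 ?(ltW rho0)//.
    move=> /(_ isT) H i; have := H (lshift _ i).
    by rewrite mxE [X in _ + X]mxE stateE row_mxEl /x0 [lsubmx _ _ _]mxE.
  have near_left (Q : R -> Prop) : (\forall u \near t, Q u) -> exists2 u, a <= u < t & Q u.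
    move=> /nbhs_ballP[e /= e0 He]; pose u := Num.max a (t - e / 2).
    have ut : u < t by rewrite gt_max at_ /=; move: e0; clear; lra.
    exists u; first by rewrite ut le_max lexx.
    apply: He; rewrite /ball /= gtr0_norm ?subr_gt0 //.
    have : t - e / 2 <= u by rewrite le_max lexx orbT.
    by move: e0; clearbody u; clear; lra.
  have Kt : (cpsi c @` K) (gam2 t).
    apply: contrapT => nK.
    have [cg _] := h2 t (abI _ tab).
    have [|u hu nu] := near_left (fun u => (~` (cpsi c @` K)) (gam2 u)).
      by apply: cg; apply: open_nbhs_nbhs; split => //; exact: closed_openC.
    exact: nu (inK u hu).
  have cg2 : cdom c (gam2 t) by case: Kt => x Kx <-; exact/cdom_cpsi/KU.
  split => //; rewrite leNgt; apply/negP => hlt.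
  have [cg1 _] := H1 t tab.
  have [|u hu] := near_left (fun u => 2 * dl < `|state c gam1 u - state c gam2 u|).
    have cc := norm_diff_continuous (state_continuous h1 (abI _ tab) ac cg1)
      (state_continuous h2 (abI _ tab) ac cg2).
    exact: (cvgr_gt _ cc).
  by have [_] := Pt u hu; rewrite leNgt => /negP.
Unshelve. all: by end_near. Qed.

Local Ltac clear_state :=
  repeat match goal with H : context [@state] |- _ => clear H end.
Local Ltac slra := clear_state; lra.
Local Ltac snra := clear_state; nra.

(** * Continuity of geodesics jointly in time and parameter *)

Section continuous_dependence.
Variables (R : realType) (n : nat) (M : manifold R n.+1) (g : M -> 'M[R]_n.+1).
Hypothesis hg : lorentzian g.
Variables (Th : topologicalType) (P : set Th) (gam : Th -> R -> M) (l : R).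
Hypothesis l0 : 0 <= l.
Hypothesis hgam : forall p, P p -> geodesic_on g [set s | 0 <= s <= l] (gam p).
Implicit Type c : chart R M n.+1.

Definition state_cvg (p0 : Th) (s : R) c :=
  [/\ atlas c, cdom c (gam p0 s) & forall e, 0 < e ->
    \forall p \near within P (nbhs p0),
      cdom c (gam p s) /\ `|state c (gam p0) s - state c (gam p) s| < e].

Lemma state_cvg_chart p0 s c c' : P p0 -> 0 <= s <= l -> state_cvg p0 s c ->
  atlas c' -> cdom c' (gam p0 s) -> state_cvg p0 s c'.
Proof.
move=> Pp0 sl [ac cs H] ac' cs'; split; [exact: ac'|exact: cs'|move=> e e0].
have [e' e'0 He'] := chart_state ac ac' (hgam Pp0) sl cs cs' e0.
have H' := H e' e'0.
have PP : \forall p \near within P (nbhs p0), P p by exact: withinT.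
near=> p.
have Pp : P p by near: p.
have [csp hp] : cdom c (gam p s) /\ `|state c (gam p0) s - state c (gam p) s| < e'.
  by near: p.
have [|h1 h2] := He' (gam p) s _ (hgam Pp) sl csp; first by rewrite distrC.
by split; [exact: h1|rewrite distrC].
Unshelve. all: by end_near. Qed.

(** The window eta depends on the reference geodesic near s0 only and is fixed before a and e. Hence
    the same statement serves to go beyond s0 (with a = s0) and to reach s0 from earlier times, and
    its conclusion is uniform in s over the window. *)
Lemma state_cvg_step p0 s0 : P p0 -> 0 <= s0 <= l -> exists eta c,
  [/\ 0 < eta, atlas c, forall s, `|s - s0| < eta -> cdom c (gam p0 s) &
    forall a, 0 <= a <= s0 -> s0 - eta < a -> (exists c', state_cvg p0 a c') ->
    forall e, 0 < e -> \forall p \near within P (nbhs p0),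
      forall s, a <= s < s0 + eta -> s <= l ->
      cdom c (gam p s) /\ `|state c (gam p0) s - state c (gam p) s| < e].
Proof.
move=> Pp0 sl; pose c := chart_at (gam p0 s0).
have ac : atlas c by exact: chart_at_atlas.
have cs0 : cdom c (gam p0 s0) by exact: chart_at_dom.
pose y0 := state c (gam p0) s0.
have [rho [L [rho0 L0 Hdom HL]]] := smooth_map_locally_lipschitz
  (@state_dom_open _ _ _ c) (smooth_spray hg ac) (state_in_dom cs0).
have c0 := state_continuous (hgam Pp0) sl ac cs0.
have : \forall s \near s0, cdom c (gam p0 s) /\ `|state c (gam p0) s - y0| <= rho / 4.
  have nc := near_cdom (hgam Pp0) sl cs0.
  have nr : \forall s \near s0, `|state c (gam p0) s0 - state c (gam p0) s| <= rho / 4.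
    by move/cvgrPdist_le : c0; apply; rewrite divr_gt0.
  near=> s; split; first by near: s.
  by rewrite distrC; near: s.
move=> /nbhs_ballP[eta1 /= eta10 Heta].
(* Both a and s lie within eta of s0, so s - a is at most 2 eta and (s - a) * L <= 1/2, as
   [ode_stability] requires. *)
pose eta := Num.min eta1 (4 * (L + 1))^-1.
have L1 : 0 < 4 * (L + 1) by rewrite mulr_gt0 // ltr_wpDl.
have eta0 : 0 < eta by rewrite lt_min eta10 invr_gt0.
have Hs s : `|s - s0| < eta -> cdom c (gam p0 s) /\ `|state c (gam p0) s - y0| <= rho / 4.
  move=> h; apply: Heta; rewrite /ball /= distrC; apply: lt_le_trans h _.
  by rewrite ge_min lexx.
exists eta, c; split; [exact: eta0|exact: ac|by move=> s /Hs[]|].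
move=> a /andP[a0 as0] sa [c' Qa] e e0.
have al : 0 <= a <= l.
  by rewrite a0 /=; move: sl => /andP[_]; exact: le_trans.
have aeta : `|a - s0| < eta.
  by rewrite distrC ger0_norm ?subr_ge0 // ltrBlDr -ltrBlDl.
have [cga _] := Hs a aeta.
have [_ _ Qc] := state_cvg_chart Pp0 al Qa ac cga.
(* The deviation at most doubles on the window: 2 dl has to be below e for the conclusion and below
   rho / 4 for the continuation. *)
pose dl := Num.min (e / 4) (rho / 16).
have dl0 : 0 < dl by rewrite lt_min !divr_gt0.
have dle : dl <= e / 4 by rewrite ge_min lexx.
have dlr : dl <= rho / 16 by rewrite ge_min lexx orbT.
have Qd := Qc dl dl0.
have PP : \forall p \near within P (nbhs p0), P p by exact: withinT.
near=> p => s /andP[as_ seta] sl'.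
have Pp : P p by near: p.
have [cpa hpa] : cdom c (gam p a) /\ `|state c (gam p0) a - state c (gam p) a| < dl.
  by near: p.
have sLe : (s - a) * L <= 2^-1.
  have h1 : s - a <= 2 * (4 * (L + 1))^-1.
    have : eta <= (4 * (L + 1))^-1 by rewrite ge_min lexx orbT.
    move: sa seta; slra.
  apply: le_trans (_ : 2 * (4 * (L + 1))^-1 * L <= _); first exact: ler_wpM2r.
  rewrite invfM; have : (L + 1)^-1 * L <= 1.
    by rewrite mulrC ler_pdivrMr ?mul1r ?lerDl // ltr_wpDl.
  move: ((L + 1)^-1) => u; snra.
have [cps hps] : cdom c (gam p s) /\ `|state c (gam p0) s - state c (gam p) s| <= 2 * dl.
  apply: (@chart_continuation _ _ _ _ c (gam p0) (gam p) [set s | 0 <= s <= l] y0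
    rho L a s dl ac (hgam Pp0) (hgam Pp) _ rho0 L0 sLe Hdom HL _ cpa (ltW hpa)).
  - move=> t /andP[h1 h2] /=; rewrite (le_trans a0 h1) /=; exact: le_trans h2 sl'.
  - move=> t /andP[h1 h2]; apply: Hs; rewrite ltr_norml.
    move: sa seta h1 h2; slra.
  - move: dlr rho0; slra.
  - by rewrite as_ lexx.
split; first exact: cps.
by apply: le_lt_trans hps _; move: dle e0; slra.
Unshelve. all: by end_near. Qed.

Hypothesis init : forall p, P p -> exists c, state_cvg p 0 c.

Lemma state_cvg_all p0 s : P p0 -> 0 <= s <= l -> exists c, state_cvg p0 s c.
Proof.
move=> Pp0; move: s.
apply: (@real_induction R (fun s => exists c, state_cvg p0 s c) 0 l l0 (init Pp0)) => s.
- move=> /andP[s0 sl] H.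
  have sl' : 0 <= s <= l by rewrite s0 ltW.
  have [eta [c [eta0 ac Hc Hstep]]] := state_cvg_step Pp0 sl'.
  exists eta; first exact: eta0.
  move=> t /andP[st te] tl; exists c.
  have ss : 0 <= s <= s by rewrite s0 lexx.
  have se : s - eta < s by rewrite ltrBlDr ltrDl.
  split; first exact: ac.
    by apply: Hc; rewrite gtr0_norm ?subr_gt0 // ltrBlDl.
  move=> e e0; apply: filterS (Hstep s ss se (H s ss) e e0) => p; apply.
    by rewrite (ltW st) te.
  exact: tl.
- move=> /andP[s0 sl] H.
  have sl' : 0 <= s <= l by rewrite ltW.
  have [eta [c [eta0 ac Hc Hstep]]] := state_cvg_step Pp0 sl'.
  pose a := Num.max 0 (s - eta / 2).
  have as_ : a < s by rewrite gt_max s0 /=; move: eta0; slra.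
  have a0 : 0 <= a by rewrite le_max lexx.
  have ea : s - eta < a by rewrite lt_max; apply/orP; right; move: eta0; slra.
  exists c; split; first exact: ac.
    by apply: Hc; rewrite subrr normr0.
  move=> e e0.
  have aa : 0 <= a <= s by rewrite a0 ltW.
  have aas : 0 <= a < s by rewrite a0.
  apply: filterS (Hstep a aa ea (H a aas) e e0) => p; apply; last exact: sl.
  by rewrite (ltW as_) ltrDl.
Qed.

(** The estimate of [state_cvg_step] is started slightly before s0, so that it covers a two-sided
    neighbourhood of s0; it is then combined with the continuity of the reference geodesic in
    time. *)
Lemma state_joint_continuous p0 s0 c (e : R) : P p0 -> 0 <= s0 <= l -> atlas c ->
  cdom c (gam p0 s0) -> 0 < e ->
  exists2 eta, 0 < eta & \forall p \near within P (nbhs p0),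
    forall s, 0 <= s <= l -> `|s - s0| < eta ->
    cdom c (gam p s) /\ `|state c (gam p) s - state c (gam p0) s0| < e.
Proof.
move=> Pp0 sl ac cs e0.
have [eta [c' [eta0 ac' Hc' Hstep]]] := state_cvg_step Pp0 sl.
have cs' : cdom c' (gam p0 s0) by apply: Hc'; rewrite subrr normr0.
have [e' e'0 He'] := chart_state ac' ac (hgam Pp0) sl cs' cs e0.
have cont := state_continuous (hgam Pp0) sl ac' cs'.
have [eta2 /= eta20 H2] : exists2 eta2 : R, 0 < eta2 & forall s, `|s - s0| < eta2 ->
    `|state c' (gam p0) s0 - state c' (gam p0) s| < e' / 2.
  have e20 : 0 < e' / 2 by rewrite divr_gt0.
  have /nbhs_ballP[r /= r0 Hr] : \forall s \near s0,
      `|state c' (gam p0) s0 - state c' (gam p0) s| < e' / 2.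
    by move/cvgrPdist_lt : cont; exact.
  by exists r => // s hs; apply: Hr; rewrite /ball /= distrC.
pose a := Num.max 0 (s0 - eta / 2).
have s00 : 0 <= s0 by case/andP: sl.
have as_ : a <= s0 by rewrite ge_max s00 /=; move: eta0; slra.
have a0 : 0 <= a by rewrite le_max lexx.
have ea : s0 - eta < a by rewrite lt_max; apply/orP; right; move: eta0; slra.
have aa : 0 <= a <= s0 by rewrite a0.
have al : 0 <= a <= l by rewrite a0 (le_trans as_) //; case/andP: sl.
have e20 : 0 < e' / 2 by rewrite divr_gt0.
pose good p := forall s : R, a <= s < s0 + eta -> s <= l -> cdom c' (gam p s) /\
  `|state c' (gam p0) s - state c' (gam p) s| < e' / 2.
have Hn : \forall p \near within P (nbhs p0), good p :=
  Hstep a aa ea (state_cvg_all Pp0 al) (e' / 2) e20.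
have PP : \forall p \near within P (nbhs p0), P p by exact: withinT.
exists (Num.min (eta / 2) eta2); first by rewrite lt_min eta20 divr_gt0.
near=> p => s /andP[s0' sl'] hs.
have Pp : P p by near: p.
have hs1 : `|s - s0| < eta / 2 by apply: lt_le_trans hs _; rewrite ge_min lexx.
have hs2 : `|s - s0| < eta2 by apply: lt_le_trans hs _; rewrite ge_min lexx orbT.
have ssl : 0 <= s <= l by rewrite s0' sl'.
have as' : a <= s.
  rewrite ge_max s0' /=; move: hs1; rewrite ltr_norml => /andP[]; slra.
have se : s < s0 + eta by move: hs1 eta0; rewrite ltr_norml => /andP[]; slra.
have [cps hps] : cdom c' (gam p s) /\
    `|state c' (gam p0) s - state c' (gam p) s| < e' / 2.
  have : good p by near: p.
  by apply; [rewrite as' se|].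
have hd : `|state c' (gam p) s - state c' (gam p0) s0| < e'.
  move: hps (H2 s hs2).
  move: (state c' (gam p0) s) (state c' (gam p) s) (state c' (gam p0) s0) => u v w.
  have := ler_distD u v w; rewrite (distrC v u) (distrC u w); slra.
exact: (He' (gam p) s _ (hgam Pp) ssl cps hd).
Unshelve. all: by end_near. Qed.

End continuous_dependence.

(** * Non-stationary phase along rays *)

Section trigonometric_waves.
Variable R : realType.

(** Derivation and integration by parts exchange cosine and sine up to sign; with the boolean both
    are covered by one statement. *)
Definition trig (b : bool) (t : R) : R := if b then cos t else sin t.

Lemma trig_max b t : `|trig b t| <= 1.
Proof. by case: b; [exact: cos_max|exact: sin_max]. Qed.

Lemma smooth1_trig b : smooth1 setT (trig b).
Proof. by case: b; [exact: smooth1_cos|exact: smooth1_sin]. Qed.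

Lemma derive_trig_linear m (f : 'rV[R]_m -> R) b lam v y : linear f ->
  differentiable (fun y => trig b (lam * f y)) y /\
  'D_v (fun y => trig b (lam * f y)) y =
    (if b then - lam else lam) * f v * trig (~~ b) (lam * f y).
Proof.
move=> lf; have [df e] := linear_rV_diff lf y v.
have dh : differentiable (fun y => lam * f y) y by exact: differentiableZ.
have dr : is_derive (lam * f y) 1 (trig b) ((if b then -1 else 1) * trig (~~ b) (lam * f y)).
  by case: b => /=; rewrite ?mulN1r ?mul1r; [exact: is_derive_cos|exact: is_derive_sin].
have [dr1 dr2] := dr.
have dT : differentiable (trig b) (lam * f y) by exact/derivable1_diffP.
have dC := @differentiable_comp _ _ _ _ (fun y => lam * f y) (trig b) _ dh dT.
split; first exact: dC.
rewrite deriveE //; apply: etrans (_ : 'd (trig b \o (fun y => lam * f y)) y v = _); first by [].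
rewrite diff_comp //= deriv1E //= derive1E dr2 -deriveE // deriveZ; last exact: diff_derivable.
by rewrite deriveE // e /GRing.scale /=; case: b {dr dr1 dr2 dT dC} => /=; ring.
Qed.

End trigonometric_waves.

Section nonstationary_phase.
Variables (R : realType) (n : nat) (M : manifold R n.+1) (g : M -> 'M[R]_n.+1).
Hypothesis hg : lorentzian g.
Notation d := n.+1.
Variables (Th : topologicalType) (P : set Th) (gam : Th -> R -> M) (l : R).
Hypothesis l0 : 0 < l.
Hypothesis cP : compact P.
Hypothesis hgam : forall p, P p -> geodesic_on g [set s | 0 <= s <= l] (gam p).
Hypothesis init : forall p, P p -> exists c, state_cvg P gam p 0 c.
Variables (c : chart R M d) (U K : set 'rV[R]_d) (a : 'cV[R]_d).
Hypothesis ac : atlas c.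
Hypothesis oU : open U.
Hypothesis Uc : U `<=` cim c.
Hypothesis cK : compact K.
Hypothesis KU : K `<=` U.

Definition patch : set M := cdom c `&` cphi c @^-1` U.

(* The phase is x |-> x *m a; its derivative along a curve with velocity v is
   v *m a, and must not vanish. *)
Definition speed (y : 'rV[R]_(d + d)) : R := (rsubmx y *m a) 0 0.
Definition phase (y : 'rV[R]_(d + d)) : R := (lsubmx y *m a) 0 0.
(** The open set on which dividing by the speed preserves smoothness; by [moving] it contains the
    state of every ray that is over the patch. *)
Definition phase_dom : set 'rV[R]_(d + d) := [set y | U (lsubmx y) /\ speed y != 0].

Hypothesis moving : forall p s, P p -> 0 <= s <= l -> patch (gam p s) ->
  speed (state c (gam p) s) != 0.
Hypothesis endpoints : forall p, P p -> ~ patch (gam p 0) /\ ~ patch (gam p l).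

(** The support is restricted in the position only. In the velocity no decay is imposed: only the
    velocities of the given rays matter, and these are controlled by compactness of the
    parameters. *)
Definition amplitude (B : 'rV[R]_(d + d) -> R) :=
  smooth_on phase_dom B /\ forall y, ~ K (lsubmx y) -> B y = 0.

(** Off the patch the state in the chart c has no meaning and the value is set to 0; for an
    amplitude this matches, since B vanishes over the complement of K. *)
Definition along (B : 'rV[R]_(d + d) -> R) (p : Th) (s : R) : R :=
  if `[< patch (gam p s) >] then B (state c (gam p) s) else 0.

(** The geodesic vector field applied to B. *)
Definition transport (B : 'rV[R]_(d + d) -> R) (y : 'rV[R]_(d + d)) : R :=
  \sum_j spray g c y 0 j * partial j B y.

Definition wave (b : bool) (lam : R) (B : 'rV[R]_(d + d) -> R) (y : 'rV[R]_(d + d)) :=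
  B y * trig b (lam * phase y).

Lemma speed_linear (x : R) (u v : 'rV[R]_(d + d)) :
  speed (x *: u + v) = x * speed u + speed v.
Proof.
by rewrite /speed linearP mulmxDl -scalemxAl mxE [X in X + _]mxE.
Qed.

Lemma phase_linear (x : R) (u v : 'rV[R]_(d + d)) :
  phase (x *: u + v) = x * phase u + phase v.
Proof.
by rewrite /phase linearP mulmxDl -scalemxAl mxE [X in X + _]mxE.
Qed.

Lemma smooth_speed (W : set 'rV[R]_(d + d)) : open W -> smooth_on W speed.
Proof. by move=> oW; apply: smooth_on_lin => // x u v; exact: speed_linear. Qed.

Lemma smooth_phase (W : set 'rV[R]_(d + d)) : open W -> smooth_on W phase.
Proof. by move=> oW; apply: smooth_on_lin => // x u v; exact: phase_linear. Qed.

Lemma phase_dom_open : open phase_dom.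
Proof.
have -> : phase_dom = [set y | U (lsubmx y)] `&` speed @^-1` [set t | t != 0] by [].
apply: openI; first exact: lsubmx_preimage_open.
apply: open_comp => [y _|]; last exact: open_neq.
exact: (smooth_on_continuous (smooth_speed (@openT _))).
Qed.

Lemma closedK : closed K.
Proof. by apply: compact_closed => //; exact: norm_hausdorff. Qed.

Lemma patch_open : open patch.
Proof.
rewrite openE => p [cp Up]; rewrite /interior.
have h1 : nbhs p (cdom c) by apply: open_nbhs_nbhs; split => //; exact: cdom_open.
have h2 : nbhs p (cphi c @^-1` U).
  by apply: (cphi_continuous cp); exact: open_nbhs_nbhs.
by rewrite /patch; near=> q; split; near: q.
Unshelve. all: by end_near. Qed.

Lemma core_closed : closed (cpsi c @` K).
Proof.
apply: compact_closed; first exact: manifold_hausdorff.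
by apply: cpsi_image_compact => // x /KU/Uc.
Qed.

Lemma along_out B p s : amplitude B -> ~ (cpsi c @` K) (gam p s) -> along B p s = 0.
Proof.
move=> [_ B0] nK; rewrite /along; case: asboolP => // -[cs _]; apply: B0 => Ks.
apply: nK; exists (cphi c (gam p s)); last exact: cphiK.
by move: Ks; rewrite stateE row_mxKl.
Qed.

Lemma amplitude_wave b lam B : amplitude B -> amplitude (wave b lam B).
Proof.
move=> [sB B0]; have oW := phase_dom_open.
split; last by move=> y /B0 By; rewrite /wave By mul0r.
apply: smooth_onM => //.
have sp : smooth_on phase_dom (fun y => lam * phase y).
  by apply: smooth_onZ => //; exact: smooth_phase.
by case: b => /=; [apply: (smooth_on_comp1 oW (@smooth1_cos R) sp)|
  apply: (smooth_on_comp1 oW (@smooth1_sin R) sp)].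
Qed.

Lemma amplitude_transport B : amplitude B -> amplitude (transport B).
Proof.
move=> [sB B0]; have oW := phase_dom_open.
split.
  apply: smooth_on_sum => // j; apply: smooth_onM => //; last exact: smooth_on_partial.
  by apply: smooth_on_sub (smooth_spray hg ac j) => y [/Uc].
move=> y nK; rewrite /transport big1 // => j _.
have oK : open [set y : 'rV[R]_(d + d) | (~` K) (lsubmx y)].
  by apply: lsubmx_preimage_open; apply: closed_openC; exact: closedK.
have -> : partial j B y = partial j (cst 0) y.
  by apply: near_partial; apply: (open_near oK nK) => u; exact: B0.
by rewrite /partial derive_cst mulr0.
Qed.

Lemma amplitude_div B : amplitude B -> amplitude (fun y => B y * (speed y)^-1).
Proof.
move=> [sB B0]; have oW := phase_dom_open.
split; last by move=> y /B0 ->; rewrite mul0r.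
apply: smooth_onM => //.
by apply: (smooth_on_comp1 oW (@smooth1_inv R) (smooth_speed oW)) => y [].
Qed.

Lemma state_phase_dom p s : P p -> 0 <= s <= l -> patch (gam p s) ->
  phase_dom (state c (gam p) s).
Proof.
move=> Pp sl Ds; split; last exact: moving.
by rewrite stateE row_mxKl; case: Ds.
Qed.

(** Over the patch this is the chain rule, as the derivative of the state is the spray. Off the
    patch the ray avoids the closed image of K, hence does so for all nearby times, and the function
    is locally zero. *)
Lemma along_derive B p s : P p -> 0 <= s <= l -> amplitude B ->
  is_derive s 1 (along B p) (along (transport B) p s).
Proof.
move=> Pp sl aB; have [cg _] := hgam Pp sl.
have [Ds|nDs] := pselect (patch (gam p s)).
  have Dn : \forall u \near s, patch (gam p u).
    by apply: cg; apply: open_nbhs_nbhs; split => //; exact: patch_open.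
  have sd := state_derive (hgam Pp) sl ac (proj1 Ds).
  have dB : differentiable B (state c (gam p) s).
    by apply: smooth_on_diff (proj1 aB) _; exact: state_phase_dom.
  have := is_derive_comp_curve (@ex_derive _ _ _ _ _ _ _ sd) dB.
  have -> : along (transport B) p s =
      \sum_j derive1 (state c (gam p)) s 0 j * partial j B (state c (gam p) s).
    rewrite /along asboolT // /transport; apply: eq_bigr => j _.
    by rewrite derive1E; have [_ ->] := sd.
  apply: near_eq_is_derive; apply: filterS Dn => u Du.
  by rewrite /along asboolT.
have nK : ~ (cpsi c @` K) (gam p s).
  move=> [x Kx xs]; apply: nDs; rewrite -xs; have cx := Uc (KU Kx).
  by split; [exact: cdom_cpsi|rewrite /= cpsiK //; exact: KU].
have Kn : \forall u \near s, (~` (cpsi c @` K)) (gam p u).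
  by apply: cg; apply: open_nbhs_nbhs; split => //; apply: closed_openC; exact: core_closed.
rewrite (along_out (amplitude_transport aB) nK).
have Ez : \near s, (cst 0 : R -> R) s = along B p s.
  by apply: filterS Kn => u nu; rewrite along_out.
apply: (near_eq_is_derive Ez); exact: is_derive_cst.
Qed.

Lemma along_continuous B p s : P p -> 0 <= s <= l -> amplitude B ->
  {for s, continuous (along B p)}.
Proof.
move=> Pp sl aB; apply: differentiable_continuous; apply/derivable1_diffP.
by have [] := along_derive Pp sl aB.
Qed.

Lemma along_within B p : P p -> amplitude B -> {within `[0, l], continuous (along B p)}.
Proof.
move=> Pp aB; apply: continuous_in_subspaceT => s; rewrite inE /= in_itv /= => sl.
exact: along_continuous.
Qed.

Lemma along_joint B p0 s0 (e : R) : P p0 -> 0 <= s0 <= l -> amplitude B -> 0 < e ->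
  exists2 eta, 0 < eta & \forall p \near within P (nbhs p0),
    forall s, 0 <= s <= l -> `|s - s0| < eta ->
    `|along B p s - along B p0 s0| < e.
Proof.
move=> Pp0 sl aB e0.
have [Ds|nDs] := pselect (patch (gam p0 s0)).
  have pd := state_phase_dom Pp0 sl Ds.
  have cB := smooth_on_continuous (proj1 aB) pd.
  have [r /= r0 Hr] : exists2 r : R, 0 < r & forall y, `|y - state c (gam p0) s0| < r ->
      phase_dom y /\ `|B y - B (state c (gam p0) s0)| < e.
    have : \forall y \near state c (gam p0) s0, phase_dom y /\
        `|B (state c (gam p0) s0) - B y| < e.
      near=> y; split; near: y.
        by apply: open_nbhs_nbhs; split => //; exact: phase_dom_open.
      by move/cvgrPdist_lt : cB; exact.
    move=> /nbhs_ballP[r /= r0 Hr]; exists r; first exact: r0.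
    move=> y yr; rewrite [in X in _ /\ X]distrC; apply: Hr.
    by rewrite -ball_normE /= distrC.
  have [eta eta0 Heta] := state_joint_continuous hg (ltW l0) hgam init Pp0 sl ac (proj1 Ds) r0.
  exists eta; first exact: eta0.
  apply: filterS Heta => p Hp s sl' hs.
  have [cs hd] := Hp s sl' hs.
  have [[Us _] hB] := Hr _ hd.
  rewrite /along asboolT; last by split; [exact: cs|move: Us; rewrite stateE row_mxKl].
  by rewrite asboolT.
have nK : ~ (cpsi c @` K) (gam p0 s0).
  move=> [x Kx xs]; apply: nDs; rewrite -xs; have cx := Uc (KU Kx).
  by split; [exact: cdom_cpsi|rewrite /= cpsiK //; exact: KU].
pose c' := chart_at (gam p0 s0).
have cd' : cdom c' (gam p0 s0) by exact: chart_at_dom.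
have ac' : atlas c' by exact: chart_at_atlas.
have [r /= r0 Hr] : exists2 r : R, 0 < r & forall x, `|x - cphi c' (gam p0 s0)| < r ->
    ~ (cpsi c @` K) (cpsi c' x).
  have : \forall x \near cphi c' (gam p0 s0), (~` (cpsi c @` K)) (cpsi c' x).
    apply: (cpsi_continuous (cim_cphi cd')); apply: open_nbhs_nbhs; split.
      by apply: closed_openC; exact: core_closed.
    by rewrite cphiK.
  move=> /nbhs_ballP[r /= r0 Hr]; exists r; first exact: r0.
  by move=> x xr; apply: Hr; rewrite -ball_normE /= distrC.
have [eta eta0 Heta] := state_joint_continuous hg (ltW l0) hgam init Pp0 sl ac' cd' r0.
exists eta; first exact: eta0.
apply: filterS Heta => p Hp s sl' hs.
have [cs hd] := Hp s sl' hs.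
rewrite (along_out aB nK) along_out ?subrr ?normr0 //.
have : `|cphi c' (gam p s) - cphi c' (gam p0 s0)| < r.
  apply/rV_norm_lt => // i; have := rV_norm_coord (state c' (gam p) s -
    state c' (gam p0) s0) (lshift _ i).
  rewrite !stateE mxE [X in _ + X]mxE !row_mxEl mxE [X in `|_ + X| < _]mxE => /le_lt_trans; apply.
  by rewrite -!stateE.
by move=> /Hr; rewrite cphiK.
Unshelve. all: by end_near. Qed.

(* Compactness of the parameter interval makes the convergence uniform in s. *)
Lemma along_uniform B p0 (e : R) : P p0 -> amplitude B -> 0 < e ->
  \forall p \near within P (nbhs p0), forall s, 0 <= s <= l ->
    `|along B p s - along B p0 s| < e.
Proof.
move=> Pp0 aB e0.
have cI : compact `[0, l] by exact: segment_compact.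
have /compact_near_coveringP nc := cI.
have H := nc Th (within P (nbhs p0)) (fun p s => 0 <= s <= l ->
  `|along B p s - along B p0 s| < e) _.
have : \forall p \near within P (nbhs p0), `[0, l] `<=` (fun s => 0 <= s <= l ->
    `|along B p s - along B p0 s| < e).
  apply: H => s0; rewrite /= in_itv /= => sl.
  have e20 : 0 < e / 2 by rewrite divr_gt0.
  have [eta eta0 Heta] := along_joint Pp0 sl aB e20.
  exists (ball s0 eta, [set p | forall s, 0 <= s <= l -> `|s - s0| < eta ->
    `|along B p s - along B p0 s0| < e / 2]).
    by split; [exact: nbhsx_ballx|exact: Heta].
  move=> [s p] /= [hs hp] sl'.
  have hs' : `|s - s0| < eta by move: hs; rewrite /ball /= distrC.
  have h1 := hp s sl' hs'.
  have Hp0 : forall s, 0 <= s <= l -> `|s - s0| < eta ->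
      `|along B p0 s - along B p0 s0| < e / 2.
    have := nbhs_singleton Heta; apply; exact: Pp0.
  have h2 := Hp0 s sl' hs'.
  move: h1 h2; move: (along B p s) (along B p0 s0) (along B p0 s) => u v w.
  have := ler_distD v u w; rewrite (distrC v); lra.
by apply: filterS => p Hp s sl; apply: Hp => //; rewrite /= in_itv.
Qed.

(** Near each parameter the bound is the maximum over [0, l] on the reference ray plus 1;
    compactness of P, in its near-covering form with the filter of large constants, yields a single
    constant. *)
Lemma along_bounded B : amplitude B ->
  exists2 C, 0 <= C & forall p s, P p -> 0 <= s <= l -> `|along B p s| <= C.
Proof.
move=> aB.
have /compact_near_coveringP nc := cP.
have : \forall C \near +oo, P `<=` (fun p => P p ->
    forall s, 0 <= s <= l -> `|along B p s| <= C).
  apply: nc => p0 Pp0.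
  have cn : {within `[0, l], continuous (fun s => `|along B p0 s|)}.
    apply: continuous_in_subspaceT => s; rewrite inE /= in_itv /= => sl.
    apply: (@continuous_comp _ _ _ (along B p0) Num.norm); last exact: norm_continuous.
    exact: along_continuous.
  have [s1 _ Hs1] := EVT_max (ltW l0) cn.
  exists ([set p | P p -> forall s, 0 <= s <= l -> `|along B p s - along B p0 s| < 1],
     [set C : R | `|along B p0 s1| + 1 <= C]).
    by split; [exact: (along_uniform Pp0 aB ltr01)|exact: nbhs_pinfty_ge].
  move=> [p C] /= [hp hC] Pp s sl.
  have h1 := hp Pp s sl.
  have h2 : `|along B p0 s| <= `|along B p0 s1| by apply: Hs1; rewrite in_itv.
  move: h1 h2 hC; move: (along B p s) (along B p0 s) (along B p0 s1) => u v w.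
  have := ler_normD (u - v) v; rewrite subrK; lra.
have C00 : \forall C \near +oo, (0 : R) <= C by exact: nbhs_pinfty_ge.
move=> HH; have [C [C0 HC]] := filter_ex (filterI C00 HH).
by exists C => // p s Pp; exact: HC.
Qed.

Lemma along_integrable B p : P p -> amplitude B ->
  (@lebesgue_measure R).-integrable `[0, l] (EFin \o along B p).
Proof.
move=> Pp aB; apply: continuous_compact_integrable; first exact: segment_compact.
exact: along_within.
Qed.

Definition ray_integral B p := \int[@lebesgue_measure R]_(s in `[0, l]) along B p s.

Lemma ray_integral_le B p C : P p -> amplitude B ->
  (forall s, 0 <= s <= l -> `|along B p s| <= C) -> `|ray_integral B p| <= C * l.
Proof.
move=> Pp aB HC; have mI : measurable (`[0, l]%classic : set (measurableTypeR R)) by [].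
apply: le_trans (le_normr_Rintegral mI (along_integrable Pp aB)) _.
apply: le_trans (_ : \int[@lebesgue_measure R]_(s in `[0, l]) cst C s <= _).
  apply: le_Rintegral => //.
  - exact: (integrable_norm (along_integrable Pp aB)).
  - apply: continuous_compact_integrable; first exact: segment_compact.
    by apply: continuous_subspaceT => ?; exact: cvg_cst.
by rewrite Rintegral_cst //= lebesgue_measure_itv /= lte_fin l0 oppr0 addr0.
Qed.

Lemma ray_integralB B p q : P p -> P q -> amplitude B ->
  `|ray_integral B p - ray_integral B q| <=
    \int[@lebesgue_measure R]_(s in `[0, l]) `|along B p s - along B q s|.
Proof.
move=> Pp Pq aB; have mI : measurable (`[0, l]%classic : set (measurableTypeR R)) by [].
have i1 := along_integrable Pp aB; have i2 := along_integrable Pq aB.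
rewrite /ray_integral -RintegralB //; apply: le_normr_Rintegral => //.
exact: (integrableB mI i1 i2).
Qed.

(** Needed for the measurability of the transform over the parameter space. *)
Lemma ray_integral_continuous B p0 (e : R) : P p0 -> amplitude B -> 0 < e ->
  \forall p \near within P (nbhs p0), `|ray_integral B p - ray_integral B p0| < e.
Proof.
move=> Pp0 aB e0; have mI : measurable (`[0, l]%classic : set (measurableTypeR R)) by [].
have d0 : 0 < e / (l + 1) by rewrite divr_gt0 // addr_gt0.
have PP : \forall p \near within P (nbhs p0), P p by exact: withinT.
have := along_uniform Pp0 aB d0; apply: filterS2 PP => p Pp Hp.
apply: le_lt_trans (ray_integralB Pp Pp0 aB) _.
have i1 := along_integrable Pp aB; have i2 := along_integrable Pp0 aB.
apply: le_lt_trans (_ : \int[@lebesgue_measure R]_(s in `[0, l]) cst (e / (l + 1)) s < _).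
  apply: le_Rintegral => //.
  - exact: (integrable_norm (integrableB mI i1 i2)).
  - apply: continuous_compact_integrable; first exact: segment_compact.
    by apply: continuous_subspaceT => ?; exact: cvg_cst.
  - by move=> s; rewrite /= in_itv /= => sl; apply/ltW/Hp.
rewrite Rintegral_cst //= lebesgue_measure_itv /= lte_fin l0 oppr0 addr0.
by rewrite /= mulrAC ltr_pdivrMr ?addr_gt0 // ltr_pM2l // ltrDl.
Qed.

Lemma ray_integral_transport B p : P p -> amplitude B ->
  ray_integral (transport B) p = 0.
Proof.
move=> Pp aB; have aX := amplitude_transport aB.
have zl : (0 : R) <= 0 <= l by rewrite lexx ltW.
have ll : (0 : R) <= l <= l by rewrite lexx ltW.
have [e0 el] := endpoints Pp.
rewrite /ray_integral /Rintegral (@continuous_FTC2 R _ (along B p) 0 l l0).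
- by rewrite /along !asboolF // subee.
- exact: along_within.
- split.
  + move=> s; rewrite in_itv /= => /andP[s0 sl].
    by have [] := along_derive Pp (introT andP (conj (ltW s0) (ltW sl))) aB.
  + exact/cvg_at_right_filter/(along_continuous Pp zl aB).
  + exact/cvg_at_left_filter/(along_continuous Pp ll aB).
- move=> s; rewrite in_itv /= => /andP[s0 sl].
  by have [_ <-] := along_derive Pp (introT andP (conj (ltW s0) (ltW sl))) aB; rewrite derive1E.
Qed.

Lemma transportE B y : differentiable B y -> transport B y = 'D_(spray g c y) B y.
Proof. by move=> dB; rewrite deriveE // diff_partial. Qed.

Lemma phase_spray y : phase (spray g c y) = speed y.
Proof. by rewrite /phase /speed /spray row_mxKl. Qed.

(** Product rule for the geodesic vector field. The position component of the spray is the velocity,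
    so the phase is differentiated into the speed, which cancels the division in the amplitude. *)
Lemma along_transport_wave B p s b lam : P p -> 0 <= s <= l -> amplitude B ->
  along (transport (wave b lam (fun y => B y * (speed y)^-1))) p s =
  along (wave b lam (transport (fun y => B y * (speed y)^-1))) p s +
  (if b then - lam else lam) * along (wave (~~ b) lam B) p s.
Proof.
move=> Pp sl aB; rewrite /along; case: asboolP => [Ds|_]; last by rewrite mulr0 addr0.
have [Us sp0] := state_phase_dom Pp sl Ds.
move: (state c (gam p) s) Us sp0 => y Us sp0.
have aD := amplitude_div aB.
have yd : phase_dom y by split.
have dD := smooth_on_diff (proj1 aD) yd.
have dW := smooth_on_diff (proj1 (amplitude_wave b lam aD)) yd.
have [dT DT] := derive_trig_linear b lam (spray g c y) y phase_linear.
have dT' := @diff_derivable _ _ _ _ _ (spray g c y) dT.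
rewrite transportE // /wave (@deriveM _ _ (fun y => B y / speed y)) //; last exact: diff_derivable.
rewrite DT phase_spray transportE // /GRing.scale /=.
by rewrite addrC; congr (_ + _); [rewrite mulrC|field].
Qed.

(* Integration by parts along the ray: B trig(lam phase) = (B / speed) d/ds of
   the other trigonometric function divided by lam, up to sign. *)
Lemma ray_integral_decay k B : amplitude B -> exists2 C, 0 <= C &
  forall p b lam, P p -> 1 <= lam -> `|ray_integral (wave b lam B) p| <= C / lam ^+ k.
Proof.
elim: k B => [|k IH] B aB.
  have [C C0 HC] := along_bounded aB.
  exists (C * l); first by rewrite mulr_ge0 // ltW.
  move=> p b lam Pp lam1; rewrite expr0 divr1.
  apply: ray_integral_le => //; first exact: amplitude_wave.
  move=> s sl; apply: le_trans (HC p s Pp sl).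
  rewrite /along; case: asboolP => // _; rewrite /wave normrM ler_piMr //.
  exact: trig_max.
have aD := amplitude_div aB.
(* The induction is over all amplitudes: the new one is [transport] (B / [speed]), its constant is
   kept unchanged, and the factor lam of the second term supplies the additional power. *)
have [C C0 HC] := IH _ (amplitude_transport aD).
exists C => // p b lam Pp lam1.
have lam0 : 0 < lam by exact: lt_le_trans lam1.
(* The total derivative is taken of the wave with the other trigonometric function, so that
   differentiating it returns [trig b]. *)
have aW := amplitude_wave (~~ b) lam aD.
have := ray_integral_transport Pp aW.
have mI : measurable (`[0, l]%classic : set (measurableTypeR R)) by [].
have aT := amplitude_wave (~~ b) lam (amplitude_transport aD).
have aB' := amplitude_wave b lam aB.
have i1 := along_integrable Pp aT; have i2 := along_integrable Pp aB'.
have -> : ray_integral (transport (wave (~~ b) lam (fun y => B y * (speed y)^-1))) p =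
    \int[@lebesgue_measure R]_(s in `[0, l])
      (along (wave (~~ b) lam (transport (fun y => B y * (speed y)^-1))) p s +
       (if ~~ b then - lam else lam) * along (wave b lam B) p s).
  apply: eq_Rintegral => s; rewrite inE /= in_itv /= => sl.
  by rewrite along_transport_wave // negbK.
rewrite RintegralD //; last exact: (integrableZl mI _ i2).
rewrite RintegralZl // -!/(ray_integral _ _) => e.
have := HC p (~~ b) lam Pp lam1.
have -> : ray_integral (wave (~~ b) lam (transport (fun y => B y / speed y))) p =
    - ((if ~~ b then - lam else lam) * ray_integral (wave b lam B) p).
  by apply/eqP; rewrite -addr_eq0; apply/eqP.
rewrite normrN normrM exprS invfM mulrCA => h.
rewrite [leRHS]mulrC ler_pdivlMr // mulrC.
by move: h; case: (~~ b); rewrite ?normrN (gtr0_norm lam0).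
Qed.

End nonstationary_phase.

(** * Lebesgue measure on boxes *)

Section lebesgue_rV.
Variable R : realType.

Lemma continuous_borel_measurable (T : ptopologicalType) (f : T -> R) :
  continuous f -> measurable_fun setT (f : borel T -> measurableTypeR R).
Proof.
move=> cf.
refine (@measurability _ _ _ _ setT (f : borel T -> measurableTypeR R) _ (RGenOpens.measurableE R) _).
move=> _ [V [a [b ->]] <-]; rewrite setTI; apply: (@borel_open _ (f @^-1` _)).
by apply: open_comp => [x _|]; [exact: cf|exact: interval_open].
Qed.

Lemma borel_closed (T : ptopologicalType) (C : set T) :
  closed C -> measurable (C : set (borel T)).
Proof.
move=> cC; rewrite -(setCK C); apply: (@measurableC _ (borel T)).
exact: (borel_open (closed_openC cC)).
Qed.

Lemma box_measurable m (x0 : 'rV[R]_m) rho : measurable (box x0 rho : set (borel 'rV[R]_m)).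
Proof. by apply: borel_closed; exact: box_closed. Qed.

Lemma vcons_shiftr m (t u : R) (z : 'rV[R]_m) (j : 'I_m) :
  vcons (t, u *: (delta_mx 0 j : 'rV[R]_m) + z) =
  u *: (delta_mx 0 (rshift 1 j) : 'rV[R]_m.+1) + (vcons (t, z) : 'rV[R]_m.+1)
    :> 'rV[R]_m.+1.
Proof.
apply/rowP; apply: vec_ord => [|i].
  by rewrite [RHS]mxE [X in _ = X + _]mxE [X in _ = _ * X + _]mxE !vcons0 /= mulr0 add0r.
rewrite [RHS]mxE [X in _ = X + _]mxE [X in _ = _ * X + _]mxE !vconsS /= !mxE.
by rewrite (inj_eq (@rshift_inj 1 m)).
Qed.

Lemma box_vcons m (x0 : 'rV[R]_m.+1) rho :
  @vcons R m @^-1` (box x0 rho) =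
  (`[x0 0 0 - rho, x0 0 0 + rho]%classic : set (measurableTypeR R)) `*`
  (box (rsubmx (x0 : 'rV[R]_(1 + m))) rho : set (borel 'rV[R]_m)).
Proof.
apply/seteqP; split=> -[t z] /=.
  move=> H; split; first by have := H 0; rewrite vcons0 /= in_itv /= ler_distl.
  by move=> j; have := H (rshift 1 j); rewrite vconsS /= !mxE.
rewrite in_itv /= -ler_distl => -[h1 h2]; apply: vec_ord => [|j].
  by rewrite vcons0.
by rewrite vconsS /=; have := h2 j; rewrite mxE.
Qed.

Lemma leb_box m (x0 : 'rV[R]_m) rho : 0 <= rho ->
  leb R m (box x0 rho) = ((2 * rho) ^+ m)%:E.
Proof.
move=> r0; elim: m x0 => [|m IH] x0.
  by rewrite expr0 /= /leb0 diracE mem_set // => -[].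
rewrite /= /lebS /pushforward box_vcons product_measure1E //; last exact: box_measurable.
have E : lebesgue_measure (`[x0 0 0 - rho, x0 0 0 + rho]%classic : set R) = (2 * rho)%:E.
  rewrite lebesgue_measure_itv /= lte_fin; case: ltP => h.
    by rewrite -EFinB; congr (_%:E); ring.
  by have -> : rho = 0 by [lra]; rewrite mulr0.
by rewrite [X in (_ * X)%E]IH [X in (X * _)%E]E exprS EFinM.
Qed.

Lemma leb_box_lty m (x0 : 'rV[R]_m) rho : (leb R m (box x0 rho) < +oo)%E.
Proof.
have [r0|r0] := leP 0 rho; first by rewrite leb_box // ltry.
apply: le_lt_trans (_ : leb R m (box x0 0) < +oo)%E; last by rewrite leb_box // ltry.
apply: le_measure; rewrite ?inE; [exact: box_measurable|exact: box_measurable|].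
by move=> x bx i; apply: le_trans (bx i) (ltW r0).
Qed.

Lemma bounded_box_integrable m (f : 'rV[R]_m -> R) (x0 : 'rV[R]_m) rho C :
  measurable_fun setT (f : borel 'rV[R]_m -> measurableTypeR R) ->
  (forall x, `|f x| <= C) -> (forall x, ~ box x0 rho x -> f x = 0) ->
  (leb R m).-integrable setT (EFin \o (f : borel 'rV[R]_m -> R)).
Proof.
move=> mf fC f0; have mB := box_measurable x0 rho.
have -> : EFin \o (f : borel 'rV[R]_m -> R) = (EFin \o f) \_ (box x0 rho).
  apply/funext => x; rewrite patchE; case: ifPn => //= /negP; rewrite inE => nb.
  by rewrite f0.
apply/(@integrable_mkcond _ _ _ _ _ _ mB).
apply: measurable_bounded_integrable => //; first exact: leb_box_lty.
  exact: measurable_funS mf.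
exists C; split; first exact: num_real.
by move=> M CM x _ /=; apply: le_trans (ltW CM).
Qed.

Lemma continuous_box_bounded m (f : 'rV[R]_m -> R) (x0 : 'rV[R]_m) rho :
  continuous f -> (forall x, ~ box x0 rho x -> f x = 0) ->
  exists2 C, 0 <= C & forall x, `|f x| <= C.
Proof.
move=> cf f0.
have cn : {within box x0 rho, continuous (fun x => `|f x|)}.
  apply: continuous_subspaceT => x; apply: (@continuous_comp _ _ _ f Num.norm).
    exact: cf.
  exact: norm_continuous.
have [[x1 bx1]|nb] := pselect (box x0 rho !=set0); last first.
  by exists 0 => // x; rewrite f0 ?normr0 // => bx; apply: nb; exists x.
have [x2 _ H] := EVT_max_rV (ex_intro _ x1 bx1) (@box_compact _ _ x0 rho) cn.
exists `|f x2| => // x; have [bx|nbx] := pselect (box x0 rho x).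
  by apply: H; rewrite inE.
by rewrite f0 // normr0.
Qed.

Lemma smooth_box_integrable m (f : 'rV[R]_m -> R) (x0 : 'rV[R]_m) rho :
  smooth_on setT f -> (forall x, ~ box x0 rho x -> f x = 0) ->
  (leb R m).-integrable setT (EFin \o (f : borel 'rV[R]_m -> R)).
Proof.
move=> sf f0; have cf : continuous f by move=> x; exact: smooth_on_continuous sf _.
have [C _ HC] := continuous_box_bounded cf f0.
by apply: (bounded_box_integrable _ HC f0); exact: continuous_borel_measurable.
Qed.

Lemma partial_outside m (f : 'rV[R]_m -> R) (K : set 'rV[R]_m) i : closed K ->
  (forall x, ~ K x -> f x = 0) -> forall x, ~ K x -> partial i f x = 0.
Proof.
move=> cK f0 x nK; have oK : open (~` K) by exact: closed_openC.
have -> : partial i f x = partial i (cst 0) x.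
  by apply: near_partial; apply: (open_near oK nK) => y /f0.
by rewrite /partial derive_cst.
Qed.

Lemma derive_comp_affine m k (f : 'rV[R]_k -> R) (h : 'rV[R]_m -> 'rV[R]_k)
    (v : 'rV[R]_m) (w : 'rV[R]_k) x :
  (forall t : R, h (t *: v + x) = t *: w + h x) ->
  'D_v (fun y => f (h y)) x = 'D_w f (h x).
Proof.
move=> H; rewrite /derive; congr (lim (_ @ 0^')).
by apply/funext => t /=; rewrite H.
Qed.

(** Fubini with the first coordinate split off. For i = 0 the inner integral is given by the
    fundamental theorem on [-A - 1, A + 1], whose ends lie outside the closed support; for the other
    directions the induction hypothesis is applied to each slice. *)
Lemma integral_partial m (f : 'rV[R]_m -> R) (A : R) i : 0 < A ->
  smooth_on setT f -> (forall x, ~ box 0 A x -> f x = 0) ->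
  (\int[leb R m]_x (partial i f x)%:E = 0)%E.
Proof.
move=> A0; elim: m f i => [|m IH] f i sf f0; first by case: i.
have sp : smooth_on setT (partial i f) by exact: smooth_on_partial.
have p0 : forall x, ~ box 0 A x -> partial i f x = 0.
  by apply: partial_outside => //; exact: box_closed.
have ip := smooth_box_integrable sp p0.
have mp : measurable_fun setT (EFin \o (partial i f : borel 'rV[R]_m.+1 -> R)).
  exact: measurable_int ip.
pose V := @vcons R m.
have iV : (@lebesgue_measure R \x leb R m)%E.-integrable setT
    ((EFin \o (partial i f : borel 'rV[R]_m.+1 -> R)) \o V).
  apply/integrableP; split; first by apply: measurableT_comp => //; exact: measurable_vcons.
  have /integrableP[_] := ip; rewrite /= /lebS ge0_integral_pushforward //.
  + exact: measurable_vcons.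
  + by have /integrableP[+ _] := integrable_abse ip.
rewrite /= /lebS (integral_pushforward (@measurable_vcons R m) mp) // preimage_setT.
have zero_out t z : A < `|t| -> f (V (t, z)) = 0.
  move=> At; apply: f0 => /(_ 0); rewrite vcons0 mxE subr0 /=; lra.
move: i sp p0 ip mp iV; apply: vec_ord => [|j] sp p0 ip mp iV.
  rewrite -(integral21_prod_meas1 iV).
  rewrite (eq_integral (fun=> 0%E)) ?integral0 // => z _.
  rewrite /fubini_G /=.
  pose h (t : R) := f (V (t, z)).
  have dy (t : R) : is_derive t 1 (fun t => V (t, z) : 'rV[R]_m.+1) (delta_mx 0 0).
    apply: is_derive_rV; apply: vec_ord => [|j].
      under eq_fun do rewrite vcons0; rewrite mxE /=; exact: is_derive_id.
    under eq_fun do rewrite vconsS; rewrite mxE /=; exact: is_derive_cst.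
  have dh (t : R) : is_derive t 1 h (partial 0 f (V (t, z))).
    have := is_derive_comp_curve (@ex_derive _ _ _ _ _ _ _ (dy t))
      (smooth_on_diff sf (I : setT (V (t, z)))).
    apply: is_derive1_eq; rewrite derive1E; have [_ ->] := dy t.
    rewrite (bigD1 ord0) //= big1 ?addr0 => [|i i0]; first by rewrite mxE mul1r.
    by rewrite mxE /= (negbTE i0) mul0r.
  have -> : (\int[@lebesgue_measure R]_x (partial 0 f (V (x, z)))%:E)%E =
      (\int[@lebesgue_measure R]_(x in `[(- A - 1)%R, (A + 1)%R]) (partial 0 f (V (x, z)))%:E)%E.
    rewrite [RHS]integral_mkcond; apply: eq_integral => t _.
    rewrite patchE; case: ifPn => // /negP; rewrite inE /= in_itv /= => nt.
    rewrite p0 // => /(_ 0); rewrite vcons0 mxE subr0 /= ler_norml.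
    by move=> /andP[h1 h2]; apply: nt; apply/andP; split; lra.
  have AA : - A - 1 < A + 1 by lra.
  rewrite (@continuous_FTC2 R _ h (- A - 1) (A + 1) AA).
  - have A1 : A < `|A + 1| by rewrite ltr_normr; apply/orP; left; lra.
    have A2 : A < `|- A - 1| by rewrite ltr_normr; apply/orP; right; lra.
    by rewrite /h (zero_out _ _ A1) (zero_out _ _ A2) subee.
  - apply: continuous_subspaceT => t.
    have ct : {for t, continuous (fun t => V (t, z) : 'rV[R]_m.+1)}.
      by apply: differentiable_continuous; apply/derivable1_diffP; have [] := dy t.
    exact: (continuous_comp ct (smooth_on_continuous sp I)).
  - have ch t : {for t, continuous h}.
      by apply: differentiable_continuous; apply/derivable1_diffP; have [] := dh t.
    split; first by move=> t _; have [] := dh t.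
      exact/cvg_at_right_filter/ch.
    exact/cvg_at_left_filter/ch.
  - by move=> t _; rewrite derive1E; have [_ ->] := dh t.
rewrite -(integral12_prod_meas1 iV).
rewrite (eq_integral (fun=> 0%E)) ?integral0 // => t _.
rewrite /fubini_F /=.
pose h (z : 'rV[R]_m) := f (V (t, z)).
have sh : smooth_on setT h.
  apply: (@smooth_on_comp _ _ _ _ _ setT f (fun z : 'rV[R]_m => V (t, z))) => //; first exact: openT.
  apply: vec_ord => [|i].
    under eq_fun do rewrite vcons0; apply: smooth_on_cst; exact: openT.
  under eq_fun do rewrite vconsS; apply: smooth_on_coord; exact: openT.
rewrite -[RHS](IH h j sh); last first.
  move=> z nz; apply: f0 => bz; apply: nz => i.
  by have := bz (rshift 1 i); rewrite vconsS !mxE.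
apply: eq_integral => z _; congr (_%:E); apply/esym.
apply: (@derive_comp_affine _ _ f (fun z : 'rV[R]_m => V (t, z))) => u.
exact: vcons_shiftr.
Qed.

End lebesgue_rV.

(** * Square integrable functions *)

Section square_integrable.
Context d (T : measurableType d) (R : realType).
Variable mu : {measure set T -> \bar R}.
Implicit Types f h u : T -> R.

Definition sqint f := measurable_fun setT f /\
  mu.-integrable setT (EFin \o (fun x => f x * f x)).

Lemma integrable_mul f h : sqint f -> sqint h ->
  mu.-integrable setT (EFin \o (fun x => f x * h x)).
Proof.
move=> [mf jf] [mh jh]; apply: (le_integrable measurableT _ _ (integrableD measurableT jf jh)).
  exact/measurable_EFinP/measurable_funM.
move=> x _ /=; rewrite lee_fin (ger0_norm (_ : 0 <= f x * f x + h x * h x)); last nra.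
by rewrite ler_norml; apply/andP; split; nra.
Qed.

Lemma sqintD f h : sqint f -> sqint h -> sqint (fun x => f x + h x).
Proof.
move=> sf sh; have [[mf jf] [mh jh]] := (sf, sh); have jfh := integrable_mul sf sh.
split; first exact: measurable_funD.
have -> : EFin \o (fun x => (f x + h x) * (f x + h x)) =
    (EFin \o (fun x => f x * f x)) \+ (fun x => 2%:E * (f x * h x)%:E)%E
     \+ (EFin \o (fun x => h x * h x)).
  by apply/funext => x /=; rewrite -EFinM -!EFinD; congr (_%:E); ring.
by apply: integrableD => //; apply: integrableD => //; exact: (integrableZl measurableT 2 jfh).
Qed.

Lemma sqintZ (a : R) f : sqint f -> sqint (fun x => a * f x).
Proof.
move=> [mf jf]; split; first exact: measurable_funM.
have -> : EFin \o (fun x => a * f x * (a * f x)) =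
    (fun x => (a * a)%:E * (f x * f x)%:E)%E.
  by apply/funext => x /=; rewrite -EFinM; congr (_%:E); ring.
exact: (integrableZl measurableT (a * a) jf).
Qed.

Lemma sqint0 : sqint (fun=> 0).
Proof.
split; first exact: measurable_cst.
by have -> : EFin \o (fun=> 0 * 0 : R) = cst 0%E :> (T -> \bar R);
  [apply/funext => x /=; rewrite mul0r|exact: integrable0].
Qed.

Lemma sqintB f h : sqint f -> sqint h -> sqint (fun x => f x - h x).
Proof.
move=> sf sh; have := sqintD sf (sqintZ (-1) sh).
by under [in X in X -> _]eq_fun do rewrite mulN1r.
Qed.

Lemma sqint_sum (I : Type) (r : seq I) (c : I -> R) (e : I -> T -> R) :
  (forall i, sqint (e i)) -> sqint (fun x => \sum_(i <- r) c i * e i x).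
Proof.
move=> se; elim: r => [|i r IH]; first by under eq_fun do rewrite big_nil; exact: sqint0.
by under eq_fun do rewrite big_cons; apply: sqintD => //; exact: sqintZ.
Qed.

Notation dot := (L2dot mu).

Lemma dotC f h : dot f h = dot h f.
Proof. by rewrite /L2dot; apply: eq_Rintegral => x _; rewrite mulrC. Qed.

Lemma dotDl f h u : sqint f -> sqint h -> sqint u ->
  dot (fun x => f x + h x) u = dot f u + dot h u.
Proof.
move=> sf sh su; rewrite /L2dot -RintegralD //; [|exact: integrable_mul|exact: integrable_mul].
by apply: eq_Rintegral => x _; rewrite mulrDl.
Qed.

Lemma dotZl (a : R) f u : sqint f -> sqint u -> dot (fun x => a * f x) u = a * dot f u.
Proof.
move=> sf su; rewrite /L2dot -RintegralZl //; last exact: integrable_mul.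
by apply: eq_Rintegral => x _; rewrite mulrA.
Qed.

Lemma dotBl f h u : sqint f -> sqint h -> sqint u ->
  dot (fun x => f x - h x) u = dot f u - dot h u.
Proof.
move=> sf sh su; have := dotDl sf (sqintZ (-1) sh) su.
by under [in X in X -> _]eq_fun do rewrite mulN1r; rewrite dotZl // mulN1r.
Qed.

Lemma dot0l u : dot (fun=> 0) u = 0.
Proof.
by rewrite /L2dot /Rintegral; under eq_integral do rewrite mul0r; rewrite integral0.
Qed.

Lemma dot_suml (I : Type) (r : seq I) (c : I -> R) (e : I -> T -> R) u :
  (forall i, sqint (e i)) -> sqint u ->
  dot (fun x => \sum_(i <- r) c i * e i x) u = \sum_(i <- r) c i * dot (e i) u.
Proof.
move=> se su; elim: r => [|i r IH].
  by under [X in dot X _]eq_fun do rewrite big_nil; rewrite dot0l big_nil.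
under [X in dot X _]eq_fun do rewrite big_cons; rewrite big_cons -IH -dotZl //.
by apply: dotDl => //; [exact: sqintZ|exact: sqint_sum].
Qed.

Lemma dot_ge0 f : 0 <= dot f f.
Proof. by apply: Rintegral_ge0 => x _; rewrite -expr2 sqr_ge0. Qed.

Lemma integral_sq f : sqint f -> (\int[mu]_x (f x * f x)%:E = (dot f f)%:E)%E.
Proof.
move=> [_ jf]; rewrite /L2dot /Rintegral fineK //.
exact: (integrable_fin_num measurableT jf).
Qed.

(** A weighted form of the Cauchy-Schwarz inequality, from the nonnegative square norm of t f + h
    and of t f - h. The weight is left free to balance factors of different size. *)
Lemma dot_AMGM f h (t : R) : 0 < t -> sqint f -> sqint h ->
  `|dot f h| <= (t * dot f f + t^-1 * dot h h) / 2.
Proof.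
move=> t0 sf sh.
have key (a : R) : a * a = 1 -> 0 <= t * dot f f + t^-1 * dot h h + 2 * a * dot f h.
  move=> a1; have sv : sqint (fun x => t * f x + a * h x).
    by apply: sqintD; exact: sqintZ.
  have := dot_ge0 (fun x => t * f x + a * h x).
  have e : dot (fun x => t * f x + a * h x) (fun x => t * f x + a * h x) =
      t * (t * dot f f) + 2 * a * (t * dot f h) + a * a * dot h h.
    rewrite dotDl ?dotZl //; [|exact: sqintZ|exact: sqintZ].
    rewrite (dotC f) (dotC h) !dotDl ?dotZl //; try exact: sqintZ.
    by rewrite (dotC h f); ring.
  rewrite e a1 mul1r => h0.
  rewrite -(pmulr_rge0 _ t0); apply: le_trans h0 _; rewrite le_eqVlt; apply/orP; left.
  by apply/eqP; field; rewrite gt_eqF.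
have k1 := key 1 (mulr1 1); have k2 := key (-1) (etrans (mulrNN 1 1) (mulr1 1)).
by move: k1 k2; rewrite ler_norml => k1 k2; apply/andP; split; lra.
Qed.

Lemma Lnorm2E f : (Lnorm mu 2%:E (EFin \o (f \_ setT)) =
    (\int[mu]_x (f x * f x)%:E) `^ 2^-1)%E.
Proof.
rewrite unlock /Lnorm; congr (_ `^ _)%E; apply: eq_integral => x _ /=.
by rewrite patchT ?inE // -expr2 -real_normK ?num_real // powR_mulrn.
Qed.

Lemma in_L2P f : in_L2 mu setT f <-> sqint f.
Proof.
have E := Lnorm2E f.
have p0 : (0 <= \int[mu]_x (f x * f x)%:E)%E.
  by apply: integral_ge0 => x _; rewrite lee_fin -expr2 sqr_ge0.
split=> -[mf h]; split => //.
  apply/integrableP; split; first exact/measurable_EFinP/measurable_funM.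
  under eq_integral do rewrite gee0_abs /= ?lee_fin -?expr2 ?sqr_ge0 //.
  under eq_integral do rewrite expr2.
  by apply: (@lty_poweRy _ _ 2^-1) => //; rewrite -E.
by rewrite /L2norm E integral_sq // poweR_EFin ltry.
Qed.

Lemma L2normE f : sqint f -> L2norm mu setT f = (Num.sqrt (dot f f))%:E.
Proof.
by move=> sf; rewrite /L2norm Lnorm2E integral_sq // poweR_EFin powR12_sqrt // dot_ge0.
Qed.

Section orthonormal.
Variable e : nat -> T -> R.
Hypothesis se : forall j, sqint (e j).
Hypothesis oe : forall i j, dot (e i) (e j) = (i == j)%:R.

Definition partial_sum (c : nat -> R) (J : nat) (x : T) : R :=
  \sum_(j <- iota 0 J) c j * e j x.

Lemma sqint_partial_sum c J : sqint (partial_sum c J).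
Proof. exact: sqint_sum. Qed.

Lemma dot_partial_sum c J i : dot (partial_sum c J) (e i) = if (i < J)%N then c i else 0.
Proof.
rewrite /partial_sum dot_suml //; case: ifPn => iJ.
  rewrite (bigD1_seq i) //= ?mem_iota ?iota_uniq // oe eqxx mulr1 big1 ?addr0 // => j ji.
  by rewrite oe (negbTE ji) mulr0.
rewrite big_seq big1 // => j; rewrite mem_iota /= add0n => jJ.
by rewrite oe (_ : (j == i) = false) ?mulr0 //; apply: contraNF iJ => /eqP <-.
Qed.

Lemma dot_partial_sum_sq c I J : (I <= J)%N ->
  dot (fun x => partial_sum c J x - partial_sum c I x)
      (fun x => partial_sum c J x - partial_sum c I x) =
  \sum_(0 <= j < J) c j ^+ 2 - \sum_(0 <= j < I) c j ^+ 2.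
Proof.
move=> IJ; have sJ := sqint_partial_sum c J; have sI := sqint_partial_sum c I.
have D K u : sqint u -> dot (partial_sum c K) u = \sum_(0 <= j < K) c j * dot u (e j).
  move=> su; rewrite /partial_sum dot_suml // /index_iota subn0.
  by apply: eq_bigr => j _; rewrite dotC.
have F K j : (j < K)%N -> dot (partial_sum c K) (e j) = c j.
  by move=> jK; rewrite dot_partial_sum jK.
rewrite dotBl //; last exact: sqintB.
rewrite !D; try exact: sqintB.
have -> : \sum_(0 <= j < I) c j * dot (fun x => partial_sum c J x - partial_sum c I x) (e j) = 0.
  rewrite big_nat big1 // => j /andP[_ jI].
  by rewrite dotBl // !F ?subrr ?mulr0 // (leq_trans jI).
rewrite subr0 (big_cat_nat _ (n := I)) //= [in RHS](big_cat_nat _ (n := I)) //=.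
rewrite [X in X + _ = _]big_nat [X in X + _ = _]big1 => [|j /andP[_ jI]]; last first.
  by rewrite dotBl // !F ?subrr ?mulr0 // (leq_trans jI).
rewrite add0r addrAC subrr add0r; apply: eq_big_nat => j /andP[Ij jJ].
by rewrite dotBl // F // dot_partial_sum ltnNge Ij subr0 expr2.
Qed.

Lemma bessel_inequality u J : sqint u ->
  \sum_(0 <= j < J) dot u (e j) ^+ 2 <= dot u u.
Proof.
move=> su; pose c j := dot u (e j); have sp := sqint_partial_sum c J.
have := dot_ge0 (fun x => u x - partial_sum c J x).
have uS : dot (partial_sum c J) u = \sum_(0 <= j < J) c j ^+ 2.
  rewrite /partial_sum dot_suml // /index_iota subn0.
  by apply: eq_bigr => j _; rewrite dotC -/(c j) expr2.
have SS : dot (partial_sum c J) (partial_sum c J) = \sum_(0 <= j < J) c j ^+ 2.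
  rewrite {1}/partial_sum dot_suml // /index_iota subn0.
  rewrite !big_seq; apply: eq_bigr => j; rewrite mem_iota /= add0n => jJ.
  by rewrite dotC dot_partial_sum jJ expr2.
rewrite dotBl //; last exact: sqintB.
rewrite (dotC u) (dotC (partial_sum c J)) !dotBl // (dotC u (partial_sum c J)) uS SS.
by rewrite subrr subr0 subr_ge0.
Qed.

(** Fatou's lemma for the squares, with the lower limit identified with the pointwise limit. *)
Lemma sqint_fatou (h : nat -> T -> R) (v : T -> R) (C : R) :
  (forall k, sqint (h k)) -> (forall x, h ^~ x @ \oo --> v x) ->
  (forall k, dot (h k) (h k) <= C) -> sqint v /\ dot v v <= C.
Proof.
move=> sh hv hC.
have mv : measurable_fun setT v by apply: measurable_fun_cvg (fun x _ => hv x) => k; case: (sh k).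
have I : (\int[mu]_x (v x * v x)%:E <= C%:E)%E.
  have E x : (v x * v x)%:E = limn_einf (fun k => (h k x * h k x)%:E).
    have cv : (fun k => (h k x * h k x)%:E) @ \oo --> (v x * v x)%:E.
      by apply: cvg_EFin; [exact: nearW|apply: cvgM; exact: hv].
    by rewrite is_cvg_limn_einfE; [rewrite (cvg_lim _ cv)|apply/cvg_ex; eexists; exact: cv].
  under eq_integral do rewrite E.
  apply: le_trans (fatou mu measurableT _ _) _.
  - by move=> k; have [_ /integrableP[]] := sh k.
  - by move=> k x _; rewrite lee_fin -expr2 sqr_ge0.
  - rewrite limn_einf_lim; apply: lime_le; first exact: is_cvg_einfs.
    apply: nearW => k; apply: ge_ereal_inf => /=.
    exists (\int[mu]_x (h k x * h k x)%:E)%E; first by exists k => /=.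
    by rewrite integral_sq // lee_fin.
have j : mu.-integrable setT (EFin \o (fun x => v x * v x)).
  apply/integrableP; split; first exact/measurable_EFinP/measurable_funM.
  under eq_integral do rewrite gee0_abs /= ?lee_fin -?expr2 ?sqr_ge0 //.
  under eq_integral do rewrite expr2.
  by apply: le_lt_trans I _; rewrite ltry.
have sv : sqint v by split.
by split => //; rewrite -lee_fin -integral_sq.
Qed.

(** Completeness of L^2 by hand: a rapidly converging subsequence of the partial sums converges
    almost everywhere, and Fatou's lemma bounds both the limit and its distance from the
    subsequence, hence its coefficients. *)
Lemma riesz_fischer (c : nat -> R) (B : R) :
  (forall J, \sum_(0 <= j < J) c j ^+ 2 <= B) ->
  exists v, [/\ sqint v, forall j, dot v (e j) = c j & dot v v <= B].
Proof.
move=> cB; pose s J := \sum_(0 <= j < J) c j ^+ 2.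
have s_nd I J : (I <= J)%N -> s I <= s J.
  move=> IJ; rewrite /s (big_cat_nat _ (n := I) (p := J)) //= lerDl.
  by apply: sumr_ge0 => j _; rewrite sqr_ge0.
have tail (eps : R) : 0 < eps -> exists N, forall J, s J - s N <= eps.
  move=> eps0; have hs : has_sup (range s).
    by split; [exists (s 0%N), 0%N|exists B => _ [J _ <-]; exact: cB].
  have [_ [N _ <-] hN] := sup_adherent eps0 hs.
  exists N => J; have : s J <= sup (range s) by apply: sup_upper_bound => //; exists J.
  by move: hN; lra.
have q0 k : (0 : R) < (16 ^- k) by rewrite invr_gt0 exprn_gt0.
have /choice[N HN] : forall k, exists N, forall J, s J - s N <= 16 ^- k.
  by move=> k; exact: tail.
(* This index is at least [N k], so the tail bound applies from it on; the successors make it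
   strictly increasing with k < n k, so every coefficient is eventually captured. *)
pose n k := (\sum_(i < k.+1) (N i).+1)%N.
have nS k : (n k < n k.+1)%N by rewrite /n [X in (_ < X)%N]big_ord_recr /= -addn1 leq_add2l.
have nN k : (N k <= n k)%N by rewrite /n big_ord_recr /= (leq_trans (leqnSn _)) // leq_addl.
have n_nd k i : (k <= i)%N -> (n k <= n i)%N.
  by move=> ki; rewrite -(subnK ki); elim: (i - k)%N => // m IH; rewrite addSn (leq_trans IH) // ltnW.
have n_ge k : (k < n k)%N by elim: k => [|k IH]; [rewrite /n big_ord1|exact: leq_ltn_trans IH (nS k)].
pose v_ k := partial_sum c (n k).
have sv_ k : sqint (v_ k) by exact: sqint_partial_sum.
have dv_ k i : (k <= i)%N ->
    dot (fun x => v_ i x - v_ k x) (fun x => v_ i x - v_ k x) <= 16 ^- k.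
  move=> ki; rewrite dot_partial_sum_sq ?n_nd // -/(s _) -/(s _).
  by apply: le_trans (HN k (n i)); rewrite lerB // s_nd // nN.
pose g k x := v_ k.+1 x - v_ k x.
have sg k : sqint (g k) by exact: sqintB.
(* The weight 4^k sits between two rates: the integrals are at most 4^k 16^-k = 4^-k and hence
   summable, while finiteness of the sum at a point bounds the increment there by a multiple of
   2^-k. *)
pose F k x := (4 ^+ k * (g k x * g k x))%:E.
have F0 k x : (0 <= F k x)%E by rewrite lee_fin mulr_ge0 ?exprn_ge0 // -expr2 sqr_ge0.
have mF k : measurable_fun setT (F k).
  by apply/measurable_EFinP; apply: measurable_funM => //; have [mg _] := sg k; exact: measurable_funM.
pose G x := (\sum_(k <oo) F k x)%E.
have mG : measurable_fun setT G.
  by apply: ge0_emeasurable_sum => // k x _ _; exact: F0.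
have G0 x : (0 <= G x)%E by apply: nneseries_ge0 => k _ _; exact: F0.
have IG : (\int[mu]_x G x < +oo)%E.
  rewrite integral_nneseries //.
  have IF k : (\int[mu]_x F k x <= (2 / (2 ^ (k + 1))%:R)%:E)%E.
    rewrite /F; under eq_integral do rewrite EFinM.
    rewrite ge0_integralZl //; last 2 first.
    - by have [_ /integrableP[]] := sg k.
    - by move=> x _; rewrite lee_fin -expr2 sqr_ge0.
    rewrite integral_sq // -EFinM lee_fin.
    apply: le_trans (_ : 4 ^+ k * 16 ^- k <= _).
      by rewrite ler_wpM2l ?exprn_ge0 // dv_.
    rewrite addn1 expnS natrM natrX invfM mulrA divff // mul1r -!exprVn -exprMn.
    rewrite lerXn2r ?nnegrE //; lra.
  apply: le_lt_trans (lee_nneseries _ _) _ => [k _ _|k _|].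
  + by apply: integral_ge0 => x _; exact: F0.
  + exact: IF.
  + have -> : (\sum_(k <oo) (2 / (2 ^ (k + 1))%:R)%:E)%E = (2 : R)%:E.
      have := @cvg_geometric_eseries_half R 2 0; rewrite expr0 divr1 => /cvg_lim -> //.
    exact: ltry.
have iG : mu.-integrable setT G.
  apply/integrableP; split => //.
  by under eq_integral do rewrite gee0_abs //.
pose bad := [set x | G x = +oo%E].
have mbad : measurable bad.
  by have := mG measurableT [set +oo%E] (emeasurable_set1 _); rewrite setTI.
have mubad : mu.-negligible bad.
  have := integrable_ae measurableT iG; apply: negligibleS => x /= bx /(_ I).
  by rewrite bx.
(* On the negligible set where the sum is infinite the functions are replaced by 0. They then
   converge everywhere, and the limit is measurable as a pointwise limit. *)
pose h k x := if `[< bad x >] then 0 else v_ k x.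
have mh k : measurable_fun setT (h k).
  have -> : h k = (v_ k) \_ (~` bad).
    apply/funext => x; rewrite patchE /h; case: asboolP => bx.
      by rewrite memNset // => /(_ bx).
    by rewrite mem_set.
  apply/(measurable_restrictT _ _).1 => //; first exact: measurableC.
  by apply: measurable_funS (proj1 (sv_ k)).
have hv2 k i x : (h i x - h k x) * (h i x - h k x) <=
    (v_ i x - v_ k x) * (v_ i x - v_ k x).
  by rewrite /h; case: asboolP => // _; rewrite subrr mul0r -expr2 sqr_ge0.
have h2 k x : h k x * h k x <= v_ k x * v_ k x.
  by rewrite /h; case: asboolP => // _; rewrite mul0r -expr2 sqr_ge0.
have le_sqint f u : measurable_fun setT f -> sqint u ->
    (forall x, f x * f x <= u x * u x) -> sqint f /\ dot f f <= dot u u.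
  move=> mf [mu_ ju] fu.
  have jf : mu.-integrable setT (EFin \o (fun x => f x * f x)).
    apply: (le_integrable measurableT _ _ ju).
      exact/measurable_EFinP/measurable_funM.
    by move=> x _ /=; rewrite lee_fin !ger0_norm // -expr2 sqr_ge0.
  by split => //; apply: le_Rintegral.
have sh k : sqint (h k) by have [] := le_sqint (h k) (v_ k) (mh k) (sv_ k) (h2 k).
have [v hv] : exists v : T -> R, forall x, h ^~ x @ \oo --> v x.
  suff H x : exists l : R, h ^~ x @ \oo --> l.
    by have [v Hv] := choice H; exists v.
  rewrite /h; case: asboolP => bx; first by exists 0; exact: cvg_cst.
  have Gfin : (G x < +oo)%E by rewrite ltey; apply/eqP.
  have [a Ga] : exists a : R, G x = a%:E.
    by exists (fine (G x)); rewrite fineK // ge0_fin_numE.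
  have a0 : 0 <= a by rewrite -lee_fin -Ga.
  have gb k : `|g k x| <= geometric (a + 1) (2^-1) k.
    have : (F k x <= G x)%E.
      apply: le_trans (nneseries_lim_ge k.+1 _); last by move=> *; exact: F0.
      by rewrite big_nat_recr //= leeDr // sume_ge0 // => i _; exact: F0.
    rewrite Ga lee_fin => hk; rewrite /geometric /= -(@ler_pXn2r _ 2) ?nnegrE //; last first.
      by rewrite mulr_ge0 ?exprn_ge0 ?addr_ge0.
    rewrite real_normK ?num_real // exprMn -exprM mulnC exprM.
    have -> : (2^-1 : R) ^+ 2 = 4^-1 by rewrite expr2 -invfM -natrM.
    rewrite exprVn ler_pdivlMr ?exprn_gt0 // mulrC expr2.
    by apply: le_trans hk _; rewrite expr2; nra.
  have cs : cvgn (series (g ^~ x)).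
    apply: normed_cvg; apply: (@series_le_cvg _ _ (geometric (a + 1) 2^-1)) => //.
    + by move=> k; exact: normr_ge0.
    + by move=> k; rewrite /geometric /= mulr_ge0 ?exprn_ge0 ?addr_ge0.
    + by apply: is_cvg_geometric_series; rewrite ger0_norm //; lra.
  exists (v_ 0%N x + limn (series (g ^~ x))).
  have -> : (fun k => v_ k x) = (fun k => v_ 0%N x + series (g ^~ x) k).
    apply/funext => k; rewrite /series /= /g telescope_sumr //; ring.
  by apply: cvgD; [exact: cvg_cst|exact: cs].
have v_B k : dot (v_ k) (v_ k) <= B.
  have := dot_partial_sum_sq c (leq0n (n k)); rewrite [in X in _ - X]big_nil subr0.
  have -> : (fun x => partial_sum c (n k) x - partial_sum c 0 x) = v_ k.
    by apply/funext => x; rewrite [X in _ - X]big_nil subr0.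
  by move=> ->; exact: cB.
have hB k : dot (h k) (h k) <= B.
  by apply: le_trans (v_B k); have [] := le_sqint _ _ (mh k) (sv_ k) (h2 k).
have [sv vB] := sqint_fatou sh hv hB.
exists v; split => // j.
(* Fatou's lemma for the shifted differences [h (i + k) - h k] as i tends to infinity. *)
have dist k : dot (fun x => v x - h k x) (fun x => v x - h k x) <= 16 ^- k.
  have shk i : sqint (fun x => h (i + k)%N x - h k x) by exact: sqintB.
  have cvk x : (fun i => h (i + k)%N x - h k x) @ \oo --> v x - h k x.
    by apply: cvgB; [by have := hv x; rewrite -(cvg_shiftn k)|exact: cvg_cst].
  apply: (proj2 (@sqint_fatou (fun i x => h (i + k)%N x - h k x) _ _ shk cvk _)) => i.
  apply: le_trans (dv_ k (i + k)%N (leq_addl _ _)).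
  have [] // := le_sqint (fun x => h (i + k)%N x - h k x)
    (fun x => v_ (i + k)%N x - v_ k x) _ _ (hv2 k (i + k)%N).
    by apply: measurable_funB.
  exact: sqintB.
have hj k : (j < k)%N -> dot (h k) (e j) = c j.
  move=> jk; rewrite -(_ : dot (v_ k) (e j) = c j); last first.
    by rewrite dot_partial_sum (ltn_trans jk (n_ge k)).
  rewrite /L2dot /Rintegral; congr fine; apply: ae_eq_integral => //.
  - by have /integrableP[] := integrable_mul (sh k) (se j).
  - by have /integrableP[] := integrable_mul (sv_ k) (se j).
  - apply: negligibleS mubad => x /= /not_implyP[_]; rewrite /h.
    by case: asboolP.
have close k : (j < k)%N -> `|dot v (e j) - c j| <= 4 ^- k.
  move=> jk; rewrite -(hj k jk) -dotBl //.
  (* With weight 4^k the two terms become 4^k 16^-k and 4^-k, both at most 4^-k. *)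
  apply: le_trans (dot_AMGM (_ : 0 < 4 ^+ k) (sqintB sv (sh k)) (se j)) _.
    by rewrite exprn_gt0.
  rewrite oe eqxx mulr1.
  have : 4 ^+ k * dot (fun x => v x - h k x) (fun x => v x - h k x) <= 4 ^- k.
    apply: le_trans (_ : 4 ^+ k * 16 ^- k <= _); first by rewrite ler_wpM2l ?exprn_ge0.
    rewrite -!exprVn -exprMn lerXn2r ?nnegrE //; lra.
  by move: (4 ^+ k * _) (4 ^- k) => p q; lra.
apply/eqP; rewrite -subr_eq0 -normr_eq0; apply/negP => /negP x0.
have {}x0 : 0 < `|dot v (e j) - c j| by rewrite lt_neqAle eq_sym x0 /=.
pose k := maxn j.+1 (Num.bound (`|dot v (e j) - c j|^-1)).
have jk : (j < k)%N by rewrite leq_max leqnn.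
have := close k jk; apply/negP; rewrite -ltNge invf_plt ?posrE ?exprn_gt0 //.
apply: lt_le_trans (archi_boundP _) _; first by rewrite invr_ge0 ltW.
rewrite -natrX ler_nat; apply: leq_trans (leq_maxr j.+1 _) _.
by rewrite ltnW // ltn_expl.
Qed.

End orthonormal.

End square_integrable.

(** * Functions supported in a chart and the Laplacian *)

Section change_of_variables.
Import HBNNSimple.
Local Open Scope ereal_scope.
Context d d' (T : measurableType d) (T' : measurableType d') (R : realType).
Variables (mu : {measure set T -> \bar R}) (nu : {measure set T' -> \bar R}).
Variables (D : set T) (D' : set T') (psi : T' -> T) (w : T' -> R).
Hypothesis mD : measurable D.
Hypothesis mD' : measurable D'.
Hypothesis mpsi : measurable_fun D' psi.
Hypothesis mw : measurable_fun D' w.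
Hypothesis w0 : forall x, D' x -> (0 <= w x)%R.
Hypothesis psiD : forall x, D' x -> D (psi x).
Hypothesis muE : forall A, measurable A ->
  mu (A `&` D) = \int[nu]_(x in D' `&` psi @^-1` A) (w x)%:E.

Lemma change_of_variables_indic (A : set T) : measurable A ->
  \int[mu]_(x in D) (\1_A x)%:E = \int[nu]_(x in D') ((\1_A (psi x)) * w x)%:E.
Proof.
move=> mA; rewrite integral_indic // muE // integral_mkcondr; apply: eq_integral => x _.
rewrite patchE indicE /=; case: ifPn => h.
  by rewrite mem_set ?mul1r //; move: h; rewrite inE.
by rewrite memNset ?mul0r // => h'; move: h; rewrite mem_set.
Qed.

Lemma change_of_variables_nnsfun (s : {nnsfun T >-> R}) :
  \int[mu]_(x in D) (s x)%:E = \int[nu]_(x in D') (s (psi x) * w x)%:E.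
Proof.
have ms y : measurable (s @^-1` [set y]) by exact: measurable_funPTI.
have mI y : measurable_fun D' (fun x => \1_(s @^-1` [set y]) (psi x) : R).
  by apply: measurableT_comp => //; exact: measurable_indic.
rewrite (eq_integral (fun x => \sum_(y \in range s) (y * \1_(s @^-1` [set y]) x)%:E)); last first.
  by move=> x _; rewrite fimfunE -fsumEFin.
rewrite ge0_integral_fsum //; last 2 first.
- by move=> y; apply/measurable_EFinP; apply: measurable_funM => //; exact: measurable_indic.
- by move=> y x _; rewrite EFinM; exact: nnfun_muleindic_ge0.
rewrite [RHS](eq_integral (fun x => \sum_(y \in range s)
    (y * \1_(s @^-1` [set y]) (psi x) * w x)%:E)); last first.
  move=> x _; rewrite (fimfunE s (psi x)) fsumEFin //; congr (_%:E).
  by rewrite !fsbig_finite //= big_distrl.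
rewrite ge0_integral_fsum //; last 2 first.
- by move=> y; apply/measurable_EFinP; apply: measurable_funM => //; apply: measurable_funM.
- move=> y x Dx; rewrite !EFinM mule_ge0 ?lee_fin ?w0 //.
  exact: nnfun_muleindic_ge0.
apply: eq_fsbigr => y; rewrite inE => -[x0 _ yE].
have y0 : (0 <= y)%R by rewrite -yE.
under eq_integral do rewrite EFinM.
rewrite ge0_integralZl //; last by apply/measurable_EFinP; exact: measurable_indic.
rewrite change_of_variables_indic // -ge0_integralZl //.
- by apply: eq_integral => x _; rewrite -EFinM mulrA.
- by apply/measurable_EFinP; apply: measurable_funM.
- by move=> x Dx; rewrite lee_fin mulr_ge0 ?w0.
Qed.

Lemma ge0_change_of_variables (f : T -> \bar R) : measurable_fun D f ->
  (forall x, D x -> 0 <= f x) ->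
  \int[mu]_(x in D) f x = \int[nu]_(x in D') (f (psi x) * (w x)%:E).
Proof.
move=> mf f0; pose s := nnsfun_approx mD mf.
have nd_s n m : (n <= m)%N -> forall x, (s n x <= s m x)%R.
  by move=> nm x; have := nd_nnsfun_approx mD mf nm => /lefP.
have cvg_s x : D x -> (s n x)%:E @[n --> \oo] --> f x.
  by move=> Dx; exact: cvg_nnsfun_approx.
rewrite (eq_integral (fun x => limn (fun n => (s n x)%:E))); last first.
  by move=> x; rewrite inE => Dx; apply/esym/cvg_lim => //; exact: cvg_s.
rewrite monotone_convergence //; last 3 first.
- by move=> n; apply/measurable_EFinP; exact: measurable_funTS.
- by move=> n x _; rewrite lee_fin.
- by move=> x _ n m nm; rewrite lee_fin nd_s.
rewrite [RHS](eq_integral (fun x => limn (fun n => (s n (psi x) * w x)%:E))); last first.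
  move=> x; rewrite inE => Dx; apply/esym/cvg_lim => //.
  under eq_fun do rewrite EFinM.
  by apply: cvgeZr => //; apply: cvg_s; exact: psiD.
rewrite monotone_convergence //; last 3 first.
- move=> n; apply/measurable_EFinP; apply: measurable_funM => //.
  by apply: (measurableT_comp _ mpsi).
- by move=> n x Dx; rewrite lee_fin mulr_ge0 ?w0.
- by move=> x Dx n m nm; rewrite lee_fin ler_wpM2r ?w0 ?nd_s.
by congr (limn _); apply/funext => n; exact: change_of_variables_nnsfun.
Qed.

Lemma change_of_variables (f : T -> R) : measurable_fun D f ->
  \int[mu]_(x in D) (f x)%:E = \int[nu]_(x in D') (f (psi x) * w x)%:E.
Proof.
move=> mf; rewrite [LHS]integralE [RHS]integralE.
have mfE : measurable_fun D (EFin \o f) by exact/measurable_EFinP.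
rewrite ge0_change_of_variables; [|exact: measurable_funepos|by []].
rewrite [X in _ - X]ge0_change_of_variables; [|exact: measurable_funeneg|by []].
congr (_ - _); apply: eq_integral => x; rewrite inE => Dx.
  by rewrite !funeposE /= -!EFin_max -EFinM maxr_pMl ?w0 // mul0r.
by rewrite !funenegE /= -!EFin_max -EFinM maxr_pMl ?w0 // mul0r mulNr.
Qed.

End change_of_variables.

(** * Functions on the manifold coming from a box in a chart *)

Section lifted_functions.
Variables (R : realType) (d : nat) (M : manifold R d).
Variables (c : chart R M d) (x0 : 'rV[R]_d) (rho : R).
Hypothesis ac : atlas c.
Notation K := (box x0 rho).
Notation U := (cim c).
Hypothesis KU : K `<=` U.

Definition test F := smooth_on [set: 'rV[R]_d] F /\ forall x, ~ K x -> F x = 0.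

Definition lift (F : 'rV[R]_d -> R) (q : M) : R :=
  if `[< cdom c q >] then F (cphi c q) else 0.

Definition core : set M := cpsi c @` K.

Lemma lift_core_closed : closed core.
Proof.
apply: compact_closed; first exact: manifold_hausdorff.
by apply: cpsi_image_compact => //; exact: box_compact.
Qed.

Lemma lift_cpsi F x : U x -> lift F (cpsi c x) = F x.
Proof. by move=> Ux; rewrite /lift asboolT ?cpsiK //; exact: cdom_cpsi. Qed.

Lemma lift_out F q : test F -> ~ core q -> lift F q = 0.
Proof.
move=> [_ F0] nq; rewrite /lift; case: asboolP => // cq; apply: F0 => Kq.
by apply: nq; exists (cphi c q) => //; exact: cphiK.
Qed.

(** The chart domain and the complement of the core cover M; both are open, the core being compact
    in a Hausdorff space. On the first set the function is F in coordinates, on the second it is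
    zero. *)
Lemma smooth_lift F : test F -> smooth_function (lift F).
Proof.
move=> tF c' ac'; apply: smooth_on_local => x cx.
have [cq|ncq] := pselect (cdom c (cpsi c' x)).
  have oW : open (cphi c' @` (cdom c' `&` cdom c)) by exact/cphi_image_open/cdom_open.
  exists (cphi c' @` (cdom c' `&` cdom c)); split; first by rewrite cphi_imageE.
  apply: (@eq_smooth_on _ _ _ (fun y => F ((cphi c \o cpsi c') y))) => //.
    by move=> y; rewrite cphi_imageE => -[_ cy]; rewrite /lift /= asboolT.
  apply: (smooth_on_comp oW (proj1 tF)) => //; exact: atlas_smooth.
have oW : open (cphi c' @` (cdom c' `&` ~` core)).
  by apply: cphi_image_open; apply: closed_openC; exact: lift_core_closed.
exists (cphi c' @` (cdom c' `&` ~` core)); split.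
  rewrite cphi_imageE; split => //; move=> [y Ky yx]; apply: ncq.
  by rewrite -yx; exact/cdom_cpsi/KU.
apply: (eq_smooth_on oW _ (smooth_on_cst 0 oW)) => y; rewrite cphi_imageE => -[_ ny].
by rewrite /= lift_out.
Qed.

Lemma smooth_function_continuous (u : M -> R) : smooth_function u -> continuous u.
Proof.
move=> su p; pose c' := chart_at p.
have cp : cdom c' p by exact: chart_at_dom.
have cu : {for cphi c' p, continuous (u \o cpsi c')}.
  apply: (smooth_on_continuous (su c' (chart_at_atlas _))); exact: cim_cphi.
have cc : {for p, continuous ((u \o cpsi c') \o cphi c')}.
  by apply: continuous_comp => //; exact: cphi_continuous.
have near_eq : \forall q \near p, ((u \o cpsi c') \o cphi c') q = u q.
  apply: (open_near (@cdom_open _ _ _ c') cp) => q cq.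
  by rewrite /= cphiK.
have cc' : ((u \o cpsi c') \o cphi c') @ p --> u p.
  have e : ((u \o cpsi c') \o cphi c') p = u p by rewrite /= cphiK.
  by rewrite -e; exact: cc.
apply: cvg_trans cc'; apply: near_eq_cvg; exact: near_eq.
Qed.

Lemma smooth_function_measurable (u : M -> R) : smooth_function u ->
  measurable_fun setT (u : borel M -> measurableTypeR R).
Proof. by move=> su; apply: continuous_borel_measurable; exact: smooth_function_continuous. Qed.

Lemma continuous_open_measurable (T : ptopologicalType) (S : ptopologicalType)
    (V : set T) (f : T -> S) : open V -> (forall x, V x -> {for x, continuous f}) ->
  measurable_fun (V : set (borel T)) (f : borel T -> borel S).
Proof.
move=> oV cf; refine (@measurability _ _ _ _ (V : set (borel T)) (f : borel T -> borel S) (@open _) _ _) => //.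
move=> _ [W oW <-]; apply: (@borel_open _ (V `&` f @^-1` W)).
rewrite openE => x [Vx Wx]; rewrite /interior.
have h1 : nbhs x V by apply: open_nbhs_nbhs.
have h2 : nbhs x (f @^-1` W) by apply: cf => //; exact: open_nbhs_nbhs.
by near=> y; split; near: y.
Unshelve. all: by end_near. Qed.

Lemma continuous_open_measurableR (T : ptopologicalType) (V : set T) (f : T -> R) :
  open V -> (forall x, V x -> {for x, continuous f}) ->
  measurable_fun (V : set (borel T)) (f : borel T -> measurableTypeR R).
Proof.
move=> oV cf; refine (@measurability _ _ _ _ (V : set (borel T)) (f : borel T -> measurableTypeR R) _
  (RGenOpens.measurableE R) _).
move=> _ [W [a [b ->]] <-]; apply: (@borel_open _ (V `&` f @^-1` _)).
rewrite openE => x [Vx Wx]; rewrite /interior.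
have h1 : nbhs x V by apply: open_nbhs_nbhs.
have h2 : nbhs x (f @^-1` `]a, b[) by apply: cf => //; apply: open_nbhs_nbhs; split => //; exact: interval_open.
by near=> y; split; near: y.
Unshelve. all: by end_near. Qed.

Variables (g : M -> 'M[R]_d) (V : set M) (mu : {measure set (borel M) -> \bar R}).
Hypothesis hg : riemannian V g.
Hypothesis cV : cdom c `<=` V.
Hypothesis hmu : is_volume V g mu.

Definition vol (x : 'rV[R]_d) : R := Num.sqrt (\det (gram g c x)).

Lemma smooth_riemannian_gram i j : smooth_on U (fun x => gram g c x i j).
Proof.
have [sf _] := hg; have := sf c ac i j; rewrite cphi_imageE.
by apply: smooth_on_sub => x Ux; split => //; apply: cV; exact: cdom_cpsi.
Qed.

Lemma riemannian_gram_posdef x : U x -> posdef (gram g c x).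
Proof.
by move=> Ux; apply: gram_posdef => //; have [_] := hg; apply; apply: cV; exact: cdom_cpsi.
Qed.

Lemma vol_gt0 x : U x -> 0 < vol x.
Proof. by move=> Ux; rewrite sqrtr_gt0; exact/posdef_det/riemannian_gram_posdef. Qed.

Lemma smooth_vol : smooth_on U vol.
Proof.
have oU : open U by exact: cim_open.
apply: (smooth_on_comp1 oU (@smooth1_sqrt R)) => [|x Ux].
  by apply: smooth_on_det => // i j; exact: smooth_riemannian_gram.
exact/posdef_det/riemannian_gram_posdef.
Qed.

Lemma smooth_ginv i j : smooth_on U (fun x => invmx (gram g c x) i j).
Proof.
have oU : open U by exact: cim_open.
apply: smooth_on_invmx => // [a b|x Ux]; first exact: smooth_riemannian_gram.
by rewrite unitmxE unitfE gt_eqF //; exact/posdef_det/riemannian_gram_posdef.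
Qed.

Lemma ginv_sym x i j : U x -> invmx (gram g c x) i j = invmx (gram g c x) j i.
Proof.
move=> Ux; have [sg _] := riemannian_gram_posdef Ux.
by rewrite -[in RHS]sg -trmx_inv mxE.
Qed.

Lemma measurable_core : measurable (core : set (borel M)).
Proof. by apply: borel_closed; exact: lift_core_closed. Qed.

Lemma core_cdom : core `<=` cdom c.
Proof. by move=> _ [x Kx <-]; exact/cdom_cpsi/KU. Qed.

Lemma measurable_vol_box : measurable_fun (K : set (borel 'rV[R]_d)) (vol : borel 'rV[R]_d -> measurableTypeR R).
Proof.
apply: measurable_funS (continuous_open_measurableR (cim_open (c := c)) _) => //.
  exact: (borel_open (cim_open (c := c))).
by move=> x Ux; exact: (smooth_on_continuous smooth_vol).
Qed.

(** The volume condition, stated with images under [cphi c], is rewritten with preimages under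
    [cpsi c], the form that the change of variables takes as hypothesis. *)
Lemma core_volume (A : set (borel M)) : measurable A ->
  mu (A `&` core) = (\int[leb R d]_(x in K `&` cpsi c @^-1` A) (vol x)%:E)%E.
Proof.
move=> mA; rewrite (hmu ac) //; last 2 first.
- by apply: measurableI => //; exact: measurable_core.
- by move=> q [_ /core_cdom cq]; split => //; exact: cV.
have -> // : (cphi c : borel M -> borel 'rV[R]_d) @` (A `&` core) = K `&` cpsi c @^-1` A.
apply/seteqP; split=> [_ [q [Aq [x Kx xq]] <-]|x [Kx Ax]] /=.
  by rewrite -xq (cpsiK (KU Kx)); split => //; rewrite /= xq.
exists (cpsi c x); last by rewrite cpsiK //; exact: KU.
by split => //; exists x.
Qed.

Lemma vol_bounded : exists2 C, 0 <= C & forall x, K x -> vol x <= C.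
Proof.
have cn : {within K, continuous vol}.
  apply: continuous_in_subspaceT => x; rewrite inE => Kx.
  exact: (smooth_on_continuous smooth_vol (KU Kx)).
have [[x1 bx1]|nb] := pselect (K !=set0); last first.
  by exists 0 => // x bx; exfalso; apply: nb; exists x.
have [x2 Kx2 H] := EVT_max_rV (ex_intro _ x1 bx1) (@box_compact _ _ x0 rho) cn.
exists (vol x2); first by rewrite sqrtr_ge0.
by move=> x Kx; apply: H; rewrite inE.
Qed.

Lemma mu_core_lty : (mu core < +oo)%E.
Proof.
have [C C0 HC] := vol_bounded.
have := core_volume measurableT; rewrite setTI => ->; rewrite setIT.
apply: le_lt_trans (_ : (\int[leb R d]_(x in K) (cst C%:E x) < +oo)%E).
  apply: ge0_le_integral => //.
  - exact: box_measurable.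
  - by move=> x _; rewrite lee_fin sqrtr_ge0.
  - by apply/measurable_EFinP; exact: measurable_vol_box.
rewrite (@integral_cst _ _ _ (leb R d) _ (box_measurable x0 rho)).
by rewrite lte_mul_pinfty ?lee_fin //; exact: leb_box_lty.
Qed.

Lemma integral_core (f : M -> R) : continuous f -> (forall q, ~ core q -> f q = 0) ->
  (\int[mu]_q (f q)%:E = \int[leb R d]_(x in K) (f (cpsi c x) * vol x)%:E)%E.
Proof.
move=> cf f0.
have -> : (\int[mu]_q (f q)%:E = \int[mu]_(q in core) (f q)%:E)%E.
  rewrite [RHS]integral_mkcond; apply: eq_integral => q _; rewrite patchE.
  by case: ifPn => // /negP; rewrite inE => /f0 ->.
apply: (@change_of_variables _ _ (borel M) (borel 'rV[R]_d) R mu (leb R d) core K (cpsi c) vol).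
- exact: measurable_core.
- exact: box_measurable.
- apply: measurable_funS (continuous_open_measurable (cim_open (c := c)) _) => //.
    exact: (borel_open (cim_open (c := c))).
  by move=> x Ux; exact: cpsi_continuous.
- exact: measurable_vol_box.
- by move=> x _; rewrite sqrtr_ge0.
- by move=> x Kx; exists x.
- exact: core_volume.
- exact: measurable_funS (continuous_borel_measurable cf).
Qed.

Lemma sqint_lift F C : test F -> (forall x, `|F x| <= C) ->
  sqint mu (lift F) /\ L2dot mu (lift F) (lift F) <= C ^+ 2 * fine (mu core).
Proof.
move=> tF HC; have mL := smooth_function_measurable (smooth_lift tF).
have C0 : 0 <= C by exact: le_trans (normr_ge0 _) (HC 0).
have Lb q : lift F q * lift F q <= C ^+ 2.
  rewrite -expr2 -real_normK ?num_real // lerXn2r ?nnegrE // /lift.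
  by case: asboolP => // _; rewrite normr0.
have iC : mu.-integrable core (EFin \o cst (C ^+ 2)).
  apply: measurable_bounded_integrable => //; [exact: measurable_core|exact: mu_core_lty|].
  exists (C ^+ 2); split; first exact: num_real.
  by move=> N CN x _ /=; rewrite ger0_norm ?sqr_ge0 // ltW.
have E : EFin \o (fun q => lift F q * lift F q) = (EFin \o (fun q => lift F q * lift F q)) \_ core.
  apply/funext => q; rewrite patchE; case: ifPn => // /negP; rewrite inE => nq /=.
  by rewrite (lift_out tF nq) mul0r.
have ic : mu.-integrable core (EFin \o (fun q => lift F q * lift F q)).
  apply: (le_integrable measurable_core _ _ iC).
    by apply/measurable_EFinP/measurable_funM; exact: measurable_funS mL.
  by move=> q _ /=; rewrite lee_fin !ger0_norm ?sqr_ge0 // -expr2 sqr_ge0.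
split; first by split => //; rewrite E; apply/(@integrable_mkcond _ _ _ _ _ _ measurable_core).
have -> : L2dot mu (lift F) (lift F) = \int[mu]_(q in core) (lift F q * lift F q).
  by rewrite /L2dot /Rintegral [in RHS]integral_mkcond -E.
rewrite -(@Rintegral_cst _ _ _ mu _ measurable_core).
by apply: le_Rintegral => //; exact: measurable_core.
Qed.

Lemma sqint_test F : test F -> sqint mu (lift F).
Proof.
move=> tF; have [sF F0] := tF.
have [|C _ HC] := continuous_box_bounded _ F0.
  by move=> x; exact: (smooth_on_continuous sF).
by have [] := sqint_lift tF HC.
Qed.

End lifted_functions.

Lemma partialM (R : realType) m (f h : 'rV[R]_m -> R) i x :
  differentiable f x -> differentiable h x ->
  partial i (fun y => f y * h y) x = f x * partial i h x + h x * partial i f x.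
Proof.
move=> df dh; have D := @deriveM _ _ f h x (delta_mx 0 i) (diff_derivable df) (diff_derivable dh).
exact: D.
Qed.

Lemma partialB (R : realType) m (f h : 'rV[R]_m -> R) i x :
  differentiable f x -> differentiable h x ->
  partial i (fun y => f y - h y) x = partial i f x - partial i h x.
Proof.
move=> df dh; exact: (@deriveB _ _ _ f h x (delta_mx 0 i) (diff_derivable df) (diff_derivable dh)).
Qed.

(** * Green's formula and Bessel potentials of test functions *)

Section green.
Variables (R : realType) (d : nat) (M : manifold R d).
Variables (c : chart R M d) (x0 : 'rV[R]_d) (rho : R).
Hypothesis ac : atlas c.
Notation K := (box x0 rho).
Notation U := (cim c).
Hypothesis KU : K `<=` U.
Variables (g : M -> 'M[R]_d) (mu : {measure set (borel M) -> \bar R}).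
Hypothesis hg : riemannian setT g.
Hypothesis hmu : is_volume setT g mu.
Let cV : cdom c `<=` setT. Proof. by []. Qed.
Let oU : open U. Proof. exact: cim_open. Qed.

Let boxK : closed K. Proof. exact: box_closed. Qed.

Notation lap := (laplacian g c).
Let w := vol c g.

Let sq f : test x0 rho f -> sqint mu (lift c f).
Proof. exact: (sqint_test ac KU hg cV hmu). Qed.

Definition gradient (f : 'rV[R]_d -> R) (i : 'I_d) (y : 'rV[R]_d) : R :=
  \sum_j invmx (gram g c y) i j * partial j f y.

Lemma smooth_gradient f i : smooth_on U f -> smooth_on U (gradient f i).
Proof.
move=> sf; apply: smooth_on_sum => // j; apply: smooth_onM => //.
  exact: (smooth_ginv ac hg cV).
exact: smooth_on_partial.
Qed.

Let sw : smooth_on U w. Proof. exact: (smooth_vol ac hg cV). Qed.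

Lemma smooth_flux f i : smooth_on U f -> smooth_on U (fun y => w y * gradient f i y).
Proof. by move=> sf; apply: smooth_onM => //; exact: smooth_gradient. Qed.

Lemma laplacianE f x :
  lap f x = (w x)^-1 * \sum_i partial i (fun y => w y * gradient f i y) x.
Proof. by []. Qed.

Lemma smooth_laplacian f : smooth_on U f -> smooth_on U (lap f).
Proof.
move=> sf; apply: (smooth_onM oU).
  apply: (smooth_on_comp1 oU (@smooth1_inv R)) => // x Ux /=.
  by rewrite gt_eqF //; exact: (vol_gt0 ac hg cV).
by apply: smooth_on_sum => // i; apply: smooth_on_partial; exact: smooth_flux.
Qed.

Lemma gradient_outside f i x : (forall y, ~ K y -> f y = 0) -> ~ K x -> gradient f i x = 0.
Proof.
move=> f0 nx; rewrite /gradient big1 // => j _.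
by rewrite (partial_outside j boxK f0 nx) mulr0.
Qed.

Lemma test_laplacian f : test x0 rho f -> test x0 rho (lap f).
Proof.
move=> [sf f0].
have l0 x : ~ K x -> lap f x = 0.
  move=> nx; rewrite laplacianE big1 ?mulr0 // => i _.
  apply: (partial_outside i boxK) nx => y ny.
  by rewrite gradient_outside ?mulr0.
split=> //; apply: (smooth_on_extend boxK KU) => //.
by apply: smooth_laplacian; apply: smooth_on_sub sf.
Qed.

Lemma sum_combination (I : finType) (F H : I -> R) (a b u v q : R) :
  u * q = \sum_i F i -> v * q = \sum_i H i ->
  (a * u - b * v) * q = \sum_i (a * F i - b * H i).
Proof. by move=> uE vE; rewrite sumrB -!mulr_sumr -uE -vE; ring. Qed.

(** The first order terms, products of a partial of f with a partial of h, cancel by the symmetry of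
    the inverse Gram matrix. *)
Lemma divergence_green f h x : smooth_on U f -> smooth_on U h -> U x ->
  \sum_i partial i (fun y => h y * (w y * gradient f i y) - f y * (w y * gradient h i y)) x =
  (h x * lap f x - f x * lap h x) * w x.
Proof.
move=> sf sh Ux.
have w0 : w x != 0 by rewrite gt_eqF //; exact: (vol_gt0 ac hg cV).
have lapE u : lap u x * w x = \sum_i partial i (fun y => w y * gradient u i y) x.
  by rewrite laplacianE mulrAC mulVf ?mul1r.
rewrite (sum_combination (h x) (f x) (lapE f) (lapE h)).
have S u v : \sum_i w x * gradient u i x * partial i v x =
    \sum_i \sum_j w x * (invmx (gram g c x) i j * (partial j u x * partial i v x)).
  apply: eq_bigr => i _; rewrite -mulrA /gradient mulr_suml mulr_sumr.
  by apply: eq_bigr => j _; rewrite !mulrA.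
have E : \sum_i w x * gradient f i x * partial i h x = \sum_i w x * gradient h i x * partial i f x.
  rewrite !S exchange_big /=; apply: eq_bigr => i _; apply: eq_bigr => j _.
  by rewrite (ginv_sym ac hg cV _ _ Ux) [partial i f x * _]mulrC.
transitivity (\sum_i (w x * gradient f i x * partial i h x - w x * gradient h i x * partial i f x
   + (h x * partial i (fun y => w y * gradient f i y) x
      - f x * partial i (fun y => w y * gradient h i y) x))).
  apply: eq_bigr => i _.
  have dF := smooth_on_diff (smooth_flux i sf) Ux; have dH := smooth_on_diff (smooth_flux i sh) Ux.
  have df := smooth_on_diff sf Ux; have dh := smooth_on_diff sh Ux.
  have dM1 := smooth_on_diff (smooth_onM oU sh (smooth_flux i sf)) Ux.
  have dM2 := smooth_on_diff (smooth_onM oU sf (smooth_flux i sh)) Ux.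
  rewrite (partialB i dM1 dM2) (partialM i dh dF) (partialM i df dH).
  move: (partial i (fun y => _ y * gradient f i y) x) (partial i (fun y => _ y * gradient h i y) x).
  by move: (partial i h x) (partial i f x) (gradient f i x) (gradient h i x) => a1 a2 a3 a4 a5 a6; ring.
by rewrite big_split /= sumrB E subrr add0r.
Qed.

(** Both terms of the field V contain f or its gradient, so V is supported in K even though h, which
    will be an eigenfunction in coordinates, is not; the integral of its divergence vanishes
    direction by direction. *)
Lemma green f h : test x0 rho f -> smooth_on U h ->
  (\int[leb R d]_(x in K) ((h x * lap f x - f x * lap h x) * w x)%:E = 0)%E.
Proof.
move=> tf sh; have [sf f0] := tf; have sfU := smooth_on_sub (@subsetT _ U) sf.
pose V i y := h y * (w y * gradient f i y) - f y * (w y * gradient h i y).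
have V0 i y : ~ K y -> V i y = 0.
  by move=> ny; rewrite /V f0 // gradient_outside // !(mulr0, mul0r) subrr.
have sV i : smooth_on setT (V i).
  apply: (smooth_on_extend boxK KU) => [|x /V0 //].
  apply: (smooth_onB oU); apply: (smooth_onM oU) => //; exact: smooth_flux.
(* [integral_partial] concerns boxes centred at 0; this one contains K, and the summand 1 makes its
   radius positive. *)
pose B := `|x0| + `|rho| + 1.
have B0 : 0 < B by rewrite /B -addrA; apply: ltr_wpDl => //; apply: ltr_wpDl.
have KB y : K y -> box 0 B y.
  move=> Ky i; rewrite mxE subr0; have := Ky i; have := rV_norm_coord x0 i.
  rewrite /B; move: (y 0 i) (x0 0 i) => s t; rewrite !ler_norml => h1 h2.
  have := ler_norm rho; move: h1 h2; lra.
have pV i x : ~ K x -> partial i (V i) x = 0.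
  exact: (partial_outside i boxK (V0 i)).
transitivity (\int[leb R d]_x (\sum_i (partial i (V i) x)%:E))%E.
  rewrite integral_mkcond; apply: eq_integral => x _; rewrite patchE sumEFin.
  case: ifPn => [|/negP]; rewrite inE => Kx; first by rewrite divergence_green //; exact: KU.
  by rewrite big1 // => i _; exact: pV.
rewrite integral_sum //=.
  rewrite big1 // => i _; apply: (integral_partial i B0) => // x nx.
  by apply: V0 => /KB.
move=> i; apply: (@smooth_box_integrable _ _ _ x0 rho); first exact: smooth_on_partial.
exact: pV.
Qed.

(** [L2dot] is the [fine] part of an extended integral and infinite values are sent to 0; the value
    1 therefore certifies that the integral of the square is finite. *)
Lemma smooth_eigen_sqint (u : M -> R) : smooth_function u -> L2dot mu u u = 1 -> sqint mu u.
Proof.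
move=> su u1; split; first exact: smooth_function_measurable.
apply/integrableP; split.
  by apply/measurable_EFinP/measurable_funM; exact: smooth_function_measurable.
move: u1; rewrite /L2dot /Rintegral.
under [in X in _ -> X]eq_integral => x _ do rewrite /= ger0_norm -?expr2 ?sqr_ge0 // expr2.
have H (y : \bar R) : fine y = 1 -> (y < +oo)%E.
  by case: y => [y|/eqP|] //=; [rewrite ltry|rewrite eq_sym oner_eq0].
exact: H.
Qed.

(** Both sides are gathered into one integrand on M that vanishes off the core; in coordinates it is
    exactly the integrand of Green's formula, once lam u is replaced by minus the Laplacian of u. *)
Lemma dot_laplacian f u lam : test x0 rho f -> smooth_function u -> sqint mu u ->
  (forall x, U x -> - lap (u \o cpsi c) x = lam * u (cpsi c x)) ->
  L2dot mu (lift c (lap f)) u = - lam * L2dot mu (lift c f) u.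
Proof.
move=> tf su squ eig; have tl := test_laplacian tf.
have sf := sq tf; have sl := sq tl.
have := dotDl sl (sqintZ lam sf) squ; rewrite (dotZl lam sf squ) => E.
suff Z : L2dot mu (fun q => lift c (lap f) q + lam * lift c f q) u = 0.
  by apply/eqP; rewrite -subr_eq0 mulNr opprK -E Z.
rewrite /L2dot /Rintegral.
rewrite (integral_core ac KU hg cV hmu (f := fun q => (lift c (lap f) q + lam * lift c f q) * u q)); first last.
- by move=> q nq; rewrite (lift_out tl nq) (lift_out tf nq) mulr0 addr0 mul0r.
- have cl := smooth_function_continuous (smooth_lift ac KU tl).
  have cf := smooth_function_continuous (smooth_lift ac KU tf).
  have cu := smooth_function_continuous su.
  move=> q; apply: (@continuousM _ _ (fun q => lift c (lap f) q + lam * lift c f q) u); last exact: cu.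
  apply: (@continuousD _ _ _ (lift c (lap f)) (fun q => lam * lift c f q)); first exact: cl.
  by apply: (@continuousM _ _ (fun=> lam) (lift c f)); [exact: cst_continuous|exact: cf].
transitivity (fine (\int[leb R d]_(x in K) (((u \o cpsi c) x * lap f x - f x * lap (u \o cpsi c) x) * w x)%:E)).
  congr fine; apply: eq_integral => x; rewrite inE => /KU Ux; congr EFin.
  rewrite !lift_cpsi //; have := eig x Ux; rewrite /= /w.
  by move: (lap (_ \o _) x) (u _) (lap f x) (f x) (vol _ _ _) => a b p q v /eqP; rewrite eqr_oppLR => /eqP ->; ring.
by rewrite green //; exact: su.
Qed.

Definition one_minus_laplacian f (y : 'rV[R]_d) : R := f y - lap f y.

Lemma test_one_minus_laplacian f : test x0 rho f -> test x0 rho (one_minus_laplacian f).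
Proof.
move=> tf; have [sl l0] := test_laplacian tf; have [sf f0] := tf; split.
  by apply: smooth_onB => //; exact: openT.
by move=> x nx; rewrite /one_minus_laplacian f0 // l0 // subr0.
Qed.

Lemma test_iter f m : test x0 rho f -> test x0 rho (iter m one_minus_laplacian f).
Proof. by move=> tf; elim: m => //= m; exact: test_one_minus_laplacian. Qed.

Lemma lift_sub f h : lift c (fun y => f y - h y) = fun q => lift c f q - lift c h q.
Proof. by apply/funext => q; rewrite /lift; case: asboolP; rewrite ?subr0. Qed.

Lemma dot_iter f u lam m : test x0 rho f -> smooth_function u -> sqint mu u ->
  (forall x, U x -> - lap (u \o cpsi c) x = lam * u (cpsi c x)) ->
  L2dot mu (lift c (iter m one_minus_laplacian f)) u = (1 + lam) ^+ m * L2dot mu (lift c f) u.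
Proof.
move=> tf su squ eig; elim: m => [|m IH]; first by rewrite expr0 mul1r.
have tm := test_iter m tf.
rewrite iterS {1}/one_minus_laplacian lift_sub (dotBl (sq tm) (sq (test_laplacian tm)) squ).
by rewrite (dot_laplacian tm su squ eig) IH exprS; ring.
Qed.

(** It is applied to a = 1 + lam_j. For negative a the logarithm is 0 by convention and the power is
    1, so the bound covers both signs. *)
Lemma powR_le_1D (a s : R) m : 0 <= s -> s <= m%:R -> a `^ s <= 1 + `|a| ^+ m.
Proof.
move=> s0 sm; have [a0|a0] := leP 0 a; last first.
  rewrite /powR (lt_eqF a0); apply: (@le_trans _ _ 1); last by rewrite lerDl exprn_ge0.
  by rewrite ln0 ?mulr0 ?expR0 // ltW.
rewrite ger0_norm //; have [a1|a1] := leP a 1.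
  apply: (@le_trans _ _ 1); last by rewrite lerDl exprn_ge0.
  by have := ge0_ler_powR s0 a0 ler01 a1; rewrite powR1; apply.
apply: (@le_trans _ _ (a ^+ m)); last by rewrite lerDr.
by rewrite -powR_mulrn //; apply: ler_powR => //; exact: ltW.
Qed.

Lemma sqr_powR_bound (p a b : R) : 0 <= p -> p <= 1 + a ->
  p ^+ 2 * b ^+ 2 <= 2 * (b ^+ 2 + a ^+ 2 * b ^+ 2).
Proof.
move=> p0 pa; have q : p ^+ 2 <= 2 * (1 + a ^+ 2).
  have h1 : 0 <= (1 + a - p) * (1 + a + p) by rewrite mulr_ge0 //; lra.
  by have h2 := sqr_ge0 (1 - a); rewrite !expr2 in h2 *; lra.
by have := ler_wpM2r (sqr_ge0 b) q; lra.
Qed.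

Lemma sobolev_bound (e : nat -> M -> R) (lam : nat -> R) (s : R) m f B :
  eigenbasis g mu e lam -> test x0 rho f -> 0 <= s / 2 -> s / 2 <= m%:R ->
  L2dot mu (lift c f) (lift c f) <= B ->
  L2dot mu (lift c (iter m one_minus_laplacian f)) (lift c (iter m one_minus_laplacian f)) <= B ->
  exists v, [/\ bessel mu e lam s (lift c f) v, sqint mu v & L2dot mu v v <= 4 * B].
Proof.
move=> [se eig oe _] tf s0 sm HB HBm.
have sqe j : sqint mu (e j) by apply: smooth_eigen_sqint => //; rewrite oe eqxx.
have tm := test_iter m tf; have sf := sq tf; have sfm := sq tm.
have [|v [sv dv vB]] := @riesz_fischer _ _ _ mu e sqe oe
    (fun j => (1 + lam j) `^ (s / 2) * L2dot mu (lift c f) (e j)) (4 * B).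
  (* The factor 4 is the 2 of (1 + a)^2 <= 2 (1 + a^2) times the two Bessel inequalities, for f and
     for its iterate. *)
  move=> J; apply: le_trans (_ : 2 * (\sum_(0 <= j < J) L2dot mu (lift c f) (e j) ^+ 2 +
    \sum_(0 <= j < J) L2dot mu (lift c (iter m one_minus_laplacian f)) (e j) ^+ 2) <= _).
    rewrite -big_split mulr_sumr /=; apply: ler_sum => j _.
    rewrite (dot_iter m tf (se j) (sqe j) (fun x Ux => eig j c x ac Ux)).
    have := powR_le_1D (1 + lam j) s0 sm; have := powR_ge0 (1 + lam j) (s / 2).
    rewrite !exprMn -[in (1 + lam j) ^+ m ^+ 2]exprM mulnC exprM -(real_normK (num_real (1 + lam j))).
    rewrite -exprM mulnC exprM.
    move: (_ `^ _) (`|_| ^+ m) (L2dot _ _ _) => p a b p0 pa.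
    exact: sqr_powR_bound.
  have h1 := bessel_inequality sqe oe J sf; have h2 := bessel_inequality sqe oe J sfm.
  by move: h1 h2 HB HBm; lra.
exists v; split => //; split => //; exact/in_L2P.
Qed.

End green.

(** * Oscillating functions *)

Section oscillating_functions.
Variables (R : realType) (d : nat) (M : manifold R d).
Variables (c : chart R M d) (x0 : 'rV[R]_d) (rho : R) (a : 'cV[R]_d).
Hypothesis ac : atlas c.
Notation K := (box x0 rho).
Notation U := (cim c).
Hypothesis KU : K `<=` U.
Notation test := (test x0 rho).
Let oU : open U. Proof. exact: cim_open. Qed.
Let oT : open [set: 'rV[R]_d]. Proof. exact: openT. Qed.

Definition linear_phase (x : 'rV[R]_d) : R := (x *m a) 0 0.

Lemma linear_phase_linear : linear linear_phase.
Proof. by move=> k x y; rewrite /linear_phase mulmxDl -scalemxAl !mxE. Qed.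

(** Sums of powers of lam times a test amplitude times a cosine or sine of the phase. The dependence
    on lam is part of the syntax, so a differential operator with smooth coefficients keeps the
    form, and a polynomial bound in lam follows by induction. *)
Inductive oscillating : (R -> 'rV[R]_d -> R) -> Prop :=
| osc_wave b B : test B ->
    oscillating (fun lam x => B x * trig b (lam * linear_phase x))
| osc_add F G : oscillating F -> oscillating G -> oscillating (fun lam x => F lam x + G lam x)
| osc_scale F : oscillating F -> oscillating (fun lam x => lam * F lam x).

Lemma smooth_trig_phase b lam : smooth_on setT (fun x => trig b (lam * linear_phase x)).
Proof.
apply: (smooth_on_comp1 oT (smooth1_trig R b)) => //.
by apply: smooth_onZ => //; apply: smooth_on_lin => //; exact: linear_phase_linear.
Qed.

Lemma partial_trig_phase b lam i x :
  partial i (fun x => trig b (lam * linear_phase x)) x =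
  lam * ((if b then - a i 0 else a i 0) * trig (~~ b) (lam * linear_phase x)).
Proof.
have [_ e] := derive_trig_linear b lam (delta_mx 0 i) x linear_phase_linear.
by apply: etrans e _; rewrite /linear_phase -rowE mxE; case: b => /=; ring.
Qed.

Lemma test_mul q B : smooth_on U q -> test B -> test (fun x => q x * B x).
Proof.
move=> sq [sB B0]; split; last by move=> x nx; rewrite B0 // mulr0.
apply: (smooth_on_extend (@box_closed _ _ x0 rho) KU) => [|x nx]; last by rewrite B0 // mulr0.
by apply: smooth_onM => //; exact: smooth_on_sub sB.
Qed.

Lemma test_partial i B : test B -> test (partial i B).
Proof.
move=> [sB B0]; split; first exact: smooth_on_partial.
exact: (partial_outside i (@box_closed _ _ x0 rho) B0).
Qed.

Lemma oscillating_test F lam : oscillating F -> test (F lam).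
Proof.
elim=> [b B [sB B0]|{}F G _ [sF F0] _ [sG G0]|{}F _ [sF F0]].
- split; last by move=> x nx; rewrite B0 // mul0r.
  by apply: smooth_onM => //; exact: smooth_trig_phase.
- split; first exact: smooth_onD.
  by move=> x nx; rewrite F0 // G0 // addr0.
- split; first exact: smooth_onZ.
  by move=> x nx; rewrite F0 // mulr0.
Qed.

Lemma eq_oscillating F G : (forall lam x, F lam x = G lam x) -> oscillating F -> oscillating G.
Proof. by move=> FG; rewrite (_ : F = G) //; apply/funext => lam; apply/funext. Qed.

Lemma oscillating_mul q F : smooth_on U q -> oscillating F ->
  oscillating (fun lam x => q x * F lam x).
Proof.
move=> sq; elim=> [b B tB|{}F G _ oF _ oG|{}F _ oF].
- apply: (@eq_oscillating (fun lam x => (q x * B x) * trig b (lam * linear_phase x))).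
    by move=> lam x; rewrite mulrA.
  by apply: osc_wave; exact: test_mul.
- apply: (@eq_oscillating (fun lam x => q x * F lam x + q x * G lam x)).
    by move=> lam x; rewrite mulrDr.
  exact: osc_add.
- apply: (@eq_oscillating (fun lam x => lam * (q x * F lam x))).
    by move=> lam x; rewrite mulrCA.
  exact: osc_scale.
Qed.

Lemma oscillating_partial i F : oscillating F -> oscillating (fun lam => partial i (F lam)).
Proof.
elim=> [b B tB|{}F G osF oF osG oG|{}F osF oF].
- apply: (@eq_oscillating (fun lam x => partial i B x * trig b (lam * linear_phase x) +
      lam * (((if b then - a i 0 else a i 0) * B x) * trig (~~ b) (lam * linear_phase x)))).
    move=> lam x; rewrite partialM; [|exact: (smooth_on_diff (proj1 tB))|exact: (smooth_on_diff (smooth_trig_phase b lam))].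
    by rewrite partial_trig_phase; ring.
  apply: osc_add; first by apply: osc_wave; exact: test_partial.
  apply/osc_scale/osc_wave; apply: test_mul => //.
  exact: (smooth_on_cst _ oU).
- apply: (@eq_oscillating (fun lam x => partial i (F lam) x + partial i (G lam) x)); last exact: osc_add.
  move=> lam x; have [sF _] := oscillating_test lam osF; have [sG _] := oscillating_test lam osG.
  by rewrite /partial (deriveD (diff_derivable (smooth_on_diff (x := x) sF I)) (diff_derivable (smooth_on_diff (x := x) sG I))).
- apply: (@eq_oscillating (fun lam x => lam * partial i (F lam) x)); last exact: osc_scale.
  move=> lam x; have [sF _] := oscillating_test lam osF.
  by rewrite /partial (deriveZ _ (diff_derivable (smooth_on_diff (x := x) sF I))).
Qed.

Lemma oscillating0 : oscillating (fun _ _ => 0).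
Proof.
apply: (@eq_oscillating (fun lam x => cst 0 x * trig true (lam * linear_phase x))).
  by move=> lam x; rewrite mul0r.
by apply: osc_wave; split => //; exact: smooth_on_cst.
Qed.

Lemma oscillating_sum (I : Type) (r : seq I) (F : I -> R -> 'rV[R]_d -> R) :
  (forall i, oscillating (F i)) -> oscillating (fun lam x => \sum_(i <- r) F i lam x).
Proof.
move=> oF; elim: r => [|i r IH].
  by apply: eq_oscillating oscillating0 => lam x; rewrite big_nil.
apply: (@eq_oscillating (fun lam x => F i lam x + \sum_(j <- r) F j lam x)).
  by move=> lam x; rewrite big_cons.
exact: osc_add.
Qed.

Section laplacian.
Variable g : M -> 'M[R]_d.
Hypothesis hg : riemannian setT g.
Let cV : cdom c `<=` setT. Proof. by []. Qed.

Lemma oscillating_one_minus_laplacian F : oscillating F ->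
  oscillating (fun lam => one_minus_laplacian c g (F lam)).
Proof.
move=> oF; have sw : smooth_on U (vol c g) by exact: (smooth_vol ac hg cV).
have sv : smooth_on U (fun x => - (vol c g x)^-1).
  apply: smooth_onN => //; apply: (smooth_on_comp1 oU (@smooth1_inv R)) => // x Ux /=.
  by rewrite gt_eqF //; exact: (vol_gt0 ac hg cV).
apply: (@eq_oscillating (fun lam x => F lam x + - (vol c g x)^-1 *
    \sum_(i <- index_enum 'I_d) partial i (fun y => vol c g y *
       \sum_(j <- index_enum 'I_d) invmx (gram g c y) i j * partial j (F lam) y) x)).
  by move=> lam x; rewrite mulNr.
apply: osc_add => //; apply: (oscillating_mul sv); apply: oscillating_sum => i.
apply: (oscillating_partial i (F := fun lam y => vol c g y * _)).
apply: (oscillating_mul sw); apply: oscillating_sum => j.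
apply: oscillating_mul; first exact: (smooth_ginv ac hg cV).
exact: oscillating_partial.
Qed.

Lemma oscillating_iter m F : oscillating F ->
  oscillating (fun lam => iter m (one_minus_laplacian c g) (F lam)).
Proof.
move=> oF; elim: m => //= m IH; exact: oscillating_one_minus_laplacian.
Qed.

End laplacian.

Lemma oscillating_bound F : oscillating F -> exists C k, 0 <= C /\
  forall lam x, 1 <= lam -> `|F lam x| <= C * lam ^+ k.
Proof.
elim=> [b B [sB B0]|{}F G _ [C1 [k1 [C10 H1]]] _ [C2 [k2 [C20 H2]]]|{}F _ [C [k [C0 H]]]].
- have [|C C0 HC] := continuous_box_bounded _ B0.
    by move=> x; exact: (smooth_on_continuous sB).
  exists C, 0%N; split => // lam x _; rewrite expr0 mulr1 normrM.
  apply: le_trans (HC x); rewrite ler_piMr //.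
  exact: trig_max.
- exists (C1 + C2), (maxn k1 k2); split; first exact: addr_ge0.
  move=> lam x l1; apply: le_trans (ler_normD _ _) _; rewrite mulrDl.
  apply: lerD; [apply: le_trans (H1 lam x l1) _|apply: le_trans (H2 lam x l1) _];
  rewrite ler_wpM2l // ler_weXn2l //; [exact: leq_maxl|exact: leq_maxr].
- exists C, k.+1; split => // lam x l1; have lam0 : 0 <= lam by exact: le_trans l1.
  rewrite normrM ger0_norm // exprS mulrCA; apply: ler_wpM2l => //; exact: H.
Qed.

Lemma oscillating_sobolev (g : M -> 'M[R]_d) (mu : {measure set (borel M) -> \bar R})
    (e : nat -> M -> R) (lm : nat -> R) (s : R) F :
  riemannian setT g -> is_volume setT g mu -> eigenbasis g mu e lm -> 0 < s ->
  oscillating F -> exists C k, 0 <= C /\ forall lam, 1 <= lam ->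
    exists v, [/\ bessel mu e lm s (lift c (F lam)) v, sqint mu v &
      L2dot mu v v <= (C * lam ^+ k) ^+ 2].
Proof.
move=> hg hmu he s0 oF; pose m := Num.bound (s / 2).
have s20 : 0 <= s / 2 by rewrite divr_ge0 // ltW.
have sm : s / 2 <= m%:R by exact/ltW/archi_boundP.
have [C1 [k1 [C10 H1]]] := oscillating_bound oF.
have [C2 [k2 [C20 H2]]] := oscillating_bound (oscillating_iter hg m oF).
pose V := fine (mu (core c x0 rho)).
have V0 : 0 <= V by rewrite fine_ge0.
(* Chosen so that 4 B <= (C lam^k)^2, using V <= (1 + V)^2; the sums dominate the constants and
   exponents of both the function and its iterate. *)
pose C := 2 * (C1 + C2) * (1 + V); pose k := (k1 + k2)%N.
exists C, k; split; first by rewrite !mulr_ge0 ?addr_ge0.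
move=> lam l1; have tF := oscillating_test lam oF; have lam0 : 0 <= lam by exact: le_trans l1.
pose B := ((C1 + C2) * lam ^+ k) ^+ 2 * V.
have bnd D j : 0 <= D -> D <= C1 + C2 -> (j <= k)%N -> (D * lam ^+ j) ^+ 2 * V <= B.
  move=> D0 DC jk; apply: ler_wpM2r => //; rewrite lerXn2r ?nnegrE ?mulr_ge0 ?exprn_ge0 ?addr_ge0 //.
  apply: ler_pM => //; rewrite ?exprn_ge0 //; exact: ler_weXn2l.
have cV : cdom c `<=` setT by [].
have C1le : C1 <= C1 + C2 by rewrite lerDl.
have C2le : C2 <= C1 + C2 by rewrite lerDr.
have [v [b sv vB]] := sobolev_bound (m := m) (f := F lam) (B := B) ac KU hg hmu he tF s20 sm
  (le_trans (proj2 (sqint_lift ac KU hg cV hmu tF (fun x => H1 lam x l1)))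
     (bnd _ _ C10 C1le (leq_addr _ _)))
  (le_trans (proj2 (sqint_lift ac KU hg cV hmu (test_iter ac KU hg m tF) (fun x => H2 lam x l1)))
     (bnd _ _ C20 C2le (leq_addl _ _))).
exists v; split => //; apply: le_trans vB _.
rewrite /B /C; move: (C1 + C2) (lam ^+ k) => D L; rewrite !exprMn.
have : V <= (1 + V) ^+ 2 by rewrite expr2; nra.
have : 0 <= D ^+ 2 * L ^+ 2 by rewrite mulr_ge0 ?sqr_ge0.
by move: (D ^+ 2) (L ^+ 2) ((1 + V) ^+ 2) => x y z h1 h2; nra.
Qed.

End oscillating_functions.

(** * Charts, null vectors and moduli of continuity *)

Section charts.
Variables (R : realType) (d : nat).

(** The transitions are restrictions of those of c, so maximality of the atlas applies. This allows
    a chart domain to be placed inside the interior of S. *)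
Lemma restricted_chart (M : manifold R d) (c : chart R M d) (W : set M) : atlas c -> open W ->
  exists c' : chart R M d, [/\ atlas c', cdom c' = cdom c `&` W & cphi c' = cphi c /\ cpsi c' = cpsi c].
Proof.
move=> ac oW; have oD : open (cdom c `&` W) by apply: openI => //; exact: cdom_open.
have sub : cdom c `&` W `<=` cdom c by move=> p [].
have oI : open (cphi c @` (cdom c `&` W)) by exact: cphi_image_open.
have subI : cphi c @` (cdom c `&` W) `<=` cim c by move=> _ [p /sub cp <-]; exact: cim_cphi.
pose c' := @Chart R M d (cdom c `&` W) (cphi c) (cpsi c) oD oI
  (fun p cp => cphiK (sub p cp)) (fun p cp => cphi_continuous (sub p cp))
  (fun x ix => cpsi_continuous (subI x ix)).
exists c'; split => //; apply: atlas_maximal => c'' ac''; split=> j.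
  apply: smooth_on_sub (atlas_smooth ac ac'' j) => _ [p [[cp _] cp''] <-].
  by exists p.
apply: smooth_on_sub (atlas_smooth ac'' ac j) => _ [p [cp'' [cp _]] <-].
by exists p.
Qed.

(** The chart carried over by [iota] has the same image in coordinate space as c, so one function of
    the coordinates can be lifted to both manifolds. It belongs to the atlas of M1 by maximality,
    its transitions being coordinate expressions of [iota] and [iotaV]. *)
Lemma transported_chart (M M1 : manifold R d) (N : set M) (iota : M -> M1) (iotaV : M1 -> M)
    (c : chart R M d) :
  open N -> open (iota @` N) -> (forall p, N p -> iotaV (iota p) = p) ->
  smooth_between N iota -> smooth_between (iota @` N) iotaV -> atlas c -> cdom c `<=` N ->
  exists c2 : chart R M1 d, [/\ atlas c2, cdom c2 = iota @` cdom c &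
    cphi c2 = cphi c \o iotaV /\ cpsi c2 = iota \o cpsi c].
Proof.
move=> oN oiN VK [ci si] [cV sV] ac cN.
have DE : iota @` cdom c = iota @` N `&` iotaV @^-1` cdom c.
  apply/seteqP; split=> [_ [p cp <-]|_ [[p Np <-]]] /=.
    by split; [exists p => //; exact: cN|rewrite /= VK //; exact: cN].
  by rewrite VK // => cp; exists p.
have oD : open (iota @` cdom c).
  rewrite DE openE => q [Nq cq]; rewrite /interior.
  have h1 : nbhs q (iota @` N) by exact: open_nbhs_nbhs.
  have h2 : nbhs q (iotaV @^-1` cdom c).
    by apply: cV => //; apply: open_nbhs_nbhs; split => //; exact: cdom_open.
  exact: filterI.
have imE : (cphi c \o iotaV) @` (iota @` cdom c) = cim c.
  apply/seteqP; split=> [_ [_ [p cp <-] <-]|_ [p cp <-]] /=.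
    by rewrite VK; [exact: cim_cphi|exact: cN].
  by exists (iota p); [exists p|rewrite /= VK //; exact: cN].
have oI : open ((cphi c \o iotaV) @` (iota @` cdom c)) by rewrite imE; exact: cim_open.
have K1 p : (iota @` cdom c) p -> (iota \o cpsi c) ((cphi c \o iotaV) p) = p.
  by move=> [q cq <-] /=; rewrite VK ?cphiK //; exact: cN.
have K2 p : (iota @` cdom c) p -> {for p, continuous (cphi c \o iotaV)}.
  rewrite DE => -[Np cp]; apply: continuous_comp; [exact: cV|exact: cphi_continuous].
have K3 x : ((cphi c \o iotaV) @` (iota @` cdom c)) x -> {for x, continuous (iota \o cpsi c)}.
  rewrite imE => cx; apply: continuous_comp; first exact: cpsi_continuous.
  by apply/ci/cN; exact: cdom_cpsi.
exists (@Chart R M1 d _ _ _ oD oI K1 K2 K3); split => //; apply: atlas_maximal => c' ac'; split=> j.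
  apply: smooth_on_sub (si c c' ac ac' j) => _ [_ [[p cp <-] cp'] <-] /=.
  by exists p; [split => //; split => //; exact: cN|rewrite VK //; exact: cN].
apply: smooth_on_sub (sV c' c ac' ac j) => _ [p [cp' /=]] + <-.
by move=> [q cq qp]; exists p => //; split; [split => //; exists q => //; exact: cN|rewrite -qp VK //; exact: cN].
Qed.

End charts.

(** * A covector that does not vanish on null vectors *)

Section null_vectors.
Variables (R : realType) (n : nat).
Notation eta := (block_mx (-1)%:M 0 0 1%:M : 'M[R]_(1 + n)).

Lemma minkowski_spacelike (w : 'rV[R]_(1 + n)) : w 0 0 = 0 -> w *m eta = w.
Proof.
move=> w0; rewrite -[w in LHS]hsubmxK mul_row_block !mulmx0 addr0 add0r mulmx1.
have l0 : lsubmx w = 0.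
  by apply/rowP => i; rewrite ord1 !mxE (_ : lshift n 0 = 0) //; exact: val_inj.
by rewrite l0 mul0mx -[RHS]hsubmxK l0.
Qed.

(** On vectors without time component the Minkowski form is the Euclidean square S. Since |w_i w_j|
    <= (w_i^2 + w_j^2) / 2, the perturbation is at most eps (n + 1) S, which is less than S unless S
    = 0. *)
Lemma near_minkowski_null (H : 'M[R]_(1 + n)) (w : 'rV[R]_(1 + n)) (eps : R) :
  (forall i j, `|H i j - eta i j| <= eps) -> eps * n.+1%:R < 1 ->
  w 0 0 = 0 -> (w *m H *m w^T) 0 0 = 0 -> w = 0.
Proof.
move=> He en w0 wH.
pose S := \sum_i w 0 i ^+ 2.
have e0 : 0 <= eps by apply: le_trans (normr_ge0 _) (He 0 0).
have E : (w *m H *m w^T) 0 0 = S + \sum_i \sum_j w 0 j * (H j i - eta j i) * w 0 i.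
  rewrite -[X in _ *m X *m _](subrK eta) mulmxDr mulmxDl (minkowski_spacelike w0) mxE addrC.
  congr (_ + _); rewrite mxE; apply: eq_bigr => i _; first by rewrite mxE -expr2.
  by rewrite mxE mulr_suml mxE; apply: eq_bigr => j _; rewrite !mxE.
have B : `|\sum_i \sum_j w 0 j * (H j i - eta j i) * w 0 i| <= eps * n.+1%:R * S.
  apply: le_trans (ler_norm_sum _ _ _) _.
  apply: le_trans (_ : \sum_i \sum_j eps * ((w 0 j ^+ 2 + w 0 i ^+ 2) / 2) <= _).
    apply: ler_sum => i _; apply: le_trans (ler_norm_sum _ _ _) _; apply: ler_sum => j _.
    have := He j i; rewrite !normrM mulrAC; move: (`|H j i - _|) => h hE.
    apply: le_trans (_ : `|w 0 j| * `|w 0 i| * eps <= _).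
      by apply: ler_wpM2l => //; rewrite mulr_ge0.
    rewrite mulrC; apply: ler_wpM2l => //.
    rewrite -(real_normK (num_real (w 0 j))) -(real_normK (num_real (w 0 i))).
    by move: `|w 0 j| `|w 0 i| => u v; have := sqr_ge0 (u - v); rewrite !expr2; lra.
  rewrite le_eqVlt; apply/orP; left; apply/eqP.
  under eq_bigr do rewrite -mulr_sumr -mulr_suml big_split /= sumr_const card_ord -/S.
  rewrite -mulr_sumr -mulr_suml big_split /= sumr_const card_ord -mulrA; congr (_ * _).
  rewrite sumrMnl -/S -[S *+ _]mulr_natl; have H2 (t : R) : (t + t) / 2 = t by lra.
  exact: H2.
have S0 : S = 0.
  have S0 : 0 <= S by apply: sumr_ge0 => i _; exact: sqr_ge0.
  move: B; rewrite -[X in `|X|](addKr S) -E wH addr0 normrN ger0_norm // => h.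
  by apply/eqP; rewrite eq_le S0 andbT; nra.
apply/rowP => i; rewrite mxE; apply/eqP; rewrite -sqrf_eq0.
by move/eqP: S0; rewrite psumr_eq0 => [/allP/(_ i (mem_index_enum i))|j _]; last exact: sqr_ge0.
Qed.

Lemma quad_congruence m (v : 'rV[R]_m) (G Q : 'M[R]_m) : Q \in unitmx ->
  v *m invmx Q *m (Q *m G *m Q^T) *m (v *m invmx Q)^T = v *m G *m v^T.
Proof.
by move=> Qu; rewrite -[in RHS](mulmxKV Qu v) [in RHS]trmx_mul !mulmxA.
Qed.

(** The rows of Q form an orthonormal frame at x0, and [v *m a] is the time component of v in that
    frame. The Gram matrix in this constant frame stays close to the Minkowski matrix near x0, so a
    null vector without time component must vanish at all nearby points. *)
Lemma null_covector (M : manifold R n.+1) (g : M -> 'M[R]_n.+1) (c : chart R M n.+1) x0 :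
  lorentzian g -> atlas c -> cim c x0 -> exists a : 'cV[R]_n.+1,
    \forall x \near x0, forall v : 'rV[R]_n.+1, v != 0 ->
      v *m gram g c x *m v^T = 0 -> (v *m a) 0 0 != 0.
Proof.
move=> hg ac cx0; have [_ lg] := hg.
have [_ [P Pu PE]] := lg (cpsi c x0).
have Fu := coord_frame_unit ac cx0.
pose Q : 'M[R]_(1 + n) := P *m invmx (coord_frame c x0).
have Qu : Q \in unitmx by rewrite unitmx_mul Pu unitmx_inv.
pose H x : 'M[R]_(1 + n) := Q *m gram g c x *m Q^T.
have Hx0 : H x0 = eta.
  by rewrite /H /Q /gram -PE trmx_mul -!mulmxA (mulmxA (invmx _)) mulVmx // mul1mx
    (mulmxA (_^T) (_^T)) -trmx_mul mulVmx // trmx1 mul1mx.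
have sH i j : smooth_on (cim c) (fun x => H x i j).
  have oU : open (cim c) by exact: cim_open.
  apply: smooth_on_mulmx => // [i' j'|i' j']; last exact: smooth_on_cst.
  by apply: smooth_on_mulmx => // [i2 j2|i2 j2]; [exact: smooth_on_cst|exact: smooth_gram].
(* The perturbation lemma needs eps (n + 1) < 1. *)
pose eps : R := (n.+2%:R)^-1.
have eps0 : 0 < eps by rewrite invr_gt0.
have nH i j : \forall x \near x0, `|H x i j - eta i j| <= eps.
  have /cvgrPdist_le/(_ _ eps0) := smooth_on_continuous (sH i j) cx0.
  by apply: filterS => x; rewrite Hx0 distrC.
have nH' : \forall x \near x0, forall i j, `|H x i j - eta i j| <= eps.
  have nF := nbhs_filter x0.
  exact: (@filter_forall _ _ _ _ nF (fun i => @filter_forall _ _ _ _ nF (nH i))).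
exists (col 0 (invmx Q)); apply: filterS nH' => x Hx v v0 vn.
apply: contraNneq v0 => w0.
have vE : v = v *m invmx Q *m Q by rewrite mulmxKV.
suff -> : v = 0 by [].
rewrite vE (near_minkowski_null Hx _ (w := v *m invmx Q)) ?mul0mx //.
- by rewrite /eps mulrC ltr_pdivrMr ?mul1r ?ltr_nat.
- by rewrite -w0 !mxE; apply: eq_bigr => j _; rewrite [in RHS]mxE.
- by rewrite /H (quad_congruence v (gram g c x) Qu) vn mxE.
Qed.

End null_vectors.

(** * From decay of every order to a lower bound for the modulus *)

Section modulus.
Variables (R : realType) (omega : R -> R).

(* For t < C the choice lam = (C / t) ^ (1 / N) gives t = C / lam ^ N and
   lam ^ - k = (t / C) ^ (k / N), where k / N <= alpha. *)
Lemma modulus_lower_bound (c : R) (k : nat) (alpha : R) :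
  (forall s t, 0 <= s -> s <= t -> omega s <= omega t) -> 0 < c -> 0 < alpha ->
  (forall N, exists2 C, 0 < C & forall lam, 1 <= lam -> c / lam ^+ k <= omega (C / lam ^+ N)) ->
  exists C t0 : R, [/\ 0 < C, 0 < t0 & forall t, 0 < t < t0 -> C * t `^ alpha <= omega t].
Proof.
move=> mono c0 al0 H; pose N := (Num.bound (k%:R / alpha)).+1.
have N0 : (0 : R) < N%:R by rewrite ltr0n.
have kN : k%:R / N%:R <= alpha.
  rewrite ler_pdivrMr // mulrC -ler_pdivrMr //.
  have b : k%:R / alpha < (Num.bound (k%:R / alpha))%:R.
    by apply: archi_boundP; rewrite divr_ge0 // ltW.
  by apply: le_trans (ltW b) _; rewrite ler_nat.
have [C C0 HC] := H N; exists (c * C `^ (- alpha)), C; split => //.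
  by rewrite mulr_gt0 // powR_gt0.
move=> t /andP[t0 tC]; pose lam := (C / t) `^ (N%:R^-1).
have Ct : 1 <= C / t by rewrite ler_pdivlMr // mul1r ltW.
have Ct0 : 0 < C / t by rewrite divr_gt0.
have lam1 : 1 <= lam by rewrite -(powRr0 (C / t)); apply: ler_powR => //; rewrite invr_ge0 ltW.
have lamX j : lam ^+ j = (C / t) `^ (j%:R / N%:R).
  rewrite /lam -powR_mulrn ?powR_ge0 // -powRrM; congr (_ `^ _); exact: mulrC.
have := HC lam lam1; rewrite [lam ^+ N]lamX divff ?gt_eqF // powRr1 ?(ltW Ct0) //.
have -> : C / (C / t) = t by rewrite invf_div mulrCA divff ?gt_eqF // mulr1.
apply: le_trans.
rewrite lamX -mulrA ler_pM2l // -powRN.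
have -> : C `^ (- alpha) * t `^ alpha = (C / t) `^ (- alpha).
  rewrite powRM ?invr_ge0 ?(ltW C0) ?(ltW t0) //; congr (_ * _).
  by rewrite -(powR_inv1 (ltW t0)) -powRrM mulN1r opprK.
by apply: ler_powR => //; rewrite lerN2.
Qed.

End modulus.

Section bounded_L2.
Context d (T : measurableType d) (R : realType).
Variable mu : {measure set T -> \bar R}.

Lemma L2norm_patch (D : set T) (f : T -> R) : L2norm mu D f = L2norm mu setT (f \_ D).
Proof. by rewrite /L2norm patch_setT. Qed.

Lemma bounded_L2 (D : set T) (f : T -> R) C : measurable D -> (mu D < +oo)%E ->
  measurable_fun D f -> 0 <= C -> (forall x, D x -> `|f x| <= C) ->
  in_L2 mu D f /\ fine (L2norm mu D f) <= C * Num.sqrt (fine (mu D)).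
Proof.
move=> mD Dlt mf C0 fC.
have sb x : (f \_ D) x * (f \_ D) x = ((fun x => f x * f x) \_ D) x.
  by rewrite !patchE; case: ifP => // _; rewrite mulr0.
have iC : mu.-integrable D (EFin \o cst (C ^+ 2)).
  apply: measurable_bounded_integrable => //.
  by exists (C ^+ 2); split; [exact: num_real|move=> N CN x _ /=; rewrite ger0_norm ?sqr_ge0 // ltW].
have ff x : D x -> f x * f x <= C ^+ 2.
  move=> Dx; rewrite -expr2 -(real_normK (num_real (f x))) lerXn2r ?nnegrE //; exact: fC.
have iD : mu.-integrable D (EFin \o (fun x => f x * f x)).
  apply: (le_integrable mD _ _ iC); first by apply/measurable_EFinP; exact: measurable_funM.
  by move=> x Dx /=; rewrite lee_fin !ger0_norm ?sqr_ge0 -?expr2 ?sqr_ge0 // expr2; exact: ff.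
have E : EFin \o (fun x => (f \_ D) x * (f \_ D) x) = (EFin \o (fun x => f x * f x)) \_ D.
  by apply/funext => x; rewrite /= sb !patchE; case: ifP.
have sq : sqint mu (f \_ D).
  split; first exact/(measurable_restrictT f mD).
  by rewrite E; apply/(@integrable_mkcond _ _ _ _ _ _ mD).
have LE := L2normE sq; rewrite /in_L2 L2norm_patch LE; split; first by split => //; rewrite ltry.
rewrite /= -[X in X * _](ger0_norm C0) -sqrtr_sqr -sqrtrM ?sqr_ge0 //.
apply: ler_wsqrtr; rewrite -Rintegral_cst //.
have -> : L2dot mu (f \_ D) (f \_ D) = \int[mu]_(x in D) (f x * f x).
  by rewrite /L2dot /Rintegral [in RHS]integral_mkcond -E.
exact: le_Rintegral.
Qed.

End bounded_L2.

(** * Light rays *)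

Section lifted_mass.
Variables (R : realType) (d : nat) (M : manifold R d).
Variables (c : chart R M d) (x0 : 'rV[R]_d) (rho : R).
Hypothesis ac : atlas c.
Notation K := (box x0 rho).
Hypothesis KU : K `<=` cim c.
Variables (g : M -> 'M[R]_d) (V : set M) (mu : {measure set (borel M) -> \bar R}).
Hypothesis hg : riemannian V g.
Hypothesis cV : cdom c `<=` V.
Hypothesis hmu : is_volume V g mu.

(** By continuity the integrand in coordinates exceeds half its value at x0 on a smaller box, which
    has positive measure. *)
Lemma lift_mass_gt0 F : 0 < rho -> test x0 rho F -> F x0 != 0 ->
  0 < L2dot mu (lift c F) (lift c F).
Proof.
move=> r0 tF Fx0; have [sF F0] := tF.
have Kx0 : K x0 by move=> i; rewrite subrr normr0 ltW.
have Ux0 := KU Kx0; have oU : open (cim c) by exact: cim_open.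
pose h x := F x * F x * vol c g x.
have sh : smooth_on (cim c) h.
  have sFU := smooth_on_sub (@subsetT _ (cim c)) sF.
  by apply: smooth_onM => //; [exact: smooth_onM|exact: (smooth_vol ac hg cV)].
have h0 : 0 < h x0.
  by rewrite /h mulr_gt0 ?(vol_gt0 ac hg cV) // -expr2 lt0r sqrf_eq0 Fx0 sqr_ge0.
have h00 : 0 < h x0 / 2 by rewrite divr_gt0.
have hge0 x : 0 <= h x by rewrite /h mulr_ge0 ?sqrtr_ge0 // -expr2 sqr_ge0.
have /nbhs_ballP[e /= e0 he] : \forall x \near x0, h x0 / 2 <= h x.
  have /cvgrPdist_le/(_ _ h00) := smooth_on_continuous sh Ux0.
  by apply: filterS => x; rewrite ler_norml; move: (h x0) (h x) => u v; lra.
pose rho' := Num.min rho (e / 2).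
have r'0 : 0 < rho' by rewrite lt_min r0 divr_gt0.
have sL := sqint_test ac KU hg cV hmu tF.
rewrite -lte_fin -integral_sq //.
have cL := smooth_function_continuous (smooth_lift ac KU tF).
rewrite (integral_core ac KU hg cV hmu (f := fun q => lift c F q * lift c F q)); first last.
- by move=> q nq; rewrite (lift_out tF nq) mulr0.
- by move=> q; apply: (@continuousM _ _ (lift c F) (lift c F)); exact: cL.
have mB := box_measurable x0 rho'; have mK := box_measurable x0 rho.
have sub : box x0 rho' `<=` K.
  by move=> x Bx i; apply: le_trans (Bx i) _; rewrite ge_min lexx.
have -> : (\int[leb R d]_(x in K) (lift c F (cpsi c x) * lift c F (cpsi c x) * vol c g x)%:E =
    \int[leb R d]_(x in K) (h x)%:E)%E.
  by apply: eq_integral => x; rewrite inE => /KU Ux; rewrite !lift_cpsi.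
have mh : measurable_fun (K : set (borel 'rV[R]_d)) (h : borel 'rV[R]_d -> measurableTypeR R).
  apply: measurable_funS (continuous_open_measurableR oU _) => //.
    exact: (borel_open oU).
  by move=> x Ux; exact: (smooth_on_continuous sh).
clearbody h.
apply: lt_le_trans (_ : \int[leb R d]_(x in box x0 rho') (h x)%:E <= _)%E; last first.
  apply: (@ge0_subset_integral _ _ _ (leb R d) _ _ mB mK (EFin \o (h : borel 'rV[R]_d -> R)) _ _ sub).
    exact/measurable_EFinP.
  by move=> x _; rewrite lee_fin; exact: hge0.
apply: lt_le_trans (_ : \int[leb R d]_(x in box x0 rho') (cst (h x0 / 2)%:E x) <= _)%E; last first.
  apply: (@ge0_le_integral _ _ _ (leb R d) _ mB (cst (h x0 / 2)%:E)
    (EFin \o (h : borel 'rV[R]_d -> R))).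
  - by move=> x _; rewrite lee_fin; exact: ltW.
  - exact: measurable_cst.
  - by apply/measurable_EFinP; exact: measurable_funS mh.
  - move=> x Bx; rewrite lee_fin; apply: he; rewrite -ball_normE /= distrC.
    apply: box_sub_ball Bx; first exact: ltW.
    by rewrite gt_min; apply/orP; right; move: e0; move: (e) => u; lra.
have P : (0 < leb R d (box x0 rho'))%E.
  by rewrite leb_box ?ltW // lte_fin exprn_gt0 // mulr_gt0.
rewrite (@integral_cst _ _ _ (leb R d) _ mB); apply: mule_gt0; last exact: P.
by rewrite lte_fin.
Qed.

End lifted_mass.

Lemma lift_pull_back (R : realType) n (M M1 : manifold R n.+1) (c : chart R M n.+1) (c2 : chart R M1 n.+1)
    x0 rho (N : set M) (iota : M -> M1) (iotaV : M1 -> M) F :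
  box x0 rho `<=` cim c -> cdom c `<=` N -> (forall p, N p -> iotaV (iota p) = p) ->
  cdom c2 = iota @` cdom c -> cphi c2 = cphi c \o iotaV -> test x0 rho F ->
  pull_back N iota (lift c2 F) = lift c F.
Proof.
move=> KU cN VK dE pE tF; apply/funext => q; rewrite /pull_back patchE.
case: ifPn => [|/negP]; rewrite inE => Nq.
  rewrite /= /lift pE /= VK //; have [cq|ncq] := pselect (cdom c q).
    by rewrite !asboolT // dE; exists q.
  rewrite !asboolF // dE => -[p cp pq]; apply: ncq.
  by rewrite -(VK q Nq) -pq VK //; exact: cN.
by rewrite /lift asboolF // => /cN.
Qed.

Section null_rays.
Variables (R : realType) (n : nat) (M : manifold R n.+1) (g : M -> 'M[R]_n.+1).
Variables (c : chart R M n.+1) (U : set 'rV[R]_n.+1) (a : 'cV[R]_n.+1).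
Hypothesis ac : atlas c.
Hypothesis oU : open U.
Hypothesis Uc : U `<=` cim c.
Variable l : R.

Lemma lightlike_geodesic_on (gam : R -> M) : lightlike_geodesic g l gam ->
  geodesic_on g [set s | 0 <= s <= l] gam.
Proof.
move=> [[eps e0 ge] _] s /= /andP[s0 sl]; apply: ge => /=; rewrite in_itv /=.
by apply/andP; split; lra.
Qed.

Lemma lightlike_speed (gam : R -> M) s : lightlike_geodesic g l gam -> 0 <= s <= l ->
  patch c U (gam s) ->
  (forall x, U x -> forall v : 'rV[R]_n.+1, v != 0 ->
     v *m gram g c x *m v^T = 0 -> (v *m a) 0 0 != 0) ->
  speed a (state c gam s) != 0.
Proof.
move=> lg sl [cs Us] H; have [cgs ge] := lightlike_geodesic_on lg sl.
have [ds _ _] := ge c ac cs; have [_ /(_ s sl)[v0 vn]] := lg.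
have vE := velocityE ac cgs cs ds.
rewrite stateE /speed row_mxKr; apply: H Us _ _ _.
  by apply: contraNneq v0 => e; rewrite vE e mul0mx.
by rewrite -vn vE /gram cphiK // trmx_mul !mulmxA.
Qed.

Variables (kappa : M -> 'rV[R]_n.+1 -> R) (x0 : 'rV[R]_n.+1) (rho : R).
Hypothesis hkappa : smooth_weight kappa.
Notation K := (box x0 rho).
Hypothesis KU : K `<=` U.

Definition weight_amplitude (F : 'rV[R]_n.+1 -> R) (y : 'rV[R]_(n.+1 + n.+1)) : R :=
  kappa (cpsi c (lsubmx y)) (rsubmx y *m coord_frame c (lsubmx y)) * F (lsubmx y).

(** The weight is smooth away from zero velocity only, and on [phase_dom] the nonzero speed excludes
    zero velocity. *)
Lemma amplitude_weight F : test x0 rho F -> amplitude U K a (weight_amplitude F).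
Proof.
move=> [sF F0]; split; last by move=> y nK; rewrite /weight_amplitude F0 // mulr0.
have oD : open (phase_dom U a) by exact: phase_dom_open.
apply: smooth_onM => //.
  have [sk _] := hkappa; apply: smooth_on_sub (sk c ac) => y [Uy sy]; split; first exact: Uc.
  by apply: contraNneq sy => e; rewrite /speed e mul0mx mxE.
by apply: (smooth_on_comp oD sF) => //; exact: smooth_lsubmx.
Qed.

Lemma ray_transform_lift (Th : topologicalType) (gam : Th -> R -> M) p F :
  lightlike_geodesic g l (gam p) -> test x0 rho F ->
  weighted_ray_transform kappa l (lift c F) (gam p) =
  ray_integral gam l c U (weight_amplitude F) p.
Proof.
move=> lg tF; apply: eq_Rintegral => s; rewrite inE /= in_itv /= => sl.
have [cgs ge] := lightlike_geodesic_on lg sl.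
rewrite /along; case: asboolP => [[cs Us]|np].
  have [ds _ _] := ge c ac cs.
  by rewrite (velocityE ac cgs cs ds) stateE /weight_amplitude row_mxKl row_mxKr cphiK // /lift asboolT.
rewrite /lift; case: asboolP => cs; last by rewrite mulr0.
have [_ F0] := tF; rewrite F0 ?mulr0 // => Ks; apply: np; split => //; exact: KU.
Qed.

End null_rays.

(** * Initial data of the rays *)

Section initial_states.
Variables (R : realType) (n : nat) (M : manifold R n.+1) (g : M -> 'M[R]_n.+1).
Variables (c : chart R M n.+1) (T : R) (Z0 Z : set 'rV[R]_n) (A0 A : set 'rV[R]_n.-1).
Variables (g' : R -> 'rV[R]_n -> 'M[R]_n) (theta : 'rV[R]_n -> 'rV[R]_n.-1 -> 'rV[R]_n).
Variable gam : 'rV[R]_n -> 'rV[R]_n.-1 -> R -> M.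
Hypothesis T0 : 0 < T.
Hypothesis hZ : coord_nbhd Z0 Z.
Hypothesis hA : coord_nbhd A0 A.
Hypothesis hc : semigeodesic g c T Z0 g'.
Hypothesis htheta : sphere_coordinates (g' 0) Z0 A0 theta.
Hypothesis hstart : forall z a, closure Z z -> closure A a -> starts_at c (gam z a) z (theta z a).

Let pts : topologicalType := ('rV[R]_n * 'rV[R]_n.-1)%type.
(** Closures are taken to have a compact set of rays, hence uniform constants; the L^2 norm of the
    transform is over the open set Z x A. *)
Definition params : set pts := [set p | closure Z p.1 /\ closure A p.2].
Definition rays (p : pts) : R -> M := gam p.1 p.2.

Lemma params_compact : compact params.
Proof.
have [_ _ _ cZ _] := hZ; have [_ _ _ cA _] := hA.
exact: (@compact_setX _ _ (closure Z) (closure A) cZ cA).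
Qed.

Lemma initial_state p : params p ->
  [/\ cdom c (rays p 0), cphi c (rays p 0) = pt 0 p.1 &
      derive1 (cphi c \o rays p) 0 = pt 1 (theta p.1 p.2)].
Proof.
move=> [Zp Ap]; have [g0 dg] := hstart Zp Ap.
have [_ ic _] := hc; have [_ _ _ _ ZZ] := hZ.
have im : cim c (pt 0 p.1).
  rewrite ic; exists 0; first by rewrite /= in_itv /= T0 oppr_lt0 T0.
  by exists p.1 => //; exact: ZZ.
by rewrite /rays g0; split => //; [exact: cdom_cpsi|exact: cpsiK].
Qed.

Lemma rV_norm_row_mx_lt m1 m2 (u : 'rV[R]_m1) (v : 'rV[R]_m2) e : 0 < e ->
  `|u| < e -> `|v| < e -> `|row_mx u v| < e.
Proof.
move=> e0 /(rV_norm_lt _ e0) Hu /(rV_norm_lt _ e0) Hv; apply/(rV_norm_lt _ e0) => i.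
by have [j ->|j ->] := split_ordP i; rewrite (row_mxEl, row_mxEr).
Qed.

Lemma pt_dist_lt (t : R) (z z' : 'rV[R]_n) e : 0 < e -> `|z - z'| < e -> `|pt t z - pt t z'| < e.
Proof.
move=> e0 zz; have -> : pt t z - pt t z' = (row_mx 0 (z - z') : 'rV[R]_(1 + n)).
  change (row_mx t%:M z - row_mx t%:M z' = row_mx 0 (z - z') :> 'rV[R]_(1 + n)).
  by rewrite opp_row_mx add_row_mx subrr.
by apply: (@rV_norm_row_mx_lt 1 n) => //; rewrite normr0.
Qed.

(** The initial state in the semigeodesic chart is (0, z) with velocity (1, theta), and theta is
    continuous in both parameters; this starts the propagation of continuity along the rays. *)
Lemma initial_state_cvg p : params p -> exists c', state_cvg params rays p 0 c'.
Proof.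
move=> Pp; have [ac _ _] := hc; exists c; have [cp Ep Dp] := initial_state Pp.
split=> // e e0; have [st _ _ _] := htheta.
have [_ _ _ _ ZZ] := hZ; have [_ _ _ _ AA] := hA; have [Zp Ap] := Pp.
have nfst d : 0 < d -> \forall q \near (p : pts), `|p.1 - q.1| < d.
  move=> d0; have C : (fun q : pts => q.1) @ (p : pts) --> p.1 by exact: cvg_fst.
  by move/cvgrPdist_lt: C; exact.
have nsnd d : 0 < d -> \forall q \near (p : pts), `|p.2 - q.2| < d.
  move=> d0; have C : (fun q : pts => q.2) @ (p : pts) --> p.2 by exact: cvg_snd.
  by move/cvgrPdist_lt: C; exact.
have nt : \forall q \near (p : pts), `|theta p.1 p.2 - theta q.1 q.2| < e.
  pose f (y : 'rV[R]_(n + n.-1)) := theta (lsubmx y) (rsubmx y).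
  have cf : {for row_mx p.1 p.2, continuous f}.
    apply: (smooth_map_continuous st); rewrite /= row_mxKl row_mxKr.
    by split; [exact: ZZ|exact: AA].
  have cr : (fun q : pts => row_mx q.1 q.2) @ (p : pts) --> row_mx p.1 p.2.
    apply/cvgrPdist_lt => d d0; apply: filterS2 (nfst d d0) (nsnd d d0) => q h1 h2.
    by rewrite opp_row_mx add_row_mx; exact: rV_norm_row_mx_lt.
  have C : (fun q : pts => f (row_mx q.1 q.2)) @ (p : pts) --> f (row_mx p.1 p.2).
    exact: (@cvg_comp _ _ _ (fun q : pts => row_mx q.1 q.2) f _ _ _ cr cf).
  move/cvgrPdist_lt: C => /(_ _ e0).
  by apply: filterS => q; rewrite /f !row_mxKl !row_mxKr.
apply: filterS2 (nfst e e0) nt => q hz ht Pq; have [cq Eq Dq] := initial_state Pq.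
split=> //; rewrite !stateE Ep Eq Dp Dq opp_row_mx add_row_mx.
by apply: rV_norm_row_mx_lt => //; exact: pt_dist_lt.
Qed.

End initial_states.

Section parameter_space.
Variables (R : realType) (n : nat).
Variables (Z : set 'rV[R]_n) (A : set 'rV[R]_n.-1).
Hypothesis oZ : open Z.
Hypothesis oA : open A.
Hypothesis cZ : compact (closure Z).
Hypothesis cA : compact (closure A).

Lemma rsubmx_preimage_open m1 m2 (U : set 'rV[R]_m2) : open U ->
  open [set y : 'rV[R]_(m1 + m2) | U (rsubmx y)].
Proof.
move=> oU; apply: (@open_comp _ _ (fun y : 'rV[R]_(m1 + m2) => rsubmx y)) => // x _.
exact: (smooth_map_continuous (smooth_rsubmx (@openT _))).
Qed.

Lemma param_space_open : open (param_space Z A : set 'rV[R]_(n + n.-1)).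
Proof. by apply: openI; [exact: lsubmx_preimage_open|exact: rsubmx_preimage_open]. Qed.

Lemma param_space_measurable : measurable (param_space Z A).
Proof. exact: (borel_open param_space_open). Qed.

Lemma compact_sub_box m (C : set 'rV[R]_m) : compact C -> exists2 B, 0 <= B & C `<=` box 0 B.
Proof.
move=> /compact_bounded [B [_ HB]]; exists (`|B| + 1); first by rewrite addr_ge0.
move=> x Cx i; rewrite mxE subr0; apply: le_trans (rV_norm_coord x i) _.
by apply: HB Cx; have := ler_norm B; lra.
Qed.

Lemma leb_param_space_lty : (leb R (n + n.-1) (param_space Z A) < +oo)%E.
Proof.
have [B1 _ H1] := compact_sub_box cZ; have [B2 _ H2] := compact_sub_box cA.
pose B := Num.max B1 B2.
apply: le_lt_trans (leb_box_lty (0 : 'rV[R]_(n + n.-1)) B).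
apply: le_measure; rewrite ?inE; [exact: param_space_measurable|exact: box_measurable|].
move=> y [Zy Ay] i; rewrite mxE subr0.
have h1 := H1 _ (subset_closure Zy); have h2 := H2 _ (subset_closure Ay).
have [j ->|j ->] := split_ordP i.
  by have := h1 j; rewrite !mxE subr0 => /le_trans; apply; rewrite le_max lexx.
by have := h2 j; rewrite !mxE subr0 => /le_trans; apply; rewrite le_max lexx orbT.
Qed.

End parameter_space.

(** * Measurability and decay of the transform of waves *)

Section wave_transform.
Variables (R : realType) (n : nat) (M : manifold R n.+1) (g : M -> 'M[R]_n.+1).
Hypothesis hg : lorentzian g.
Variables (l : R) (Z : set 'rV[R]_n) (A : set 'rV[R]_n.-1).
Variable gam : 'rV[R]_n -> 'rV[R]_n.-1 -> R -> M.
Hypothesis l0 : 0 < l.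
Hypothesis oZ : open Z.
Hypothesis oA : open A.
Hypothesis cP : compact (params Z A).
Hypothesis lg : forall z a, closure Z z -> closure A a -> lightlike_geodesic g l (gam z a).
Hypothesis init : forall p, params Z A p -> exists c, state_cvg (params Z A) (rays gam) p 0 c.
Variables (c : chart R M n.+1) (U : set 'rV[R]_n.+1) (a : 'cV[R]_n.+1).
Variables (x0 : 'rV[R]_n.+1) (rho : R) (kappa : M -> 'rV[R]_n.+1 -> R).
Notation K := (box x0 rho).
Hypothesis ac : atlas c.
Hypothesis oU : open U.
Hypothesis Uc : U `<=` cim c.
Hypothesis KU : K `<=` U.
Hypothesis hkappa : smooth_weight kappa.
Hypothesis null : forall x, U x -> forall v : 'rV[R]_n.+1, v != 0 ->
  v *m gram g c x *m v^T = 0 -> (v *m a) 0 0 != 0.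
Hypothesis ends : forall p, params Z A p ->
  ~ patch c U (rays gam p 0) /\ ~ patch c U (rays gam p l).

Let geo p : params Z A p -> geodesic_on g [set s | 0 <= s <= l] (rays gam p).
Proof. by move=> [Zp Ap]; apply: lightlike_geodesic_on; exact: lg. Qed.

Let moving p s : params Z A p -> 0 <= s <= l -> patch c U (rays gam p s) ->
  speed a (state c (rays gam p) s) != 0.
Proof. by move=> [Zp Ap] sl Us; apply: (lightlike_speed ac (lg Zp Ap) sl Us null). Qed.

Let cK : compact K. Proof. exact: box_compact. Qed.

Lemma params_sub (y : 'rV[R]_(n + n.-1)) : param_space Z A y -> params Z A (lsubmx y, rsubmx y).
Proof. by move=> [Zy Ay]; split; exact: subset_closure. Qed.

Definition transform (F : 'rV[R]_n.+1 -> R) (y : 'rV[R]_(n + n.-1)) : R :=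
  weighted_ray_transform kappa l (lift c F) (gam (lsubmx y) (rsubmx y)).

Lemma transformE F y : test x0 rho F -> param_space Z A y ->
  transform F y = ray_integral (rays gam) l c U (weight_amplitude c kappa F) (lsubmx y, rsubmx y).
Proof.
move=> tF Dy; have [Zy Ay] := params_sub Dy.
by rewrite -(ray_transform_lift ac kappa KU (gam := rays gam) (lg Zy Ay) tF).
Qed.

Lemma transform_measurable F : test x0 rho F ->
  measurable_fun (param_space Z A) (transform F : borel 'rV[R]_(n + n.-1) -> measurableTypeR R).
Proof.
move=> tF; pose f (y : 'rV[R]_(n + n.-1)) : R :=
  ray_integral (rays gam) l c U (weight_amplitude c kappa F) (lsubmx y, rsubmx y).
have oD := param_space_open oZ oA.
apply: (continuous_open_measurableR oD) => y' Dy'.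
suff cont (y : 'rV[R]_(n + n.-1)) : param_space Z A y -> transform F @ y --> transform F y.
  exact: cont.
move=> {y' Dy'} Dy.
have aF := amplitude_weight a ac oU Uc hkappa tF.
have Py := params_sub Dy.
have Fy : Filter (nbhs y) by exact: nbhs_filter.
apply/cvgrPdist_lt => e e0.
have H := ray_integral_continuous hg l0 geo init ac oU Uc cK KU moving Py aF e0.
have pc : (fun z : 'rV[R]_(n + n.-1) => (lsubmx z, rsubmx z)) @ y -->
    ((lsubmx y, rsubmx y) : 'rV[R]_n * 'rV[R]_n.-1).
  have pl : (fun z : 'rV[R]_(n + n.-1) => lsubmx z) @ y --> lsubmx y.
    exact: (smooth_map_continuous (smooth_lsubmx (@openT _))).
  have pr : (fun z : 'rV[R]_(n + n.-1) => rsubmx z) @ y --> rsubmx y.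
    exact: (smooth_map_continuous (smooth_rsubmx (@openT _))).
  exact: (cvg_pair pl pr).
have H' : \forall z \near y, params Z A (lsubmx z, rsubmx z) ->
    `|f z - f y| < e by exact: (pc _ H).
have nD : \forall z \near y, param_space Z A z by apply: (open_near oD Dy).
apply: filterS2 H' nD => z Hz Dz; rewrite !transformE // distrC; apply: Hz; exact: params_sub.
Qed.

Definition oscillation (chi : 'rV[R]_n.+1 -> R) b (lam : R) (x : 'rV[R]_n.+1) : R :=
  chi x * trig b (lam * linear_phase a x).

(** The factor sigma is kept apart because it will itself depend on lam; C does not depend on it. *)
Lemma transform_decay chi N : test x0 rho chi -> exists2 C, 0 <= C &
  forall b lam sigma y, param_space Z A y -> 1 <= lam ->
    `|transform (fun x => sigma * oscillation chi b lam x) y| <= `|sigma| * (C / lam ^+ N).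
Proof.
move=> tchi; have aB := amplitude_weight a ac oU Uc hkappa tchi.
have [C C0 HC] := ray_integral_decay hg l0 cP geo init ac oU Uc cK KU moving ends N aB.
exists C => // b lam sigma y Dy lam1; have Py := params_sub Dy.
have tF : test x0 rho (fun x => sigma * oscillation chi b lam x).
  have oT : open [set: 'rV[R]_n.+1] by exact: openT.
  have [s1 s2] := oscillating_test lam (osc_wave a b tchi).
  by split; [exact: smooth_onZ|move=> x /s2 E; rewrite /oscillation E mulr0].
rewrite transformE //; set p := (_, _).
have -> : ray_integral (rays gam) l c U (weight_amplitude c kappa (fun x => sigma * oscillation chi b lam x)) p =
    sigma * ray_integral (rays gam) l c U (wave a b lam (weight_amplitude c kappa chi)) p.
  have aW := amplitude_wave oU b lam aB.
  have I := along_integrable hg geo ac oU Uc cK KU moving Py aW.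
  rewrite /ray_integral -RintegralZl //; apply: eq_Rintegral => s _.
  rewrite /along; case: asboolP => _; last by rewrite mulr0.
  by rewrite /weight_amplitude /wave /oscillation /phase /linear_phase; ring.
by rewrite normrM; apply: ler_wpM2l => //; exact: HC.
Qed.

End wave_transform.

(** * The stability estimate *)

Lemma L2norm0 d (T : measurableType d) (R : realType) (mu : {measure set T -> \bar R}) (D : set T) :
  L2norm mu D (fun=> 0) = 0%E.
Proof.
rewrite L2norm_patch (_ : _ \_ D = fun=> 0); last first.
  by apply/funext => x; rewrite patchE; case: ifP.
by rewrite L2normE; [rewrite dot0l sqrtr0|exact: sqint0].
Qed.

Lemma dotZ2 d (T : measurableType d) (R : realType) (mu : {measure set T -> \bar R}) a (f : T -> R) :
  sqint mu f -> L2dot mu (fun x => a * f x) (fun x => a * f x) = a ^+ 2 * L2dot mu f f.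
Proof.
by move=> sf; rewrite (dotZl a sf (sqintZ a sf)) dotC (dotZl a sf sf) mulrA expr2.
Qed.

Section sobolev_lift.
Variables (R : realType) (d : nat) (M : manifold R d).
Variables (c : chart R M d) (x0 : 'rV[R]_d) (rho : R).
Hypothesis ac : atlas c.
Notation K := (box x0 rho).
Hypothesis KU : K `<=` cim c.
Variables (g : M -> 'M[R]_d) (mu : {measure set (borel M) -> \bar R}).
Variables (e : nat -> M -> R) (lam : nat -> R).
Hypothesis he : eigenbasis g mu e lam.

Lemma bessel0 s : bessel mu e lam s (fun=> 0) (fun=> 0).
Proof.
by split; [exact/in_L2P/sqint0|exact/in_L2P/sqint0|move=> j; rewrite dot0l mulr0].
Qed.

Lemma liftZ a F : lift c (fun x => a * F x) = fun q => a * lift c F q.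
Proof. by apply/funext => q; rewrite /lift; case: asboolP; rewrite ?mulr0. Qed.

Lemma lift0 : lift c (fun=> 0) = fun=> 0.
Proof. by apply/funext => q; rewrite /lift; case: asboolP. Qed.

Lemma besselZ s a u v : bessel mu e lam s u v ->
  bessel mu e lam s (fun q => a * u q) (fun q => a * v q).
Proof.
move=> [/in_L2P su /in_L2P sv uv]; have [se _ oe _] := he.
have sqe j : sqint mu (e j) by apply: smooth_eigen_sqint => //; rewrite oe eqxx.
split; [exact/in_L2P/sqintZ|exact/in_L2P/sqintZ|].
by move=> j; rewrite !dotZl // uv mulrCA.
Qed.

Lemma sobolev_ball_lift (S : set M) s r F v : test x0 rho F -> core c x0 rho `<=` S ->
  bessel mu e lam s (lift c F) v -> 0 <= r -> L2dot mu v v <= r ^+ 2 ->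
  sobolev_ball mu e lam S s r (lift c F).
Proof.
move=> tF cS b r0 vr; split; last first.
  exists v => //; have [_ /in_L2P sv _] := b; rewrite L2normE // lee_fin.
  by rewrite -[leRHS](ger0_norm r0) -sqrtr_sqr; exact: ler_wsqrtr.
move=> p sp; apply: contrapT => nS; apply: sp.
exists (~` core c x0 rho); last by move=> cp; apply: nS; exact: cS.
split; first by apply: closed_openC; exact: lift_core_closed.
by apply: aeW => q nq; exact: (lift_out tF nq).
Qed.

End sobolev_lift.

(** The constant sequence at u is an approximating sequence, with the zero function as Bessel
    potential of each difference. *)
Lemma light_ray_extension_smooth (R : realType) n (M M1 : manifold R n.+1)
    (Z : set 'rV[R]_n) (A : set 'rV[R]_n.-1) (gam : 'rV[R]_n -> 'rV[R]_n.-1 -> R -> M) (l : R)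
    (kappa : M -> 'rV[R]_n.+1 -> R) (mu1 : {measure set (borel M1) -> \bar R})
    (e : nat -> M1 -> R) (lam : nat -> R) (N : set M) (iota : M -> M1) s u :
  smooth_function u -> closure [set p | u p != 0] `<=` iota @` N ->
  in_L2 (leb R (n + n.-1)) (param_space Z A) (light_ray_transform gam l kappa (pull_back N iota u)) ->
  light_ray_extension Z A gam l kappa mu1 e lam N iota s u
    (light_ray_transform gam l kappa (pull_back N iota u)).
Proof.
move=> su cu iu; split => //; exists (fun=> u).
have sub0 (T : Type) (f : T -> R) : f \- f = fun=> 0 by apply/funext => x; rewrite /= subrr.
split => //.
  exists (fun _ _ => 0) => [k|]; first by rewrite sub0; exact: bessel0.
  by rewrite L2norm0; exact: cvg_cst.
by rewrite sub0 L2norm0; exact: cvg_cst.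
Qed.

Lemma wave_mass (R : realType) n (M : manifold R n.+1) (c : chart R M n.+1) (a : 'cV[R]_n.+1) chi lam
    (mu : {measure set (borel M) -> \bar R}) :
  let f b := lift c (oscillation a chi b lam) in
  sqint mu (lift c chi) -> (forall b, sqint mu (f b)) ->
  exists b, L2dot mu (lift c chi) (lift c chi) / 2 <= L2dot mu (f b) (f b).
Proof.
move=> f schi sf.
have E : L2dot mu (lift c chi) (lift c chi) = L2dot mu (f true) (f true) + L2dot mu (f false) (f false).
  rewrite /L2dot -RintegralD //; [|exact: integrable_mul|exact: integrable_mul].
  apply: eq_Rintegral => q _; rewrite /f /lift; case: asboolP => _; last by rewrite !mulr0 addr0.
  rewrite /oscillation /=; set t := lam * _.
  by have := cos2Dsin2 t; rewrite !expr2; move: (cos t) (sin t) (chi _) => u v w uv;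
    rewrite -[LHS]mulr1 -uv; ring.
have [h|h] := leP (L2dot mu (lift c chi) (lift c chi) / 2) (L2dot mu (f true) (f true)); first by exists true.
exists false; move: E h; move: (L2dot mu _ _) (L2dot mu (f true) _) (L2dot mu (f false) _) => u v w; lra.
Qed.

Theorem theorem4p4 (R : realType) (n : nat)
  (* the Lorentzian manifold and the reference geodesic *)
  (M : manifold R n.+1) (g : M -> 'M[R]_n.+1) (hg : lorentzian g)
  (l : R) (hl : 0 < l)
  (gam0 : R -> M) (hgam0 : lightlike_geodesic g l gam0)
  (* the parametrization of nearby lightlike geodesics by Z x A *)
  (c : chart R M n.+1) (T : R) (hT : 0 < T)
  (Z0 Z : set 'rV[R]_n) (hZ : coord_nbhd Z0 Z)
  (A0 A : set 'rV[R]_n.-1) (hA : coord_nbhd A0 A)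
  (g' : R -> 'rV[R]_n -> 'M[R]_n) (hc : semigeodesic g c T Z0 g')
  (theta : 'rV[R]_n -> 'rV[R]_n.-1 -> 'rV[R]_n)
  (htheta : sphere_coordinates (g' 0) Z0 A0 theta)
  (hstart0 : starts_at c gam0 0 (theta 0 0))
  (gam : 'rV[R]_n -> 'rV[R]_n.-1 -> R -> M)
  (hgam : forall z a, closure Z z -> closure A a ->
     lightlike_geodesic g l (gam z a) /\ starts_at c (gam z a) z (theta z a))
  (* the domain, the weight and the set S *)
  (Omega : set M) (hOmega : open Omega) (hOmegac : compact (closure Omega))
  (hends : forall z a, closure Z z -> closure A a ->
     ~ closure Omega (gam z a 0) /\ ~ closure Omega (gam z a l))
  (kappa : M -> 'rV[R]_n.+1 -> R) (hkappa : smooth_weight kappa)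
  (S : set M) (hSc : compact S) (hSOmega : S `<=` Omega)
  (hSint : interior S !=set0)
  (* L^2(Omega) and the spaces H^s_S(Omega) *)
  (G : M -> 'M[R]_n.+1) (hG : riemannian Omega G)
  (mu : {measure set (borel M) -> \bar R}) (hmu : is_volume Omega G mu)
  (M1 : manifold R n.+1) (hM1 : compact [set: M1])
  (g1 : M1 -> 'M[R]_n.+1) (hg1 : riemannian setT g1)
  (mu1 : {measure set (borel M1) -> \bar R}) (hmu1 : is_volume setT g1 mu1)
  (N : set M) (hSN : S `<=` N) (hNOmega : N `<=` Omega)
  (iota : M -> M1) (iotaV : M1 -> M)
  (hiota : isometric_open_embedding G g1 N iota iotaV)
  (e : nat -> M1 -> R) (lam : nat -> R) (he : eigenbasis g1 mu1 e lam)
  (* the stability estimate *)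
  (delta r : R) (hdelta : 0 < delta) (hr : 0 < r)
  (omega : R -> R) (homega : modulus_of_continuity omega)
  (hstab : forall (f1 f2 : M1 -> R) (w1 w2 : borel 'rV[R]_(n + n.-1) -> R),
     sobolev_ball mu1 e lam (iota @` S) delta r f1 ->
     sobolev_ball mu1 e lam (iota @` S) delta r f2 ->
     light_ray_extension Z A gam l kappa mu1 e lam N iota delta f1 w1 ->
     light_ray_extension Z A gam l kappa mu1 e lam N iota delta f2 w2 ->
     (L2norm mu Omega (pull_back N iota f1 \- pull_back N iota f2)%R <=
      (omega (fine (L2norm (leb R (n + n.-1)) (param_space Z A)
                           (w1 \- w2)%R)))%:E)%E)
  (alpha : R) (halpha : 0 < alpha < 1) :
  exists C t0 : R, [/\ 0 < C, 0 < t0 &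
    forall t, 0 < t < t0 -> C * t `^ alpha <= omega t].
Proof.
have [[oN oiN] VK si sV _] := hiota.
have [_ oZ _ cZ _] := hZ; have [_ oA _ cA _] := hA.
have lg z a : closure Z z -> closure A a -> lightlike_geodesic g l (gam z a).
  by move=> Zz Aa; have [] := hgam z a Zz Aa.
have hstart z a : closure Z z -> closure A a -> starts_at c (gam z a) z (theta z a).
  by move=> Zz Aa; have [] := hgam z a Zz Aa.
have cP := params_compact hZ hA.
have init := initial_state_cvg hT hZ hA hc htheta hstart.
have [p0 Sp0] := hSint.
(* A chart domain inside S lies in N and in Omega as well: the lifted functions are supported in S,
   and the ends of the rays, which are outside the closure of Omega, miss the patch. *)
have [c0 [ac0 dE [pE psE]]] := restricted_chart (chart_at_atlas p0) (@open_interior _ S).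
have c0S : cdom c0 `<=` S by rewrite dE => p [_ /interior_subset].
have c0N : cdom c0 `<=` N by move=> p /c0S /hSN.
have c0O : cdom c0 `<=` Omega by move=> p /c0S /hSOmega.
have cp0 : cdom c0 p0 by rewrite dE; split => //; exact: chart_at_dom.
pose x0 := cphi c0 p0.
have cx0 : cim c0 x0 by exact: cim_cphi.
have [a na] := null_covector hg ac0 cx0.
have nc : \forall x \near x0, cim c0 x by apply: (open_near (cim_open (c := c0)) cx0).
have /nbhs_ballP[e0 /= e00 He0] : \forall x \near x0, cim c0 x /\ forall v : 'rV[R]_n.+1,
    v != 0 -> v *m gram g c0 x *m v^T = 0 -> (v *m a) 0 0 != 0.
  exact: filterI nc na.
pose U : set 'rV[R]_n.+1 := ball x0 e0.
have oU : open U by exact: ball_open.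
have Uc : U `<=` cim c0 by move=> x /He0 [].
have null x : U x -> forall v : 'rV[R]_n.+1, v != 0 ->
    v *m gram g c0 x *m v^T = 0 -> (v *m a) 0 0 != 0 by move=> /He0 [].
pose rho := e0 / 2.
have rho0 : 0 < rho by rewrite divr_gt0.
have KU : box x0 rho `<=` U.
  move=> x Kx; rewrite /U -ball_normE /= distrC; apply: box_sub_ball Kx; first exact: ltW.
  by rewrite /rho; move: (e0) e00 => u; lra.
have KU0 : box x0 rho `<=` cim c0 by move=> x /KU /Uc.
have ends p : params Z A p -> ~ patch c0 U (rays gam p 0) /\ ~ patch c0 U (rays gam p l).
  move=> [Zp Ap]; have [h1 h2] := hends _ _ Zp Ap.
  by split=> -[/c0O Op _]; [apply: h1|apply: h2]; exact: subset_closure.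
have [c2 [ac2 dE2 [pE2 psE2]]] := transported_chart oN oiN VK si sV ac0 c0N.
have KU2 : box x0 rho `<=` cim c2.
  move=> x /KU0 cx; exists (iota (cpsi c0 x)).
    by rewrite dE2; exists (cpsi c0 x) => //; exact: cdom_cpsi.
  by rewrite pE2 /= VK ?cpsiK //; apply: c0N; exact: cdom_cpsi.
have core2 : core c2 x0 rho `<=` iota @` S.
  move=> _ [x Kx <-]; rewrite psE2; exists (cpsi c0 x) => //.
  by apply: c0S; apply: cdom_cpsi; exact: KU0.
have [chi [schi chi0 chip chiz]] := smooth_cutoff x0 rho0.
have tchi : test x0 rho chi by split.
have chix0 : chi x0 != 0 by rewrite gt_eqF //; apply: chip => i; rewrite subrr normr0.
have tosc b lm := oscillating_test lm (osc_wave a b tchi) : test x0 rho (oscillation a chi b lm).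
have tscale s F : test x0 rho F -> test x0 rho (fun x => s * F x).
  move=> [sF F0]; split; first by apply: smooth_onZ => //; exact: openT.
  by move=> x /F0 ->; rewrite mulr0.
have sq0 F : test x0 rho F -> sqint mu (lift c0 F) by exact: (sqint_test ac0 KU0 hG c0O hmu).
have sob : exists (C : R) (k : nat), 0 <= C /\ forall b lm, 1 <= lm -> exists v,
    bessel mu1 e lam delta (lift c2 (oscillation a chi b lm)) v /\ L2dot mu1 v v <= (C * lm ^+ k) ^+ 2.
  have H b := oscillating_sobolev ac2 KU2 hg1 hmu1 he hdelta (osc_wave a b tchi).
  have [C1 [k1 [C10 H1]]] := H true; have [C2 [k2 [C20 H2]]] := H false.
  exists (C1 + C2), (maxn k1 k2); split; first exact: addr_ge0.
  have mono D j lm : 0 <= D -> D <= C1 + C2 -> (j <= maxn k1 k2)%N -> 1 <= lm ->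
      (D * lm ^+ j) ^+ 2 <= ((C1 + C2) * lm ^+ maxn k1 k2) ^+ 2.
    move=> D0 DC jk lm1; have lm0 : 0 <= lm by exact: le_trans lm1.
    rewrite lerXn2r ?nnegrE ?mulr_ge0 ?exprn_ge0 ?addr_ge0 //.
    by apply: ler_pM => //; rewrite ?exprn_ge0 //; exact: ler_weXn2l.
  case=> lm lm1.
    have [v [bv _ vC]] := H1 lm lm1; exists v; split => //; apply: le_trans vC _.
    by apply: mono => //; [rewrite lerDl|exact: leq_maxl].
  have [v [bv _ vC]] := H2 lm lm1; exists v; split => //; apply: le_trans vC _.
  by apply: mono => //; [rewrite lerDr|exact: leq_maxr].
have [C [k [C0 HC]]] := sob.
have [omono _ _ _] := homega; have [al0 _] := andP halpha.
pose m0 := L2dot mu (lift c0 chi) (lift c0 chi) / 2.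
have m00 : 0 < m0 by rewrite divr_gt0 // (lift_mass_gt0 ac0 KU0 hG c0O hmu rho0 tchi chix0).
pose D := param_space Z A; pose LD := Num.sqrt (fine (leb R (n + n.-1) D)).
(* The wave times s = r / (C + 1) / lam^k lies in the ball of radius r, and its L^2 norm is at least
   s times the square root of m0. The denominator is C + 1 because C may be 0. *)
apply: (@modulus_lower_bound _ omega (r / (C + 1) * Num.sqrt m0) k alpha omono) => //.
  by rewrite mulr_gt0 ?sqrtr_gt0 // divr_gt0 // ltr_wpDl.
move=> J; have [B B0 HB] := transform_decay hg hl cP lg init ac0 oU Uc KU hkappa null ends J tchi.
have rB0 : 0 <= r * B * LD by rewrite !mulr_ge0 ?sqrtr_ge0 // ltW.
(* The transform is bounded by s B / lam^J, its norm by LD times this, and s <= r; the summand 1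
   makes the constant strictly positive. *)
exists (r * B * LD + 1); first by rewrite ltr_wpDl.
move=> lm lm1; have lm0 : 0 < lm by exact: lt_le_trans lm1.
have [b mb] := wave_mass (sq0 chi tchi) (fun b => sq0 _ (tosc b lm)).
have [v [bv vC]] := HC b lm lm1.
pose s := r / (C + 1) / lm ^+ k.
have C10 : 0 < C + 1 by rewrite ltr_wpDl.
have lmk : 0 < lm ^+ k by rewrite exprn_gt0.
have s0 : 0 < s by rewrite !divr_gt0.
pose F x := s * oscillation a chi b lm x.
have tF : test x0 rho F by apply: tscale; exact: tosc.
have t0 : test x0 rho (fun=> 0) by split => //; apply: smooth_on_cst; exact: openT.
have pbE G1 : test x0 rho G1 -> pull_back N iota (lift c2 G1) = lift c0 G1.
  exact: (lift_pull_back KU0 c0N VK dE2 pE2).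
have tm G1 : test x0 rho G1 -> measurable_fun D (transform l gam c0 kappa G1).
  exact: (transform_measurable hg hl oZ oA lg init ac0 oU Uc KU hkappa null).
have mD : measurable D by exact: param_space_measurable.
have Dlt : (leb R (n + n.-1) D < +oo)%E by exact: leb_param_space_lty.
have tF_le y : D y -> `|transform l gam c0 kappa F y| <= s * (B / lm ^+ J).
  by move=> Dy; have := HB b lm s y Dy lm1; rewrite (gtr0_norm s0).
have BJ : 0 <= s * (B / lm ^+ J) by rewrite mulr_ge0 ?divr_ge0 ?exprn_ge0 // ltW.
have [iF LF] := bounded_L2 mD Dlt (tm F tF) BJ tF_le.
have T0 : transform l gam c0 kappa (fun=> 0) = fun=> 0.
  apply/funext => y; rewrite /transform lift0 /weighted_ray_transform.
  by under eq_Rintegral do rewrite mulr0; rewrite /Rintegral integral0.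
have i0 : in_L2 (leb R (n + n.-1)) D (fun=> 0) by split; [exact: measurable_cst|rewrite L2norm0].
have ext G1 : test x0 rho G1 -> in_L2 (leb R (n + n.-1)) D (transform l gam c0 kappa G1) ->
    light_ray_extension Z A gam l kappa mu1 e lam N iota delta (lift c2 G1) (transform l gam c0 kappa G1).
  move=> tG iG; have tE : transform l gam c0 kappa G1 = light_ray_transform gam l kappa (pull_back N iota (lift c2 G1)).
    by rewrite pbE.
  rewrite tE; apply: light_ray_extension_smooth; [exact: (smooth_lift ac2 KU2)| |by rewrite -tE].
  (* The lift vanishes off the core, and the core is closed, so it also contains the closure of the
     set where the lift is nonzero. *)
  move=> q cq; have cc : core c2 x0 rho q.
    have cl := lift_core_closed KU2; rewrite closure_id in cl; rewrite cl.
    apply: closureS cq => p /= /eqP np; apply: contrapT => nc2; apply: np.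
    exact: (lift_out tG nc2).
  by have [p Sp pq] := core2 _ cc; exists p => //; exact: hSN.
have ball1 : sobolev_ball mu1 e lam (iota @` S) delta r (lift c2 F).
  apply: (sobolev_ball_lift KU2 tF core2 (v := fun q => s * v q)); [|exact: ltW|].
    by rewrite /F liftZ; exact: (besselZ he).
  have [_ /in_L2P sv _] := bv.
  rewrite (dotZ2 s sv); apply: le_trans (ler_wpM2l (sqr_ge0 s) vC) _; rewrite -exprMn.
  have sC : s * (C * lm ^+ k) = r * (C / (C + 1)).
    rewrite /s; have := lt0r_neq0 C10; have := lt0r_neq0 lmk.
    by move: (lm ^+ k) (C + 1) (C) (r) => q p x y q0 p0'; field; rewrite ?q0 ?p0'.
  have C1 : 0 <= C / (C + 1) <= 1 by rewrite divr_ge0 ?(ltW C10) //= ler_pdivrMr // mul1r lerDl.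
  have [h1 h2] := andP C1; rewrite sC lerXn2r ?nnegrE ?(mulr_ge0 (ltW hr) h1) ?(ltW hr) //.
  by rewrite ger_pMr.
have ball2 : sobolev_ball mu1 e lam (iota @` S) delta r (lift c2 (fun=> 0)).
  apply: (sobolev_ball_lift KU2 t0 core2 (v := fun=> 0)); [|exact: ltW|].
    by rewrite lift0; exact: bessel0.
  by rewrite dot0l sqr_ge0.
have i0' : in_L2 (leb R (n + n.-1)) D (transform l gam c0 kappa (fun=> 0)) by rewrite T0.
have := hstab _ _ _ _ ball1 ball2 (ext F tF iF) (ext _ t0 i0').
rewrite !pbE // lift0 T0.
have sub0 (T1 : Type) (f : T1 -> R) : f \- (fun=> 0) = f by apply/funext => x /=; rewrite subr0.
rewrite !sub0.
have patchO : lift c0 F \_ Omega = lift c0 F.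
  apply/funext => q; rewrite patchE; case: ifPn => // /negP; rewrite inE => nq.
  by rewrite /lift asboolF // => /c0O.
rewrite L2norm_patch patchO (L2normE (sq0 F tF)) lee_fin => H.
apply: le_trans (le_trans H _).
  have -> : Num.sqrt (L2dot mu (lift c0 F) (lift c0 F)) =
      s * Num.sqrt (L2dot mu (lift c0 (oscillation a chi b lm)) (lift c0 (oscillation a chi b lm))).
    by rewrite /F liftZ (dotZ2 s (sq0 _ (tosc b lm))) sqrtrM ?sqr_ge0 // sqrtr_sqr (gtr0_norm s0).
  rewrite (mulrAC (r / (C + 1))); apply: ler_wpM2l; first exact: ltW.
  exact: ler_wsqrtr.
apply: omono; first by rewrite fine_ge0 // Lnorm_ge0.
apply: le_trans LF _; rewrite -/LD.
have sr : s <= r.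
  rewrite /s -mulrA -invfM ler_pdivrMr ?mulr_gt0 //; apply: ler_peMr; first exact: ltW.
  by apply: mulr_ege1; [rewrite lerDr|exact: exprn_ege1].
rewrite mulrA mulrAC; apply: ler_wpM2r; first by rewrite invr_ge0 exprn_ge0 // ltW.
apply: le_trans (_ : r * B * LD <= _); last by rewrite lerDl.
by rewrite ler_wpM2r ?sqrtr_ge0 // ler_wpM2r.
Qed.
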